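(* Let $\mathbb{K}$ be an algebraically closed field of characteristic zero and let $G$ be a connected commutative linear algebraic group over $\mathbb{K}$. The number of isomorphy (equivalence) classes of prehomogeneous $G$-modules is finite if and only if the corank of $G$ is at most $5$.
   Context: $\mathbb{G}_m$ and $\mathbb{G}_a$ denote the multiplicative and additive groups of $\mathbb{K}$. Every connected commutative linear algebraic group $G$ is isomorphic to $(\mathbb{G}_m)^r\times(\mathbb{G}_a)^s$ with some non-negative integers $r$ and $s$; $r$ is called the rank and $s$ the corank of $G$. A prehomogeneous $G$-module is a finite dimensional $\mathbb{K}$-vector space $V$ with an effective linear algebraic action of $G$ (so that $G$ is identified with a closed subgroup of $\mathrm{GL}(V)$) that has an open orbit in $V$. A $G$-module $V$ is equivalent to a $G'$-module $V'$ if there exists an isomorphism of vector spaces $V\to V'$ such that the induced isomorphism $\mathrm{GL}(V)\to\mathrm{GL}(V')$ identifies the subgroups $G$ and $G'$; prehomogeneous $G$-modules are counted up to this equivalence.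
   Formalization: The case of rank 0 and corank at least 6 is excluded: there G is a nontrivial unipotent group, which has no prehomogeneous module at all, so the number of classes is 0 (finite) although the corank exceeds 5. *)

(* Defs.v *)
From HB Require Import structures.
From mathcomp Require Import all_boot all_order all_algebra.
From mathcomp Require Import mpoly.

Set Implicit Arguments.
Unset Strict Implicit.
Unset Printing Implicit Defensive.

Import GRing.Theory.
Local Open Scope ring_scope.

Section Zariski.
Variable K : fieldType.

Definition zclosed n (X : 'rV[K]_n -> Prop) : Prop :=
  exists S : {mpoly K[n]} -> Prop,
    forall x, X x <-> (forall p, S p -> p.@[x 0] = 0).

Definition zconnected n (X : 'rV[K]_n -> Prop) : Prop :=
  ~ exists Y Z : 'rV[K]_n -> Prop,
      [/\ zclosed Y /\ zclosed Z,
          forall x, X x -> Y x \/ Z x,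
          forall x, X x -> ~ (Y x /\ Z x),
          exists x, X x /\ Y x
        & exists x, X x /\ Z x].

(* On a closed subset of affine space the regular functions are exactly the
   restrictions of polynomials; the values of [f] off [X] are irrelevant. *)
Definition regular_on n m (X : 'rV[K]_n -> Prop)
    (f : 'rV[K]_n -> 'rV[K]_m) : Prop :=
  exists F : 'I_m -> {mpoly K[n]},
    forall x, X x -> forall j, f x 0 j = (F j).@[x 0].

(* Openness in the Zariski topology of a vector space does not depend on the
   basis used to identify it with affine space. *)
Definition zopen_in (V : vectType K) (X : V -> Prop) : Prop :=
  zclosed (fun x : 'rV[K]_(\dim {:V}) => ~ X (passmx.vecof (vbasis {:V}) x)).

End Zariski.

(* A linear algebraic group is an affine variety, given here as a Zariski
   closed set of points of some affine space, with a group structure whose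
   multiplication and inverse are morphisms of varieties.  The operations are
   total functions on the ambient space, constrained only on the points. *)
Record linAlgGroup (K : fieldType) := LinAlgGroup {
  lag_dim : nat;
  lag_pt : 'rV[K]_lag_dim -> Prop;
  lag_one : 'rV[K]_lag_dim;
  lag_mul : 'rV[K]_lag_dim -> 'rV[K]_lag_dim -> 'rV[K]_lag_dim;
  lag_inv : 'rV[K]_lag_dim -> 'rV[K]_lag_dim;
  lag_closed : zclosed lag_pt;
  lag_mul_regular :
    regular_on (fun z : 'rV[K]_(lag_dim + lag_dim) =>
                  lag_pt (lsubmx z) /\ lag_pt (rsubmx z))
               (fun z => lag_mul (lsubmx z) (rsubmx z));
  lag_inv_regular : regular_on lag_pt lag_inv;
  lag_pt1 : lag_pt lag_one;
  lag_ptM : forall x y, lag_pt x -> lag_pt y -> lag_pt (lag_mul x y);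
  lag_ptV : forall x, lag_pt x -> lag_pt (lag_inv x);
  lag_mulA : forall x y z, lag_pt x -> lag_pt y -> lag_pt z ->
    lag_mul x (lag_mul y z) = lag_mul (lag_mul x y) z;
  lag_mul1 : forall x, lag_pt x -> lag_mul lag_one x = x;
  lag_mulV : forall x, lag_pt x -> lag_mul (lag_inv x) x = lag_one
}.

Section Groups.
Variable K : fieldType.
Implicit Types G H : linAlgGroup K.

Definition lag_connected G : Prop := zconnected (@lag_pt K G).

Definition lag_commutative G : Prop :=
  forall x y : 'rV[K]_(lag_dim G),
    lag_pt x -> lag_pt y -> lag_mul x y = lag_mul y x.

Definition lag_isomorphic G H : Prop :=
  exists (f : 'rV[K]_(lag_dim G) -> 'rV[K]_(lag_dim H))
         (h : 'rV[K]_(lag_dim H) -> 'rV[K]_(lag_dim G)),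
    [/\ regular_on (@lag_pt K G) f /\ regular_on (@lag_pt K H) h,
        forall x, lag_pt x -> lag_pt (f x) /\ h (f x) = x,
        forall y, lag_pt y -> lag_pt (h y) /\ f (h y) = y
      & forall x y, lag_pt x -> lag_pt y ->
          f (lag_mul x y) = lag_mul (f x) (f y)].

End Groups.

(* (G_m)^r x (G_a)^s, realised on the closed set of all (t, u, a) in
   K^r x K^r x K^s with t_i u_i = 1 for every i. *)
Section TorusVector.
Variables (K : fieldType) (r s : nat).
Local Notation pt := 'rV[K]_(r + r + s).

Definition tv_t (x : pt) : 'rV[K]_r := lsubmx (lsubmx x).
Definition tv_u (x : pt) : 'rV[K]_r := rsubmx (lsubmx x).
Definition tv_a (x : pt) : 'rV[K]_s := rsubmx x.
Definition tv_mk (t u : 'rV[K]_r) (a : 'rV[K]_s) : pt := row_mx (row_mx t u) a.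

Definition tv_pt (x : pt) : Prop := forall i, tv_t x 0 i * tv_u x 0 i = 1.
Definition tv_one : pt := tv_mk (const_mx 1) (const_mx 1) 0.
Definition tv_mul (x y : pt) : pt :=
  tv_mk (\row_i (tv_t x 0 i * tv_t y 0 i)) (\row_i (tv_u x 0 i * tv_u y 0 i))
        (tv_a x + tv_a y).
Definition tv_inv (x : pt) : pt := tv_mk (tv_u x) (tv_t x) (- tv_a x).

Lemma tv_mkE t u a :
  (tv_t (tv_mk t u a) = t) * (tv_u (tv_mk t u a) = u) *
  (tv_a (tv_mk t u a) = a).
Proof. by rewrite /tv_t /tv_u /tv_a !(row_mxKl, row_mxKr). Qed.

Lemma tv_mkK x : tv_mk (tv_t x) (tv_u x) (tv_a x) = x.
Proof. by rewrite /tv_mk !hsubmxK. Qed.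

Lemma tv_closed : zclosed tv_pt.
Proof.
exists (fun p => exists i, p = 'X_(lshift s (lshift r i))
                             * 'X_(lshift s (rshift r i)) - 1).
move=> x; split=> [xP p [i ->]|xP i].
  rewrite mevalB mevalM !mevalXU meval1.
  by have := xP i; rewrite !mxE => ->; rewrite subrr.
have := xP _ (ex_intro _ i erefl).
by rewrite mevalB mevalM !mevalXU meval1 !mxE => /eqP; rewrite subr_eq0 => /eqP.
Qed.

Lemma tv_mul_regular :
  regular_on (fun z : 'rV[K]_((r + r + s) + (r + r + s)) =>
                tv_pt (lsubmx z) /\ tv_pt (rsubmx z))
             (fun z => tv_mul (lsubmx z) (rsubmx z)).
Proof.
exists (fun j => match split j with
  | inl _ => 'X_(lshift _ j) * 'X_(rshift _ j)
  | inr _ => 'X_(lshift _ j) + 'X_(rshift _ j)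
  end) => z _ j.
case: (split_ordP j) => k ->; last first.
  by rewrite row_mxEr mevalD !mevalXU !mxE.
rewrite row_mxEl mevalM !mevalXU.
by case: (split_ordP k) => i ->; rewrite (row_mxEl, row_mxEr) !mxE.
Qed.

Lemma tv_inv_regular : regular_on tv_pt tv_inv.
Proof.
exists (fun j => match split j with
  | inl k => match split k with
             | inl i => 'X_(lshift s (rshift r i))
             | inr i => 'X_(lshift s (lshift r i))
             end
  | inr _ => - 'X_j
  end) => x _ j.
case: (split_ordP j) => k ->; last by rewrite row_mxEr mevalN mevalXU !mxE.
rewrite row_mxEl.
by case: (split_ordP k) => i ->; rewrite (row_mxEl, row_mxEr) mevalXU !mxE.
Qed.

Lemma tv_pt1 : tv_pt tv_one.
Proof. by move=> i; rewrite !tv_mkE mxE mulr1. Qed.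

Lemma tv_ptM x y : tv_pt x -> tv_pt y -> tv_pt (tv_mul x y).
Proof.
move=> xP yP i; rewrite !tv_mkE [X in X * _]mxE [X in _ * X]mxE mulrACA.
by rewrite xP yP mulr1.
Qed.

Lemma tv_ptV x : tv_pt x -> tv_pt (tv_inv x).
Proof. by move=> xP i; rewrite !tv_mkE mulrC xP. Qed.

Lemma tv_mulA x y z : tv_pt x -> tv_pt y -> tv_pt z ->
  tv_mul x (tv_mul y z) = tv_mul (tv_mul x y) z.
Proof.
move=> _ _ _; rewrite /tv_mul !tv_mkE addrA.
by congr tv_mk; apply/rowP=> i; rewrite !mxE mulrA.
Qed.

Lemma tv_mul1 x : tv_pt x -> tv_mul tv_one x = x.
Proof.
move=> _; rewrite -[RHS]tv_mkK /tv_mul !tv_mkE add0r.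
by congr tv_mk; apply/rowP=> i; rewrite !mxE mul1r.
Qed.

Lemma tv_mulV x : tv_pt x -> tv_mul (tv_inv x) x = tv_one.
Proof.
move=> xP; rewrite /tv_mul !tv_mkE addNr.
by congr tv_mk; apply/rowP=> i; rewrite [LHS]mxE [RHS]mxE // mulrC.
Qed.

Definition torus_vector_group : linAlgGroup K :=
  LinAlgGroup tv_closed tv_mul_regular tv_inv_regular
              tv_pt1 tv_ptM tv_ptV tv_mulA tv_mul1 tv_mulV.

End TorusVector.

Definition has_rank_corank (K : fieldType) (G : linAlgGroup K) (r s : nat) :
    Prop :=
  lag_isomorphic G (torus_vector_group K r s).

(* Only the values of the action at the points of [G] matter.  A linear action
   is algebraic iff its matrix coefficients are regular functions on [G]. *)
Record prehomModule (K : fieldType) (G : linAlgGroup K) := PrehomModule {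
  phm_space : vectType K;
  phm_act : 'rV[K]_(lag_dim G) -> 'End(phm_space);
  phm_act1 : phm_act (lag_one G) = \1%VF;
  phm_actM : forall x y, lag_pt x -> lag_pt y ->
    phm_act (lag_mul x y) = (phm_act x \o phm_act y)%VF;
  phm_regular : regular_on (@lag_pt K G) (fun x =>
    mxvec (passmx.mxof (vbasis {:phm_space}) (vbasis {:phm_space})
                       (phm_act x)));
  phm_effective : forall x, lag_pt x -> phm_act x = \1%VF -> x = lag_one G;
  phm_open_orbit : exists v : phm_space,
    zopen_in (fun w => exists2 x, lag_pt x & w = phm_act x v)
}.

Section Equivalence.
Variable K : fieldType.

Definition phm_image (G : linAlgGroup K) (M : prehomModule G)
    (a : 'End(phm_space M)) : Prop :=
  exists2 x, lag_pt x & a = phm_act M x.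

(* The isomorphism of vector spaces only has to match the images of the groups
   as subgroups, so it need not intertwine the two actions. *)
Definition phm_equiv (G H : linAlgGroup K)
    (M : prehomModule G) (N : prehomModule H) : Prop :=
  exists (f : 'Hom(phm_space M, phm_space N))
         (h : 'Hom(phm_space N, phm_space M)),
    [/\ (h \o f)%VF = \1%VF, (f \o h)%VF = \1%VF
      & forall a : 'End(phm_space M),
          phm_image a <-> phm_image (f \o a \o h)%VF].

Definition finitely_many_prehomModules (G : linAlgGroup K) : Prop :=
  exists (k : nat) (L : 'I_k -> prehomModule G),
    forall M : prehomModule G, exists i, phm_equiv M (L i).

End Equivalence.

(* Main.v *)
Require Import Defs.
From mathcomp Require Import all_boot all_order all_algebra.
From HB Require Import structures.
From mathcomp Require Import falgebra mpoly ring zify.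
From Stdlib Require Import Classical ClassicalEpsilon.

(* Acting on a point [v] of the open orbit identifies [V] with a commutative
   algebra [A] in which [G] becomes the group of all units.  Its torus-vector
   structure bounds [A]: nilpotent subspaces have dimension at most [s], being
   spanned by the velocities of one-parameter subgroups, and there are at most
   [r] orthogonal idempotents, since these produce square roots of 1.

   If [s <= 5], the maximal ideal of every local factor of [A] has dimension at
   most 5, and such a nilpotent algebra has a basis in which the product of two
   elements is [0] or an element of the basis (by cases on the dimensions of
   [N], [N^2] and [N^3]).  Hence finitely many multiplication tables suffice.

   If [s >= 6], the local algebras [K + K^(s-2) + K^2] whose multiplication is
   the pencil spanned by [sum x_i^2] and [sum d_i x_i^2] give modules, and an
   equivalence induces a homography taking each [d_i] to some [d'_k].  For
   [d = (0, 1, 2, la, la, ...)] the cross ratio leaves only finitely many values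
   of [la] in each class. *)

Set Implicit Arguments.
Unset Strict Implicit.
Unset Printing Implicit Defensive.

Import GRing.Theory.
Local Open Scope ring_scope.

(** * Commutative finite-dimensional algebras *)

(** The threshold is the first appearance of moduli. The discriminant of a pencil of quadrics in n
    variables has n roots on the projective line, and up to homography such root sets carry a
    continuous invariant only from n = 4 on; with the two dimensions of the pencil itself this gives
    a maximal ideal of dimension 4 + 2 = 6. Below that, all structure constants can be shifted or
    scaled to 0 or 1 by solving equations of degree at most 3. Characteristic zero enters through
    division by 2, 3 and factorials, and through the natural numbers as infinitely many test points
    for polynomial identities. Equivalence compares only the images of [G]. Since each image is the
    full unit group of an algebra, isomorphic algebras give equivalent modules, and finiteness needs
    only upper bounds on the idempotents and nilpotents of a basis. Conversely, an equivalence
    matches the unit groups but may move the unit element, so it must be corrected before it becomes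
    an algebra map. *)

#[short(type="comFalgType")]
HB.structure Definition ComFalgebra (K : fieldType) :=
  {A of Falgebra K A & GRing.ComUnitAlgebra K A}.

Lemma scale_in_alg (K : fieldType) (A : comFalgType K) (a : K) (x : A) :
  a *: x = in_alg A a * x.
Proof. by rewrite in_algE mulr_algl. Qed.

Ltac algring := rewrite ?scale_in_alg; ring.

(** * Nilpotent elements, nilpotent subspaces and Nakayama's lemma *)

Section Nilpotence.
Variables (K : fieldType) (A : comFalgType K).
Implicit Types (U V N I J : {vspace A}) (x y z : A) (B : seq A).

Definition nilpotent x := exists n, x ^+ n = 0.

Lemma nilpotentW x m n : x ^+ m = 0 -> (m <= n)%N -> x ^+ n = 0.
Proof. by move=> x0 /subnK<-; rewrite exprD x0 mulr0. Qed.

Lemma nilpotent0 : nilpotent 0.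
Proof. by exists 1%N; rewrite expr1. Qed.

Lemma nilpotentMl x y : nilpotent x -> nilpotent (y * x).
Proof. by case=> n x0; exists n; rewrite exprMn x0 mulr0. Qed.

Lemma nilpotentZ a x : nilpotent x -> nilpotent (a *: x).
Proof. by move=> x0; rewrite -mulr_algl; apply: nilpotentMl. Qed.

Lemma nilpotentD x y : nilpotent x -> nilpotent y -> nilpotent (x + y).
Proof.
move=> [m x0] [n y0]; exists (m + n)%N; rewrite exprDn big1 // => i _.
have [le_ni|lt_in] := leqP n i.
  by rewrite (nilpotentW y0 le_ni) mulr0 mul0rn.
rewrite (nilpotentW x0) ?mul0r ?mul0rn //; lia.
Qed.

Lemma nilpotentN x : nilpotent x -> nilpotent (- x).
Proof. by move=> x0; rewrite -mulN1r; apply: nilpotentMl. Qed.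

Lemma nilpotentB x y : nilpotent x -> nilpotent y -> nilpotent (x - y).
Proof. by move=> x0 y0; apply/nilpotentD/nilpotentN. Qed.

Lemma nilpotent_sum (I : Type) (r : seq I) (F : I -> A) :
  (forall i, nilpotent (F i)) -> nilpotent (\sum_(i <- r) F i).
Proof.
move=> F0; elim/big_ind: _ => //; [exact: nilpotent0|exact: nilpotentD].
Qed.

Lemma nilpotent_span B : {in B, forall x, nilpotent x} ->
  {in <<B>>%VS, forall x, nilpotent x}.
Proof.
move=> B0 x /(coord_span (X := in_tuple B))->; apply: nilpotent_sum => i; apply: nilpotentZ.
by apply: B0; rewrite mem_nth.
Qed.

Lemma prodvC : commutative (@prodv K A).
Proof.
move=> U V; apply/eqP; rewrite eqEsubv.
by apply/andP; split; apply/prodvP=> u v Uu Vv; rewrite mulrC memv_mul.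
Qed.

(** Pigeonhole: among [a + b] factors from [U] or [V], at least [a] come from [U] or at least [b]
    from [V]; the factor [{:A}] in [key] absorbs the others. *)
Lemma expvDnil U V m n : (U ^+ m = 0)%VS -> (V ^+ n = 0)%VS ->
  ((U + V) ^+ (m + n) = 0)%VS.
Proof.
move=> U0 V0.
have key a b : ((U + V) ^+ (a + b) <= U ^+ a * {:A} + V ^+ b * {:A})%VS.
  move: {2}(a + b)%N (leqnn (a + b)) => c.
  elim: c a b => [|c IHc] [|a] [|b] le_c;
    rewrite ?expv0 ?prod1v ?(subv_trans (subvf _) (addvSl _ _))
            ?(subv_trans (subvf _) (addvSr _ _)) //.
  rewrite addSn [((U + V) ^+ _)%VS]expvSl prodvDl subv_add.
  apply/andP; split.
    have /(prodvSr U) : ((U + V) ^+ (a + b.+1) <= U ^+ a * {:A} + V ^+ b.+1 * {:A})%VS.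
      by apply: IHc; lia.
    move/subv_trans; apply; rewrite prodvDr !prodvA -expvSl addvS //.
    by rewrite [(U * _)%VS]prodvC -prodvA prodvSr ?subvf.
  have /(prodvSr V) : ((U + V) ^+ (a + b.+1) <= U ^+ a.+1 * {:A} + V ^+ b * {:A})%VS.
    by rewrite -addSnnS; apply: IHc; lia.
  move/subv_trans; apply; rewrite prodvDr !prodvA -expvSl addvS //.
  by rewrite [(V * _)%VS]prodvC -prodvA prodvSr ?subvf.
by apply/eqP; rewrite -subv0 (subv_trans (key m n)) // U0 V0 !prod0v addv0.
Qed.

Lemma expv_span_nil B : {in B, forall x, nilpotent x} ->
  exists n, (<<B>> ^+ n = 0)%VS.
Proof.
elim: B => [|x B IHB] B0; first by exists 1%N; rewrite expv1 span_nil.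
have [n n0] := IHB (fun y By => B0 y (mem_behead (s := x :: B) By)).
have [m m0] := B0 x (mem_head x B).
by exists (m + n)%N; rewrite span_cons expvDnil // expv_line m0.
Qed.

(** Substituting the inclusion into itself [n] times leaves [N ^+ n * I], which is zero, and terms
    [N ^+ m * J], which stay in [J]. *)
Lemma nakayama N I J n : (N ^+ n = 0)%VS -> (I <= J + N * I)%VS ->
  (N * J <= J)%VS -> (I <= J)%VS.
Proof.
move=> N0 le_I le_J.
have le_Jm m : (N ^+ m * J <= J)%VS.
  elim: m => [|m IHm]; first by rewrite expv0 prod1v.
  by rewrite expvSr -prodvA (subv_trans (prodvSr _ le_J)).
suffices: (I <= J + N ^+ n * I)%VS by rewrite N0 prod0v addv0.
elim: {N0}n => [|n IHn]; first by rewrite expv0 prod1v addvSr.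
apply: subv_trans IHn _; rewrite subv_add addvSl /=.
apply: subv_trans (prodvSr _ le_I) _; rewrite prodvDr prodvA -expvSr.
exact: addvS.
Qed.

Lemma nakayama0 N I n : (N ^+ n = 0)%VS -> (I <= N * I)%VS -> I = 0%VS.
Proof.
move=> N0 le_I; apply/eqP; rewrite -subv0.
by apply: (nakayama N0); rewrite ?prodv0 ?add0v.
Qed.

End Nilpotence.

(** * Equations of low degree over an algebraically closed field *)

Section ClosedField.
Variable K : closedFieldType.
Implicit Types a b c : K.

Lemma closed_sqrt a : exists s, s ^+ 2 = a.
Proof.
have [s /rootP] := closed_rootP ('X^2 - a%:P) ltac:(by rewrite size_XnsubC).
by rewrite !hornerE => /eqP; rewrite subr_eq0 => /eqP; exists s.
Qed.

Lemma closed_quadratic_root a b c : a != 0 -> exists t, a * t ^+ 2 + b * t + c = 0.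
Proof.
move=> a0; have sz : size (a *: 'X^2 + b *: 'X + c%:P) != 1%N.
  apply/eqP=> sz1; have := leq_trans (eq_leq sz1) (isT : 1 <= 2)%N; move/(nth_default 0).
  by rewrite !coefD !coefZ coefXn coefX coefC mulr1 mulr0 !addr0 => /eqP; apply/negP.
by have [t /rootP tP] := closed_rootP _ sz; exists t; rewrite -[RHS]tP !hornerE.
Qed.

Lemma closed_cubic_root a b c d :
  a != 0 -> exists t, a * t ^+ 3 + b * t ^+ 2 + c * t + d = 0.
Proof.
move=> a0; have sz : size (a *: 'X^3 + b *: 'X^2 + c *: 'X + d%:P) != 1%N.
  apply/eqP=> sz1; have := leq_trans (eq_leq sz1) (isT : 1 <= 3)%N; move/(nth_default 0).
  by rewrite !coefD !coefZ !coefXn coefX coefC mulr1 !mulr0 !addr0 => /eqP; apply/negP.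
by have [t /rootP tP] := closed_rootP _ sz; exists t; rewrite -[RHS]tP !hornerE.
Qed.

(** Scaling a generator by [s] scales its square by [s ^+ 2]; this is how a parameter in front of a
    square is turned into 0 or 1. *)
Lemma normalize_square a :
  exists2 s, s != 0 & s ^+ 2 * a = 0 \/ s ^+ 2 * a = 1.
Proof.
have [->|a0] := eqVneq a 0; first by exists 1; [exact: oner_neq0|left; rewrite mulr0].
have [s sP] := closed_sqrt a^-1; exists s; last by right; rewrite sP mulVf.
by apply: contraNneq a0 => s0; rewrite -invr_eq0 -sP s0 expr0n.
Qed.

Lemma binary_quadratic_factor a b c : exists p q r s : K,
  [/\ a = p * r, b = p * s + q * r & c = q * s] /\
  ((p, q) != (0, 0) /\ (r, s) != (0, 0) \/ (a, b, c) = (0, 0, 0)).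
Proof.
have [->|a0] := eqVneq a 0.
  exists 0, 1, b, c; split; first by split; ring.
  have [->|b0] := eqVneq b 0; last first.
    by left; rewrite !xpair_eqE !negb_and oner_neq0 b0 orbT.
  have [->|c0] := eqVneq c 0; first by right.
  by left; rewrite !xpair_eqE !negb_and oner_neq0 c0 !orbT.
(* With [t] a root, the form with coefficients [a], [b], [c] factors as
   [a (X - t Y) (X + (b / a + t) Y)]. *)
have [t tP] := closed_quadratic_root b c a0.
exists a, (- (a * t)), 1, (b / a + t); split; last first.
  by left; rewrite !xpair_eqE !negb_and a0 oner_neq0.
split; [by rewrite mulr1|by field|].
by apply/eqP; rewrite -subr_eq0; apply/eqP; rewrite -{}[RHS]tP; field.
Qed.

End ClosedField.

Section Monomial.
Variables (K : fieldType) (A : comFalgType K).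
Implicit Types (U V W N : {vspace A}) (x y z : A) (B X Y : seq A).

(** Products carry no scalar coefficient, so a basis of this kind reduces the whole multiplication
    to a finite combinatorial table. *)
Definition monomial B := {in B &, forall x y, x * y \in 0 :: B}.

Lemma memv_subv U V x : (U <= V)%VS -> x \in U -> x \in V.
Proof. by move/subvP; apply. Qed.

Lemma dim_addv_line v V : v \notin V -> \dim (<[v]> + V) = (\dim V).+1.
Proof.
move=> Vv; have v0 : v != 0 by apply: contraNneq Vv => ->; rewrite mem0v.
rewrite dimv_disjoint_sum ?dim_vline ?v0 //.
apply/eqP; rewrite -subv0; apply/subvP=> w /memv_capP[/vlineP[k ->]].
have [->|k0] := eqVneq k 0; first by rewrite scale0r !mem0v.
by move/(memvZ k^-1); rewrite scalerA mulVf // scale1r (negPf Vv).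
Qed.

Lemma memv_addline v w V : w \in (<[v]> + V)%VS -> exists a, w - a *: v \in V.
Proof.
move/memv_addP=> [_ /vlineP[a ->]] [u Vu ->].
by exists a; rewrite addrC addKr.
Qed.

Lemma memv_span2 x y w : w \in <<[:: x; y]>>%VS -> exists a b, w = a *: x + b *: y.
Proof.
rewrite span_cons => /memv_addline[a]; rewrite span_seq1 => /vlineP[b wE].
by exists a, b; rewrite -wE subrKC.
Qed.

Lemma span2_lin x y a b : a *: x + b *: y \in <<[:: x; y]>>%VS.
Proof. by rewrite memvD // memvZ // memv_span // !inE eqxx ?orbT. Qed.

Lemma basis1 U : \dim U = 1%N -> exists2 x, x != 0 & U = <[x]>%VS.
Proof.
move=> dU; have := vbasisP U; case: (vbasis U); rewrite dU => -[|x []] //= _ bU.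
by exists x; rewrite ?(basis_not0 bU) ?inE // -span_seq1 (span_basis bU).
Qed.

Lemma basis2 U : \dim U = 2 -> exists x y, basis_of U [:: x; y].
Proof.
move=> dU; have := vbasisP U; case: (vbasis U); rewrite dU => -[|x [|y []]] //=.
by exists x, y.
Qed.

Lemma basis2_comb U x y a b : basis_of U [:: x; y] -> (a, b) != (0, 0) ->
  a *: x + b *: y != 0.
Proof.
move=> /basis_free; rewrite free_cons span_seq1 seq1_free => /andP[xy y0] ab0.
apply/eqP=> abE; have [a0|a0] := eqVneq a 0.
  move: abE ab0; rewrite a0 scale0r add0r xpair_eqE eqxx /= => /eqP.
  by rewrite scaler_eq0 (negPf y0) orbF => ->.
case/vlineP: xy; exists (- (b / a)); apply: (scalerI a0).
rewrite scalerA mulrN mulrCA mulfV // mulr1 scaleNr.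
by apply/eqP; rewrite -addr_eq0 abE.
Qed.

End Monomial.

(** * Monomial bases of small nilpotent algebras *)

Section Curvilinear.
Variables (K : closedFieldType) (A : comFalgType K).
Hypothesis two_neq0 : 2 != 0 :> K.
Implicit Types (U V W N : {vspace A}) (x y z : A) (B X Y : seq A).

Definition annv x U := (U :&: lker (amull x))%VS.

Lemma memv_annv x U w : (w \in annv x U) = (w \in U) && (x * w == 0).
Proof. by rewrite memv_cap memv_ker lfunE. Qed.

Lemma squares_subv W V : {in W, forall y, y * y \in V} -> (W * W <= V)%VS.
Proof.
move=> sqZ; apply/prodvP=> x y Wx Wy.
have := memvB (memvB (sqZ _ (memvD Wx Wy)) (sqZ x Wx)) (sqZ y Wy).
have ->: (x + y) * (x + y) - x * x - y * y = 2 *: (x * y).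
  by rewrite scaler_nat; ring.
by move/(memvZ 2^-1); rewrite scalerA mulVf // scale1r.
Qed.

(** Multiplication on [W] is a symmetric bilinear form with values in a line. A vector of nonzero
    square is normalised to have square [z] and split off, its orthogonal complement being
    [annv x W]; when all squares vanish, polarisation kills every product. *)
Lemma diagonal_basis z W : (W * W <= <[z]>)%VS ->
  exists2 B, basis_of W B & {in B &, forall x y, x * y \in [:: 0; z]}.
Proof.
have [n] := ubnP (\dim W); elim: n W => // n IHn W; rewrite ltnS => le_n WW.
have [sq0|/not_all_ex_not[y /(imply_to_and (is_true _))]] :=
  classic (forall y, y \in W -> y * y = 0).
  exists (vbasis W); first exact: vbasisP.
  have WW0 : (W * W <= 0)%VS.
    by apply: squares_subv => y Wy; rewrite sq0 ?mem0v.
  move=> x y /vbasis_mem Wx /vbasis_mem Wy; rewrite inE.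
  by rewrite -memv0 (prodvP WW0).
case=> Wy /eqP yy0.
have /vlineP[c yyE] : y * y \in <[z]>%VS by apply: (prodvP WW).
have c0 : c != 0 by apply: contraNneq yy0 => c0; rewrite yyE c0 scale0r.
have [s sP] := closed_sqrt c^-1.
have s0 : s != 0 by apply: contraTneq c0 => s0; rewrite -invr_eq0 -sP s0 expr0n eqxx.
pose x := s *: y; have Wx : x \in W by rewrite memvZ.
have xx : x * x = z.
  rewrite /x -scalerAl -scalerAr scalerA -expr2 sP yyE scalerA mulVf //.
  by rewrite scale1r.
have z0 : z != 0 by apply: contraNneq yy0 => z0; rewrite yyE z0 scaler0.
have sW : (annv x W <= W)%VS by apply: capvSl.
have ltW : (\dim (annv x W) < \dim W)%N.
  rewrite ltn_neqAle dimvS // andbT; apply: contraNneq z0 => eqd.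
  have /eqP eqW : annv x W == W by rewrite eqEdim sW eqd leqnn.
  by move: Wx; rewrite -eqW memv_annv xx => /andP[].
have [|B bB BB] := IHn _ (leq_trans ltW le_n).
  by apply: subv_trans WW; apply: prodvS.
exists (x :: B).
  rewrite basisEdim span_cons (span_basis bB) /=.
  rewrite -(eqP (_ : \dim (annv x W) == size B)) ?ltW ?andbT; last first.
    by rewrite -(span_basis bB) eqn_leq dim_span -(eqP (basis_free bB)) leqnn.
  apply/subvP=> w Ww; have /vlineP[d wd] : x * w \in <[z]>%VS by apply: (prodvP WW).
  rewrite -(subrKC (d *: x) w) memv_add //.
    exact/memvZ/memv_line.
  by rewrite memv_annv memvB ?memvZ // mulrBr wd -scalerAr xx subrr eqxx.
have Bx w : w \in B -> x * w = 0.
  by move/(basis_mem bB); rewrite memv_annv => /andP[_ /eqP].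
move=> v w; rewrite !inE => /predU1P[->|Bv] /predU1P[->|Bw].
- by rewrite xx eqxx orbT.
- by rewrite Bx // eqxx.
- by rewrite mulrC Bx // eqxx.
- by have := BB _ _ Bv Bw; rewrite !inE.
Qed.

(** Multiplication by [x ^+ n] sends the lowest power [x ^+ (t - n)] to [x ^+ t] and annihilates all
    higher ones, so the lowest power is independent of them. *)
Lemma free_powers x t n : x ^+ t.+1 = 0 -> x ^+ t != 0 -> (n <= t.+1)%N ->
  free [seq x ^+ i | i <- iota (t.+1 - n) n].
Proof.
move=> xt1 xt0; elim: n => [|n IHn] le_n; first exact: nil_free.
rewrite /= free_cons -subSn // subSS IHn ?(ltnW le_n) // andbT.
apply: contraNN xt0 => xV; have {xV} := memv_img (amull (x ^+ n)) xV.
rewrite lfunE /= -exprD (_ : n + (t - n) = t)%N ?subnKC // limg_span -map_comp.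
rewrite -memv0 => xt; apply: memv_subv xt; apply/span_subvP=> v /mapP[i];
  rewrite mem_iota => /andP[lei _] ->.
rewrite /= lfunE /= -exprD memv0; apply/eqP; apply: (nilpotentW xt1); lia.
Qed.

Section Tail.
Variables (N : {vspace A}) (k : nat).
Hypotheses (NN : (N * N <= N)%VS) (Nk : (N ^+ k = 0)%VS).
Hypothesis N2_neq0 : (N * N)%VS != 0%VS.
Hypothesis N2_small : (\dim (N * N) <= (\dim (N * (N * N))).+1)%N.

Lemma N3_sub_N2 : (N * (N * N) <= N * N)%VS.
Proof. exact: prodvSr. Qed.

(** Were all squares in [N^3], polarisation would give [N^2 <= N^3] and Nakayama would give
    [N^2 = 0]. A square outside [N^3] spans [N^2] modulo [N^3] because of [N2_small]. *)
Lemma tail_generator : exists2 x, x \in N & (N * N = <[x * x]> + N * (N * N))%VS.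
Proof.
have [x Nx xx] : exists2 x, x \in N & x * x \notin (N * (N * N))%VS.
  apply: NNPP => noX; have /(nakayama0 Nk)/eqP : (N * N <= N * (N * N))%VS.
    apply: squares_subv => y Ny; apply: contraT => yy.
    by case: noX; exists y.
  exact/negP.
exists x => //; apply/esym/eqP; rewrite eqEdim dim_addv_line // N2_small andbT.
by rewrite subv_add N3_sub_N2 andbT -memvE memv_mul.
Qed.

(** By Nakayama [N^2 = x N], and [N^2] is spanned by the powers of [x] from the second on. The other
    basis elements can be taken in the annihilator [Y] of [x]: a product of two of them lies in
    [N^2] and is killed by [x], hence is a multiple of the last nonzero power [x ^+ t], and
    [diagonal_basis] applies. *)
Lemma curvilinear_monomial : exists2 B, basis_of N B & monomial B.
Proof.
have [x Nx N2E] := tail_generator.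
have sxN : (<[x]> <= N)%VS by rewrite -memvE.
have N2x : (N * N = <[x]> * N)%VS.
  apply/eqP; rewrite eqEsubv; apply/andP; split; last exact: prodvSl.
  apply: (nakayama Nk).
    by rewrite {1}N2E addvS // -memvE memv_mul ?memv_line.
  by rewrite prodvA (prodvC N) -prodvA prodvSr.
have N3x : (N * (N * N) = <[x]> * (N * N))%VS.
  by rewrite {1}N2x prodvA (prodvC N) -prodvA.
have [t xt1 xt0] : exists2 t, x ^+ t.+1 = 0 & x ^+ t != 0.
  have xk : x ^+ k == 0.
    by rewrite -memv0 memvE -expv_line -Nk expvS.
  case: (ex_minnP (ex_intro (fun n => x ^+ n == 0) k xk)) => -[|t] /eqP xt1 min_t.
    by move/eqP: xt1; rewrite expr0 oner_eq0.
  by exists t => //; apply: contraTN (ltnSn t) => /min_t; rewrite -leqNgt.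
have Px i : (0 < i)%N -> x ^+ i \in N.
  case: i => // i _; elim: i => [|i IHi]; first by rewrite expr1.
  by rewrite exprS (subvP NN) // memv_mul.
pose powers m := [seq x ^+ i | i <- iota m (t.+1 - m)].
pose pow m := <<powers m>>%VS.
have mem_pow m i : (m <= i)%N -> x ^+ i \in pow m.
  move=> le_mi; have [lt_it|ge_it] := ltnP i t.+1.
    by apply: memv_span; apply: map_f; rewrite mem_iota le_mi subnKC ?(leq_trans le_mi) ?(ltnW
      lt_it) //.
  by rewrite (nilpotentW xt1) ?mem0v.
have powS m : (<[x]> * pow m = pow m.+1)%VS.
  apply/eqP; rewrite eqEsubv; apply/andP; split.
    apply/prodvP=> _ w /vlineP[a ->] /(memv_img (amull x)).
    rewrite lfunE /= -scalerAl limg_span -map_comp => xw; apply: memvZ.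
    apply: memv_subv xw; apply/span_subvP=> v /mapP[i]; rewrite mem_iota => /andP[le_i _] ->.
    by rewrite /= lfunE /= -exprS mem_pow.
  apply/span_subvP=> v /mapP[[|i]]; rewrite mem_iota => /andP[// le_i _] ->.
  by rewrite exprS memv_mul ?memv_line ?mem_pow.
have le2t : (2 <= t)%N.
  rewrite ltnNge; apply: contraNN N2_neq0 => le_t.
  have xx0 : x * x = 0 by rewrite -expr2 (nilpotentW xt1).
  apply/eqP; apply: (nakayama0 Nk).
  by rewrite {1}N2E xx0 add0v.
have N2pow : (N * N <= pow 2)%VS.
  apply: (@nakayama _ _ <[x]>%VS _ _ t.+1); first by rewrite expv_line xt1.
    by rewrite {1}N2E N3x addvS // -memvE -expr2 mem_pow.
  by rewrite powS; apply/span_subvP=> v /mapP[i]; rewrite mem_iota => /andP[/ltnW le_i _] ->;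
    apply: mem_pow.
pose Y := annv x N.
have NPY : (N <= pow 1%N + Y)%VS.
  apply/subvP=> n Nn; have : x * n \in pow 2 by rewrite (subvP N2pow) ?memv_mul.
  rewrite -(powS 1%N) prodvC => /memv_cosetP[w w1 xn].
  rewrite -(subrKC w n) memv_add // memv_annv mulrBr xn mulrC subrr eqxx andbT.
  rewrite memvB // (memv_subv _ w1) //; apply/span_subvP=> v /mapP[i].
  by rewrite mem_iota => /andP[i0 _] ->; apply: Px.
have powersE m : (m <= t)%N -> powers m = x ^+ m :: powers m.+1.
  by move=> le_mt; rewrite /powers subSn // subSS.
have powE m : (m <= t)%N -> pow m = (<[x ^+ m]> + pow m.+1)%VS.
  by move=> le_mt; rewrite /pow powersE // span_cons.
have free_pow m : (m <= t.+1)%N -> free (powers m).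
  move=> le_mt; have := free_powers xt1 xt0 (leq_subr m t.+1).
  by rewrite subKn.
have pow_notin m : (m <= t)%N -> x ^+ m \notin pow m.+1.
  by move=> le_mt; have := free_pow m (leqW le_mt); rewrite powersE // free_cons => /andP[].
have pow_ann m w : (m <= t)%N -> w \in pow m -> x * w = 0 -> w \in <[x ^+ t]>%VS.
  move=> le_mt; move def_n: (t - m)%N => n.
  elim: n => [|n IHn] in m w le_mt def_n *.
    have ->: m = t by lia.
    by rewrite powE // /pow /powers subnn span_nil addv0.
  have lt_mt : (m < t)%N by lia.
  rewrite powE // => /memv_addline[a]; set w' := w - _ => w'P xw0.
  suffices a0 : a = 0.
    by apply: (IHn m.+1) xw0 => //; [lia|rewrite /w' a0 scale0r subr0 in w'P].
  have := pow_notin m.+1 lt_mt; apply: contraNeq => a0.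
  have : x * w' \in pow m.+2 by rewrite -powS memv_mul ?memv_line.
  rewrite /w' mulrBr xw0 sub0r -scalerAr -exprS memvN => /(memvZ a^-1).
  by rewrite scalerA mulVf // scale1r.
pose z := x ^+ t; have Nz : z \in N by rewrite Px // (leq_trans _ le2t).
have xz : x * z = 0 by rewrite -exprS.
have Yz : z \in Y by rewrite memv_annv Nz xz eqxx.
have YN : (Y <= N)%VS by apply: capvSl.
have YY : (Y * Y <= <[z]>)%VS.
  apply/prodvP=> y y' Yy; rewrite memv_annv => /andP[Ny' /eqP xy'].
  apply: (pow_ann 2) => //; last by rewrite mulrCA xy' mulr0.
  by rewrite (subvP N2pow) // memv_mul // (subvP YN).
(* [z] already occurs among the powers of [x], so the diagonal basis is taken in a complement of its
   line in [Y]. *)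
have sY' : (Y :\: <[z]> <= Y)%VS by apply: diffvSl.
have [B bB BB] := diagonal_basis (subv_trans (prodvS sY' sY') YY).
have BY y : y \in B -> y \in Y by move/(basis_mem bB)/(subvP sY').
have xB i y : (0 < i)%N -> y \in B -> x ^+ i * y = 0.
  case: i => // i _ /BY; rewrite memv_annv => /andP[_ /eqP xy].
  by rewrite exprSr -mulrA xy mulr0.
pose X := [seq x ^+ i | i <- iota 1 t].
have sX : <<X>>%VS = pow 1%N by rewrite /pow /powers subn1.
have freeX : free X by have := free_pow 1%N isT; rewrite /powers subn1.
exists (X ++ B).
  have dimX : \dim <<X>>%VS = t.
    by rewrite (eqP freeX) size_map size_iota.
  have dXB : \dim (<<X>> + <<B>>)%VS = (size X + size B)%N.
    rewrite dimv_disjoint_sum ?dimX ?(eqP (basis_free bB)) ?size_map ?size_iota //.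
    apply/eqP; rewrite -subv0 (span_basis bB) -(capv_diff Y <[z]>) subv_cap capvSr.
    apply/subvP=> w /memv_capP[]; rewrite sX => w1 /(subvP sY').
    by rewrite memv_annv => /andP[_ /eqP]; apply: pow_ann w1; apply: ltnW.
  have sXN : (<<X>> <= N)%VS.
    by apply/span_subvP=> v /mapP[i]; rewrite mem_iota => /andP[i0 _] ->; apply: Px.
  have sBN : (<<B>> <= N)%VS by rewrite (span_basis bB) (subv_trans sY').
  rewrite basisEdim span_cat size_cat -dXB dimvS ?andbT; last first.
    by rewrite subv_add sXN.
  rewrite (subv_trans NPY) // subv_add sX addvSl /=.
  rewrite (span_basis bB); apply/subvP=> y Yy.
  have : y \in (Y :\: <[z]> + <[z]>)%VS.
    by rewrite addv_diff (subvP (addvSl _ _)).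
  by apply: memv_subv; rewrite addvC addvS // -memvE mem_pow // (leq_trans _ le2t).
have Xz : z \in X by apply: map_f; rewrite mem_iota add1n ltnS leqnn (leq_trans _ le2t).
have XX i : (0 < i)%N -> x ^+ i \in 0 :: X ++ B.
  move=> i0; have [le_it|lt_ti] := leqP i t.
    by rewrite in_cons mem_cat map_f ?orbT // mem_iota i0 add1n ltnS.
  by rewrite (nilpotentW xt1) // mem_head.
have memX u : u \in X -> exists2 i, (0 < i)%N & u = x ^+ i.
  by case/mapP=> i; rewrite mem_iota => /andP[i0 _] ->; exists i.
move=> u v; rewrite !mem_cat => /orP[/memX[i i0 ->]|Bu] /orP[/memX[j j0 ->]|Bv].
- by rewrite -exprD XX // addn_gt0 i0.
- by rewrite xB // mem_head.
- by rewrite mulrC xB // mem_head.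
- have := BB _ _ Bu Bv; rewrite !inE => /orP[->//|/eqP->].
  by rewrite mem_cat Xz orbT.
Qed.

End Tail.
End Curvilinear.

(** * Nilpotent algebras with two generators *)

Section TwoGenerators.
Variables (K : closedFieldType) (A : comFalgType K).
Hypotheses (two_neq0 : 2 != 0 :> K) (three_neq0 : 3 != 0 :> K).
Implicit Types (U V W Z N : {vspace A}) (x y z : A) (B C X Y : seq A).

Lemma pairwise_mul B C : all (fun x => x * x \in C) B ->
  pairwise (fun x y => x * y \in C) B -> {in B &, forall x y, x * y \in C}.
Proof.
elim: B => //= x B IHB /andP[xx /IHB{}IHB] /andP[/allP xB /IHB{}IHB] y z.
rewrite !inE => /predU1P[->|By] /predU1P[->|Bz] //; first exact: xB.
  by rewrite mulrC xB.
exact: IHB.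
Qed.

(** Modulo [Z] the three products lie in a space of dimension at most 2. *)
Lemma quadratic_relation x y U Z :
    x * x \in U -> x * y \in U -> y * y \in U -> (Z <= U)%VS ->
    (\dim U <= (\dim Z).+2)%N ->
  exists a b c : K, (a, b, c) != (0, 0, 0) /\
    a *: (x * x) + b *: (x * y) + c *: (y * y) \in Z.
Proof.
move=> Uxx Uxy Uyy sZU dU.
have [yyZ|yyZ] := boolP (y * y \in Z).
  exists 0, 0, 1; rewrite !scale0r !add0r scale1r; split=> //.
  by rewrite !xpair_eqE oner_eq0 andbF.
have [/memv_addline[a xyZ]|xyZ] := boolP (x * y \in (<[y * y]> + Z)%VS).
  exists 0, 1, (- a); rewrite scale0r add0r scale1r scaleNr; split=> //.
  by rewrite !xpair_eqE oner_eq0 andbF.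
have /memv_addline[b /memv_addline[a xxZ]] : x * x \in (<[x * y]> + (<[y * y]> + Z))%VS.
  apply: contraTT dU => xxZ; rewrite -ltnNge.
  rewrite -(dim_addv_line yyZ) -(dim_addv_line xyZ) -(dim_addv_line xxZ).
  by rewrite dimvS // !subv_add -!memvE Uxx Uxy Uyy.
exists 1, (- b), (- a); rewrite scale1r !scaleNr; split=> //.
by rewrite !xpair_eqE oner_eq0.
Qed.

Lemma span2E x y : span [:: x; y] = (<[x]> + <[y]>)%VS.
Proof. by rewrite !span_cons span_nil addv0. Qed.

Lemma span3E x y z : span [:: x; y; z] = (<[x]> + (<[y]> + <[z]>))%VS.
Proof. by rewrite !span_cons span_nil addv0. Qed.

Lemma memvZ_neq0 a x U : a != 0 -> (a *: x \in U) = (x \in U).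
Proof. by move=> a0; rewrite rpredZeq (negPf a0). Qed.

Lemma eq_span2 x y p q r s : p * s - q * r != 0 ->
  span [:: p *: x + q *: y; r *: x + s *: y] = span [:: x; y].
Proof.
move=> D0; apply/eqP; rewrite eqEsubv; apply/andP; split; apply/span_subvP=> w.
  by rewrite !inE => /orP[]/eqP->; apply: span2_lin.
rewrite !inE => /orP[]/eqP->; rewrite -(memvZ_neq0 _ _ D0).
  rewrite (_ : _ *: x = s *: (p *: x + q *: y) + (- q) *: (r *: x + s *: y)); last by algring.
  exact: span2_lin.
rewrite (_ : _ *: y = (- r) *: (p *: x + q *: y) + p *: (r *: x + s *: y)); last by algring.
exact: span2_lin.
Qed.

(* A quadratic relation between [x] and [y] is a product of two linear forms. *)
Lemma null_product x y U Z :
    x * x \in U -> x * y \in U -> y * y \in U -> (Z <= U)%VS ->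
    (\dim U <= (\dim Z).+2)%N ->
  exists x' y', <<[:: x'; y']>>%VS = <<[:: x; y]>>%VS /\
    (x' * y' \in Z \/ x' * x' \in Z).
Proof.
move=> Uxx Uxy Uyy sZU dU.
have [a [b [c [abc0 relZ]]]] := quadratic_relation Uxx Uxy Uyy sZU dU.
have [p [q [r [s [[aE bE cE]]]]]] := binary_quadratic_factor a b c.
case=> [[pq0 rs0]|/eqP abc]; last by rewrite abc in abc0.
set l1 := p *: x + q *: y; set l2 := r *: x + s *: y.
have l12 : l1 * l2 \in Z.
  by rewrite (_ : l1 * l2 = a *: (x * x) + b *: (x * y) + c *: (y * y)) // aE bE cE /l1 /l2;
    algring.
(* If the determinant vanishes, the two linear forms are proportional and the relation is a multiple
   of [l1 * l1]; then [l1] is completed to a basis by [x] or [y]. *)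
have [D0|D0] := eqVneq (p * s - q * r) 0; last first.
  by exists l1, l2; split; [exact: eq_span2|left].
have ps : p * s = q * r by apply/eqP; rewrite -subr_eq0 D0.
have {l12} l11 : l1 * l1 \in Z.
  have [r0|r0] := eqVneq r 0.
    have s0 : s != 0 by move: rs0; rewrite r0 xpair_eqE eqxx.
    rewrite -(memvZ_neq0 _ _ s0) scalerAr (_ : s *: l1 = q *: l2).
      by rewrite -scalerAr memvZ.
    by rewrite /l1 /l2 !scalerDr !scalerA -ps (mulrC s) (mulrC q).
  rewrite -(memvZ_neq0 _ _ r0) scalerAr (_ : r *: l1 = p *: l2).
    by rewrite -scalerAr memvZ.
  by rewrite /l1 /l2 !scalerDr !scalerA ps (mulrC r) (mulrC r).
have [p0|p0] := eqVneq p 0.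
  have q0 : q != 0 by move: pq0; rewrite p0 xpair_eqE eqxx.
  exists l1, (1 *: x + 0 *: y); split; last by right.
  by apply: eq_span2; rewrite mulr0 mulr1 sub0r oppr_eq0.
exists l1, (0 *: x + 1 *: y); split; last by right.
by apply: eq_span2; rewrite mulr0 mulr1 subr0.
Qed.

Section Nilpotent.
Variables (N : {vspace A}) (k : nat).
Hypotheses (NN : (N * N <= N)%VS) (Nk : (N ^+ k = 0)%VS).

Lemma N2_generated X : {subset X <= N} -> (N <= <<X>> + N * N)%VS ->
  (N * N <= <<X>> * <<X>> + N * (N * N))%VS.
Proof.
move=> /span_subvP XN NX; apply: subv_trans (prodvSl _ NX) _.
rewrite prodvDl subv_add; apply/andP; split; last first.
  by rewrite prodvC addvSr.
apply: subv_trans (prodvSr _ NX) _.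
by rewrite prodvDr addvS // prodvSl.
Qed.

(** Elements of degree two annihilate [N], so only products of the generators [X] have to be
    checked; the size bound makes the spanning family a basis. *)
Lemma monomial_basis_by_degree X Y : {subset X <= N} -> {subset Y <= (N * N)%VS} ->
  (N <= <<X>> + N * N)%VS -> (N * N <= <<Y>>)%VS -> (N * (N * N) = 0)%VS ->
  (size X + size Y <= \dim N)%N -> {in X &, forall x x', x * x' \in 0 :: Y} ->
  exists2 B, basis_of N B & monomial B.
Proof.
move=> XN YN2 NX N2Y N3 sz XX; exists (X ++ Y).
  by rewrite basisEdim size_cat sz andbT span_cat (subv_trans NX) ?addvS.
have N0 u v : u \in N -> v \in Y -> u * v = 0.
  by move=> Nu /YN2 N2v; apply/eqP; rewrite -memv0 -N3 memv_mul.
have YN v : v \in Y -> v \in N by move/YN2; apply: memv_subv.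
move=> u v; rewrite !mem_cat => /orP[Xu|Yu] /orP[Xv|Yv].
- by have := XX _ _ Xu Xv; rewrite !inE mem_cat => /orP[->//|->]; rewrite !orbT.
- by rewrite N0 ?mem_head // XN.
- by rewrite mulrC N0 ?mem_head // XN.
- by rewrite N0 ?mem_head // YN.
Qed.

Section Two.
Hypothesis dN : \dim N = (\dim (N * N)).+2.

Lemma two_generators : exists x y, [/\ x \in N, y \in N & (N <= <<[:: x; y]>> + N * N)%VS].
Proof.
have dD : \dim (N :\: (N * N)) = 2.
  by have := dimv_cap_compl N (N * N); rewrite (capv_idPr NN) dN -addn2 => /addnI.
have [x [y bxy]] := basis2 dD.
have sD : (N :\: (N * N) <= N)%VS := diffvSl _ _.
exists x, y; split; try by apply: memv_subv sD _; apply: (basis_mem bxy); rewrite !inE eqxx ?orbT.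
by rewrite (span_basis bxy) addv_diff addvSl.
Qed.

Lemma sq_span2 x y : (<<[:: x; y]>> * <<[:: x; y]>> =
  span [:: x * x; x * y; y * y]%R)%VS.
Proof.
rewrite !span_cons !span_nil !addv0 prodvDl !prodvDr !prodv_line -!addvA; congr (_ + _)%VS.
by rewrite (mulrC y x) addvA addvv.
Qed.

(** The digits in this and the similar names are the dimensions of [N / N^2], [N^2 / N^3] and, if
    present, [N^3]. Here the three products of two generators span a space of dimension 3, so they
    form a basis of it. *)
Lemma monomial_2_3 : \dim (N * N) = 3 -> (N * (N * N) = 0)%VS ->
  exists2 B, basis_of N B & monomial B.
Proof.
move=> dN2 N3; have [x [y [Nx Ny NX]]] := two_generators.
have XN : {subset [:: x; y] <= N} by move=> w; rewrite !inE => /orP[]/eqP->.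
have := N2_generated XN NX; rewrite N3 addv0 sq_span2 => N2Y.
apply: (monomial_basis_by_degree (Y := [:: x * x; x * y; y * y]) XN _ NX N2Y N3).
- by move=> w; rewrite !inE => /or3P[]/eqP->; apply: memv_mul.
- by rewrite dN dN2.
- by apply: pairwise_mul; rewrite /= !inE !eqxx ?orbT.
Qed.

Lemma monomial_2_2 : \dim (N * N) = 2 -> (N * (N * N) = 0)%VS ->
  exists2 B, basis_of N B & monomial B.
Proof.
move=> dN2 N3; have [x0 [y0 [Nx0 Ny0 NX0]]] := two_generators.
have [x [y [eqX xy]]] : exists x y, <<[:: x; y]>>%VS = <<[:: x0; y0]>>%VS /\
    (x * y \in 0%VS \/ x * x \in 0%VS).
  by apply: (@null_product _ _ (N * N)%VS); rewrite ?memv_mul ?sub0v ?dimv0 ?dN2.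
rewrite -eqX in NX0.
have XN : {subset [:: x; y] <= N}.
  apply/span_subvP; rewrite eqX; apply/span_subvP => w.
  by rewrite !inE => /orP[]/eqP->.
have [Nx Ny] : x \in N /\ y \in N by split; apply: XN; rewrite !inE eqxx ?orbT.
have := N2_generated XN NX0; rewrite N3 addv0 sq_span2.
rewrite !memv0 in xy; case: xy => /eqP xy N2Y.
  apply: (monomial_basis_by_degree (Y := [:: x * x; y * y]) XN _ NX0 _ N3).
  - by move=> w; rewrite !inE => /orP[]/eqP->; apply: memv_mul.
  - apply: subv_trans N2Y _; apply/span_subvP=> w; rewrite xy !inE.
    by case/or3P=> /eqP->; rewrite ?mem0v ?memv_span // !inE eqxx ?orbT.
  - by rewrite dN dN2.
  - by apply: pairwise_mul; rewrite /= !inE ?xy !eqxx ?orbT.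
apply: (monomial_basis_by_degree (Y := [:: x * y; y * y]) XN _ NX0 _ N3).
- by move=> w; rewrite !inE => /orP[]/eqP->; apply: memv_mul.
- apply: subv_trans N2Y _; apply/span_subvP=> w; rewrite xy !inE.
  by case/or3P=> /eqP->; rewrite ?mem0v ?memv_span // !inE eqxx ?orbT.
- by rewrite dN dN2.
- by apply: pairwise_mul; rewrite /= !inE ?xy !eqxx ?orbT.
Qed.

Section TwoTwoOne.
Hypotheses (dN2 : \dim (N * N) = 3) (dN3 : \dim (N * (N * N)) = 1%N).

Lemma N4_eq0 : (N * (N * (N * N)) = 0)%VS.
Proof.
set N3 := (N * (N * N))%VS.
have sN3 : (N * N3 <= N3)%VS by rewrite /N3 prodvSr // prodvSr.
have [/eqP|d0] := eqVneq (\dim (N * N3)) 0; first by rewrite dimv_eq0 => /eqP.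
have : (N * N3)%VS == N3 by rewrite eqEdim sN3 dN3 lt0n.
move/eqP=> N3E; have /eqP : N3 = 0%VS by apply: (nakayama0 Nk); rewrite N3E.
by rewrite -dimv_eq0 dN3.
Qed.

Lemma mul4_eq0 a b c d : a \in N -> b \in N -> c \in N -> d \in N ->
  a * (b * (c * d)) = 0.
Proof.
by move=> Na Nb Nc Nd; apply/eqP; rewrite -memv0 -N4_eq0 !memv_mul.
Qed.

Lemma cubes_span x y : (N <= <<[:: x; y]>> + N * N)%VS -> x \in N -> y \in N ->
  (N * (N * N) <= span [:: x * (x * x); x * (x * y); x * (y * y); y * (y * y)]%R)%VS.
Proof.
move=> NX Nx Ny.
have XN : {subset [:: x; y] <= N} by move=> w; rewrite !inE => /orP[]/eqP->.
have N2X := N2_generated XN NX; rewrite sq_span2 in N2X.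
apply: subv_trans (prodvSr _ N2X) _; rewrite prodvDr N4_eq0 addv0.
apply: subv_trans (prodvSl _ NX) _; rewrite prodvDl subv_add; apply/andP; split.
  set S := [:: x * (x * x); x * (x * y); x * (y * y); y * (y * y)].
  have memS w1 w2 : w1 \in S -> w1 = w2 -> w2 \in <<S>>%VS by move=> ? <-; apply: memv_span.
  rewrite span2E span3E !prodvDl !prodvDr !prodv_line.
  rewrite !subv_add -!memvE; do ?[apply/andP; split].
  - by apply: (memS (x * (x * x))); [rewrite !inE eqxx ?orbT|ring].
  - by apply: (memS (x * (x * y))); [rewrite !inE eqxx ?orbT|ring].
  - by apply: (memS (x * (y * y))); [rewrite !inE eqxx ?orbT|ring].
  - by apply: (memS (x * (x * y))); [rewrite !inE eqxx ?orbT|ring].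
  - by apply: (memS (x * (y * y))); [rewrite !inE eqxx ?orbT|ring].
  - by apply: (memS (y * (y * y))); [rewrite !inE eqxx ?orbT|ring].
apply: subv_trans (sub0v _); rewrite -N4_eq0 prodvA prodvSr //.
rewrite -sq_span2; apply: prodvS; exact/span_subvP.
Qed.

Lemma monomial5 b1 b2 b3 b4 b5 : (N <= span [:: b1; b2; b3; b4; b5])%VS ->
  all (fun x => x * x \in [:: 0; b1; b2; b3; b4; b5]) [:: b1; b2; b3; b4; b5] ->
  pairwise (fun x y => x * y \in [:: 0; b1; b2; b3; b4; b5]) [:: b1; b2; b3; b4; b5] ->
  exists2 B, basis_of N B & monomial B.
Proof.
move=> sNB sq pw; exists [:: b1; b2; b3; b4; b5]; last exact: pairwise_mul.
by rewrite basisEdim sNB dN dN2.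
Qed.

Lemma subv_2_2_1 x y b3 b4 z : (N <= <<[:: x; y]>> + N * N)%VS ->
  (N * N <= span [:: b3; b4] + N * (N * N))%VS -> (N * (N * N) <= <[z]>)%VS ->
  (N <= span [:: x; y; b3; b4; z])%VS.
Proof.
move=> NX N2Y N3z; rewrite (_ : [:: x; y; b3; b4; z] = [:: x; y] ++ [:: b3; b4] ++ [:: z]) //.
by rewrite !span_cat span_seq1 (subv_trans NX) ?addvS // (subv_trans N2Y) ?addvS.
Qed.

(* Subtracting a multiple of [x^2] from [y] makes [x y] vanish; rescaling [y]
   then makes [y^3] equal to [0] or [x^3]. *)
Lemma monomial_2_2_1_split x y : x \in N -> y \in N ->
  (N <= <<[:: x; y]>> + N * N)%VS -> x * y \in (N * (N * N))%VS ->
  x * (x * x) != 0 -> exists2 B, basis_of N B & monomial B.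
Proof.
move=> Nx Ny NX xyN3 x30; set z := x * (x * x) in x30.
have N3z : (N * (N * N) = <[z]>)%VS.
  apply/esym/eqP; rewrite eqEdim dN3 dim_vline x30 -memvE andbT.
  by rewrite memv_mul // memv_mul.
have mul0 w1 w2 : w1 \in N -> w2 \in <[z]>%VS -> w1 * w2 = 0.
  by rewrite -N3z => Nw1 w2z; apply/eqP; rewrite -memv0 -N4_eq0 memv_mul.
have [a xyE] : exists a, x * y = a *: z by apply/vlineP; rewrite -N3z.
have [c yyyE] : exists c, y * (y * y) = c *: z.
  by apply/vlineP; rewrite -N3z memv_mul // memv_mul.
have [s s0 scE] : exists2 s, s != 0 & s ^+ 3 * c = 0 \/ s ^+ 3 * c = 1.
  have [->|c0] := eqVneq c 0; first by exists 1; [exact: oner_neq0|left; rewrite mulr0].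
  have [t] := closed_cubic_root 0 0 (- 1) c0; rewrite !mul0r !addr0 => tP.
  have tP1 : t ^+ 3 * c = 1 by apply/eqP; rewrite -subr_eq0 mulrC tP.
  exists t; last by right.
  by apply: contra_eqT tP1 => /negPn/eqP->; rewrite expr0n mul0r eq_sym oner_eq0.
pose w := s *: (y - a *: (x * x)).
have xxy : x * (x * y) = 0 by rewrite mul0 // xyE memvZ ?memv_line.
have xxxx : x * z = 0 by rewrite mul0 ?memv_line.
have xw : x * w = 0.
  by rewrite /w -scalerAr mulrBr xyE -scalerAr subrr scaler0.
have Nw : w \in N by rewrite memvZ // memvB // memvZ // (memv_subv NN) ?memv_mul.
have ww : w * w = s ^+ 2 *: (y * y).
  have -> : w * w = s ^+ 2 *: (y * y) - (2 * s ^+ 2 * a) *: (x * (x * y)) + (s ^+ 2 * a ^+ 2) *: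
    (x * z).
    by rewrite /w /z; algring.
  by rewrite xxy xxxx !scaler0 subr0 addr0.
have www : w * (w * w) = (s ^+ 3 * c) *: z.
  have -> : w * (w * w) = s ^+ 3 *: (y * (y * y)) - (s ^+ 3 * a) *: (y * (x * (x * y))).
    by rewrite ww /w; algring.
  by rewrite yyyE xxy mulr0 scaler0 subr0 scalerA.
have NX' : (N <= <<[:: x; w]>> + N * N)%VS.
  apply: subv_trans NX _; rewrite subv_add addvSr andbT; apply/span_subvP=> v.
  rewrite !inE => /orP[]/eqP->; first by apply: memv_subv (addvSl _ _) _;
    rewrite memv_span ?mem_head.
  have -> : y = s^-1 *: w + a *: (x * x).
    by rewrite /w scalerA mulVf // scale1r subrK.
  by apply: memv_add; rewrite memvZ ?memv_mul // memv_span // !inE eqxx orbT.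
have N2Y : (N * N <= span [:: x * x; w * w]%R + N * (N * N))%VS.
  apply: subv_trans (N2_generated _ NX') _; first by move=> v; rewrite !inE => /orP[]/eqP->.
  rewrite sq_span2 xw subv_add addvSr andbT (subv_trans _ (addvSl _ _)) //.
  apply/span_subvP=> v; rewrite !inE.
  by case/or3P=> /eqP->; rewrite ?mem0v ?memv_span // !inE eqxx ?orbT.
have N3z' : (N * (N * N) <= <[z]>)%VS by rewrite N3z.
have zmul0 v : v \in N -> v * z = 0 by move=> Nv; rewrite mul0 ?memv_line.
have Nxx : x * x \in N by rewrite (memv_subv NN) ?memv_mul.
have Nww : w * w \in N by rewrite (memv_subv NN) ?memv_mul.
have Nz : z \in N by rewrite (memv_subv NN) ?memv_mul.
have xww : x * (w * w) = 0 by rewrite mulrA xw mul0r.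
have wxx : w * (x * x) = 0 by rewrite mulrC -mulrA xw mulr0.
have xxxx' : x * x * (x * x) = 0 by rewrite -mulrA mul4_eq0.
have xxww : x * x * (w * w) = 0 by rewrite -mulrA mul4_eq0.
have wwww : w * w * (w * w) = 0 by rewrite -mulrA mul4_eq0.
have wwwE : w * (w * w) \in [:: 0; x; w; x * x; w * w; z].
  by rewrite www; case: scE => ->; rewrite ?scale0r ?scale1r !inE eqxx ?orbT.
apply: (monomial5 (subv_2_2_1 NX' N2Y N3z')).
  by rewrite /= xxxx' wwww zmul0 // !inE !eqxx ?orbT.
rewrite /= wwwE xw wxx xww xxww !zmul0 //.
by rewrite !inE !eqxx ?orbT.
Qed.

(** If [x y^2 = 0], then [y^3] spans [N^3], and scaling [x] makes [x^2] equal to 0 or [y^3].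
    Otherwise [x y^2] spans [N^3]: adding [al x] to [y] changes [y^3] by [3 al x y^2], and then
    subtracting [be y'^2] from [x] changes [x^2] by [- 2 be x y'^2], so both [y^3] and [x^2] can be
    removed. *)
Lemma monomial_2_2_1_square x y : x \in N -> y \in N ->
  (N <= <<[:: x; y]>> + N * N)%VS -> x * x \in (N * (N * N))%VS ->
  exists2 B, basis_of N B & monomial B.
Proof.
move=> Nx Ny NX xxN3.
have mul0 w1 w2 : w1 \in N -> w2 \in (N * (N * N))%VS -> w1 * w2 = 0.
  by move=> Nw1 N3w2; apply/eqP; rewrite -memv0 -N4_eq0 memv_mul.
have N2N : {in N &, forall a b, a * b \in N}.
  by move=> a b Na Nb; rewrite (memv_subv NN) ?memv_mul.
have xxx : x * (x * x) = 0 by rewrite mul0.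
have xxy : x * (x * y) = 0 by rewrite mulrA (mulrC _ y) (mul0 y).
have N3_xyy_yyy : (N * (N * N) <= span [:: x * (y * y); y * (y * y)]%R)%VS.
  apply: subv_trans (cubes_span NX Nx Ny) _; apply/span_subvP=> w.
  rewrite !inE xxx xxy => /or4P[]/eqP->; rewrite ?mem0v ?memv_span //.
    by rewrite mem_head.
  by rewrite !inE eqxx orbT.
have [xyy0|xyy0] := eqVneq (x * (y * y)) 0.
  set z := y * (y * y).
  have N3z : (N * (N * N) <= <[z]>)%VS.
    apply: subv_trans N3_xyy_yyy _; apply/span_subvP=> w.
    by rewrite xyy0 !inE => /orP[]/eqP->; rewrite ?mem0v ?memv_line.
  have N3Ez : z \in (N * (N * N))%VS by rewrite memv_mul ?memv_mul.
  have /vlineP[a xxE] : x * x \in <[z]>%VS by apply: memv_subv xxN3.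
  have [s s0 saE] := normalize_square a.
  pose w := s *: x.
  have Nw : w \in N by rewrite memvZ.
  have ww : w * w = (s ^+ 2 * a) *: z.
    by rewrite -scalerA -xxE /w; algring.
  have NX' : (N <= <<[:: w; y]>> + N * N)%VS.
    apply: subv_trans NX _; rewrite subv_add addvSr andbT (subv_trans _ (addvSl _ _)) //.
    apply/span_subvP=> v; rewrite !inE => /orP[]/eqP->; last by rewrite memv_span // !inE eqxx orbT.
    by rewrite -(memvZ_neq0 _ _ s0) memv_span ?mem_head.
  have N2Y : (N * N <= span [:: w * y; y * y]%R + N * (N * N))%VS.
    apply: subv_trans (N2_generated _ NX') _; first by move=> v; rewrite !inE => /orP[]/eqP->.
    rewrite sq_span2 subv_add addvSr andbT; apply/span_subvP=> v; rewrite !inE.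
    case/or3P=> /eqP->; first by apply: memv_subv (addvSr _ _) _; rewrite ww memvZ.
      by apply: memv_subv (addvSl _ _) _; rewrite memv_span // !inE eqxx.
    by apply: memv_subv (addvSl _ _) _; rewrite memv_span // !inE eqxx orbT.
  have zmul0 v : v \in N -> v * z = 0 by move=> Nv; rewrite mul0.
  have wwE : w * w \in [:: 0; w; y; w * y; y * y; z].
    by rewrite ww; case: saE => ->; rewrite ?scale0r ?scale1r !inE eqxx ?orbT.
  have wwy : w * (w * y) = 0 by rewrite mulrA (mulrC _ y) ww -scalerAr zmul0 ?scaler0.
  have wyy : w * (y * y) = 0 by rewrite /w -scalerAl xyy0 scaler0.
  have ywy : y * (w * y) = 0 by rewrite mulrCA wyy.
  have wywy : w * y * (w * y) = 0 by rewrite -mulrA mul4_eq0.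
  have wyyy : w * y * (y * y) = 0 by rewrite -mulrA mul4_eq0.
  have yyyy : y * y * (y * y) = 0 by rewrite -mulrA mul4_eq0.
  apply: (monomial5 (subv_2_2_1 NX' N2Y N3z)).
    by rewrite /= wwE wywy yyyy zmul0 ?N2N // !inE !eqxx ?orbT.
  rewrite /= wwy wyy ywy wyyy !zmul0 ?N2N //.
  by rewrite !inE !eqxx ?orbT.
set z := x * (y * y) in xyy0.
have N3Ez : z \in (N * (N * N))%VS by rewrite memv_mul ?memv_mul.
have N3z : (N * (N * N) = <[z]>)%VS.
  by apply/esym/eqP; rewrite eqEdim dN3 dim_vline xyy0 -memvE N3Ez.
have /vlineP[a xxE] : x * x \in <[z]>%VS by rewrite -N3z.
have /vlineP[c yyyE] : y * (y * y) \in <[z]>%VS by rewrite -N3z memv_mul ?memv_mul.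
have [al alP] : exists al, c + 3 * al = 0.
  by exists (- (c / 3)); rewrite mulrN mulrCA mulfV // mulr1 subrr.
have [be beP] : exists be, a - 2 * be = 0.
  by exists (a / 2); rewrite mulrCA mulfV // mulr1 subrr.
pose y' := y + al *: x; pose x' := x - be *: (y' * y').
have Ny' : y' \in N by rewrite memvD // memvZ.
have Nx' : x' \in N by rewrite memvB // memvZ // N2N.
have y'3 : y' * (y' * y') = 0.
  have -> : y' * (y' * y') = y * (y * y) + (3 * al) *: z + (3 * al ^+ 2) *: (x * (x * y))
      + al ^+ 3 *: (x * (x * x)) by rewrite /y' /z; algring.
  by rewrite xxx xxy !scaler0 !addr0 yyyE -scalerDl alP scale0r.
have xy'y' : x * (y' * y') = z.
  have -> : x * (y' * y') = z + (2 * al) *: (x * (x * y)) + al ^+ 2 *: (x * (x * x)).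
    by rewrite /y' /z; algring.
  by rewrite xxx xxy !scaler0 !addr0.
have x'x' : x' * x' = 0.
  have -> : x' * x' = x * x - (2 * be) *: (x * (y' * y')) + be ^+ 2 *: (y' * (y' * (y' * y'))).
    by rewrite /x'; algring.
  by rewrite y'3 mulr0 scaler0 addr0 xxE xy'y' -scalerBl beP scale0r.
have x'y'y' : x' * (y' * y') = z.
  have -> : x' * (y' * y') = x * (y' * y') - be *: (y' * (y' * (y' * y'))).
    by rewrite /x'; algring.
  by rewrite y'3 mulr0 scaler0 subr0.
have NX' : (N <= <<[:: x'; y']>> + N * N)%VS.
  have x'P : x' \in (<<[:: x'; y']>> + N * N)%VS.
    by apply: memv_subv (addvSl _ _) _; rewrite memv_span ?mem_head.
  have y'P : y' \in (<<[:: x'; y']>> + N * N)%VS.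
    by apply: memv_subv (addvSl _ _) _; rewrite memv_span // !inE eqxx orbT.
  have xP : x \in (<<[:: x'; y']>> + N * N)%VS.
    rewrite -[x](subrK (be *: (y' * y'))) memvD // memvZ //.
    by apply: memv_subv (addvSr _ _) _; apply: memv_mul.
  apply: subv_trans NX _; rewrite subv_add addvSr andbT; apply/span_subvP=> v.
  by rewrite !inE => /orP[]/eqP-> //; rewrite -[y](addrK (al *: x)) memvB // memvZ.
have N2Y : (N * N <= span [:: x' * y'; y' * y']%R + N * (N * N))%VS.
  apply: subv_trans (N2_generated _ NX') _; first by move=> v; rewrite !inE => /orP[]/eqP->.
  rewrite sq_span2 x'x' addvS //; apply/span_subvP=> v; rewrite !inE.
  by case/or3P=> /eqP->; rewrite ?mem0v ?memv_span // !inE eqxx ?orbT.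
have N3z' : (N * (N * N) <= <[z]>)%VS by rewrite N3z.
have zmul0 v : v \in N -> v * z = 0 by move=> Nv; rewrite mul0.
have x'x'y' : x' * (x' * y') = 0 by rewrite mulrA x'x' mul0r.
have y'x'y' : y' * (x' * y') = z by rewrite mulrCA.
have e1 : x' * y' * (x' * y') = 0 by rewrite -mulrA mul4_eq0.
have e2 : x' * y' * (y' * y') = 0 by rewrite -mulrA mul4_eq0.
have e3 : y' * y' * (y' * y') = 0 by rewrite -mulrA mul4_eq0.
have Nz : z \in N by rewrite N2N ?N2N.
apply: (monomial5 (subv_2_2_1 NX' N2Y N3z')).
  by rewrite /= x'x' e1 e3 zmul0 // !inE !eqxx ?orbT.
rewrite /= x'x'y' y'x'y' x'y'y' y'3 e2 !zmul0 ?N2N //.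
by rewrite !inE !eqxx ?orbT.
Qed.

Lemma monomial_2_2_1 : exists2 B, basis_of N B & monomial B.
Proof.
have [x0 [y0 [Nx0 Ny0 NX0]]] := two_generators.
have [x [y [eqX xy]]] : exists x y, <<[:: x; y]>>%VS = <<[:: x0; y0]>>%VS /\
    (x * y \in (N * (N * N))%VS \/ x * x \in (N * (N * N))%VS).
  apply: (@null_product _ _ (N * N)%VS); rewrite ?memv_mul ?dN2 ?dN3 //.
  exact: prodvSr.
rewrite -eqX in NX0.
have XN : {subset [:: x; y] <= N}.
  apply/span_subvP; rewrite eqX; apply/span_subvP => w.
  by rewrite !inE => /orP[]/eqP->.
have [Nx Ny] : x \in N /\ y \in N by split; apply: XN; rewrite !inE eqxx ?orbT.
case: xy => xyN3; last exact: monomial_2_2_1_square NX0 xyN3.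
(* The splitting needs a generator with nonzero cube. If [x] fails, [y] works: with both cubes zero
   and [x y] annihilating [N], all cubic monomials would vanish and [N^3] would be 0. *)
have [xxx|] := eqVneq (x * (x * x)) 0; last exact: monomial_2_2_1_split NX0 xyN3.
have NX1 : (N <= <<[:: y; x]>> + N * N)%VS.
  rewrite (_ : <<_>>%VS = <<[:: x; y]>>%VS) //; apply: eq_span => w.
  by rewrite !inE orbC.
apply: (@monomial_2_2_1_split y x) => //; first by rewrite mulrC.
apply: contra_eq_neq (dN3 : _ = 1%N) => yyy; apply/eqP.
have xyx : x * (x * y) = 0 by apply/eqP; rewrite -memv0 -N4_eq0 memv_mul.
have xyy : x * (y * y) = 0 by rewrite mulrA (mulrC _ y); apply/eqP; rewrite -memv0 -N4_eq0 memv_mul.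
have : (N * (N * N) <= 0)%VS.
  apply: subv_trans (cubes_span NX0 Nx Ny) _; apply/span_subvP=> w.
  by rewrite !inE xxx yyy xyx xyy => /or4P[]/eqP->; rewrite mem0v.
by rewrite subv0 => /eqP->; rewrite dimv0.
Qed.

End TwoTwoOne.
End Two.
End Nilpotent.
End TwoGenerators.

(** * Three generators with a plane of products: normal forms *)

Section Pencil.
Variables (K : closedFieldType) (A : comFalgType K).
Hypotheses (two_neq0 : 2 != 0 :> K).
Implicit Types (U V W Z : {vspace A}) (x y z u v : A) (B C X Y : seq A).
Variables (N : {vspace A}).
Hypotheses (NN : (N * N <= N)%VS) (N3 : (N * (N * N) = 0)%VS).
Hypotheses (dN : \dim N = 5) (dN2 : \dim (N * N) = 2).

(** Generators modulo [N^2]. Below, [x] has square zero, and the numbers in [rank2], [rank1],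
    [rank0] give the rank of multiplication by [x] from [N] to [N^2]. *)
Definition frame x y z :=
  [/\ x \in N, y \in N, z \in N & (N <= <<[:: x; y; z]>> + N * N)%VS].

Lemma span3_lin x y z (a b c : K) : a *: x + b *: y + c *: z \in <<[:: x; y; z]>>%VS.
Proof.
by rewrite !memvD ?memvZ ?memv_span // !inE eqxx ?orbT.
Qed.

Lemma frame_change x y z x' y' z' : frame x y z ->
  x' \in N -> y' \in N -> z' \in N ->
  x \in <<[:: x'; y'; z']>>%VS -> y \in <<[:: x'; y'; z']>>%VS ->
  z \in <<[:: x'; y'; z']>>%VS -> frame x' y' z'.
Proof.
move=> [_ _ _ NX] Nx' Ny' Nz' xX yX zX; split=> //.
apply: subv_trans NX _; rewrite addvS //; apply/span_subvP=> w.
by rewrite !inE => /or3P[]/eqP->.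
Qed.

Lemma frame_monomial x y z u v : frame x y z -> (N * N <= <<[:: u; v]>>)%VS ->
  u \in (N * N)%VS -> v \in (N * N)%VS ->
  all (fun a => a * a \in [:: 0; u; v]) [:: x; y; z] ->
  pairwise (fun a b => a * b \in [:: 0; u; v]) [:: x; y; z] ->
  exists2 B, basis_of N B & monomial B.
Proof.
move=> [Nx Ny Nz NX] N2Y N2u N2v sq pw.
apply: (monomial_basis_by_degree NN _ _ NX N2Y N3).
- by move=> w; rewrite !inE => /or3P[]/eqP->.
- by move=> w; rewrite !inE => /orP[]/eqP->.
- by rewrite dN.
- exact: pairwise_mul.
Qed.

Lemma span2_sub u v u' v' : (N * N <= <<[:: u; v]>>)%VS ->
  u \in <<[:: u'; v']>>%VS -> v \in <<[:: u'; v']>>%VS -> (N * N <= <<[:: u'; v']>>)%VS.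
Proof.
move=> N2 uP vP; apply: subv_trans N2 _; apply/span_subvP=> w.
by rewrite !inE => /orP[]/eqP->.
Qed.

Lemma span2Z u v (a b : K) : a != 0 -> b != 0 ->
  (N * N <= <<[:: u; v]>>)%VS -> (N * N <= span [:: a *: u; b *: v])%VS.
Proof.
move=> a0 b0 N2; apply: (span2_sub N2).
  by rewrite -(memvZ_neq0 _ _ a0) memv_span ?mem_head.
by rewrite -(memvZ_neq0 _ _ b0) memv_span // !inE eqxx orbT.
Qed.

Lemma frameZ x y z (a b c : K) : a != 0 -> b != 0 -> c != 0 ->
  frame x y z -> frame (a *: x) (b *: y) (c *: z).
Proof.
move=> a0 b0 c0 F; have [Nx Ny Nz _] := F.
apply: (frame_change F); rewrite ?memvZ //.
- by rewrite -(memvZ_neq0 _ _ a0) memv_span ?mem_head.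
- by rewrite -(memvZ_neq0 _ _ b0) memv_span // !inE eqxx orbT.
- by rewrite -(memvZ_neq0 _ _ c0) memv_span // !inE eqxx !orbT.
Qed.

Lemma frame_shift x y z (a b c : K) : frame x y z ->
  frame x (y + a *: x) (z + b *: y + c *: x).
Proof.
move=> F; have [Nx Ny Nz _] := F.
apply: (frame_change F); rewrite ?memvD ?memvZ //.
- by rewrite memv_span ?mem_head.
- rewrite {1}(_ : y = (- a) *: x + 1 *: (y + a *: x) + 0 *: (z + b *: y + c *: x)); last by algring.
  exact: span3_lin.
rewrite {1}(_ : z = (a * b - c) *: x + (- b) *: (y + a *: x) + 1 *: (z + b *: y + c *: x));
  last by algring.
exact: span3_lin.
Qed.

Lemma mulZ (a b : K) x y : (a *: x) * (b *: y) = (a * b) *: (x * y).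
Proof. by algring. Qed.

Ltac mem3 := by rewrite ?inE ?eqxx ?orbT.

Section Rank2.
Variables x y z u v : A.
Hypotheses (F : frame x y z) (xx : x * x = 0) (yy : y * y = 0).
Hypotheses (xy : x * y = u) (xz : x * z = v) (N2uv : (N * N <= <<[:: u; v]>>)%VS).

Lemma rank2_uv : u \in (N * N)%VS /\ v \in (N * N)%VS.
Proof. by have [Nx Ny Nz _] := F; rewrite -xy -xz !memv_mul. Qed.

Lemma rank2_a f c : f != 0 -> y * z = f *: v -> z * z = c *: u ->
  exists2 B, basis_of N B & monomial B.
Proof.
(* With [y] scaled by [f^-1] and [z] by [s], the new [u] is [f^-1 u] and the new [v] is [s v]; so
   [y z] becomes the new [v], and [z z] becomes [s^2 c f] times the new [u]. *)
move=> f0 yz zz; have [N2u N2v] := rank2_uv; have [s s0 sE] := normalize_square (c * f).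
have f'0 : f^-1 != 0 by rewrite invr_eq0.
have := frameZ (oner_neq0 K) f'0 s0 F; rewrite scale1r => F'.
apply: (frame_monomial F' (span2Z f'0 s0 N2uv)); rewrite ?memvZ //=.
  rewrite xx !mulZ yy zz scaler0 scalerA.
  rewrite (_ : s * s * c = (s ^+ 2 * (c * f)) * f^-1); last by field.
  by case: sE => ->; rewrite ?mul0r ?mul1r ?scale0r; mem3.
rewrite -scalerAr xy -scalerAr xz mulZ yz scalerA.
by rewrite (_ : f^-1 * s * f = s); [mem3|field].
Qed.

Lemma rank2_b c : y * z = 0 -> z * z = c *: u ->
  exists2 B, basis_of N B & monomial B.
Proof.
move=> yz zz; have [N2u N2v] := rank2_uv; have [s s0 sE] := normalize_square c.
have := frameZ (oner_neq0 K) (oner_neq0 K) s0 F; rewrite !scale1r => F'.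
have := span2Z (oner_neq0 K) s0 N2uv; rewrite scale1r => N2uv'.
apply: (frame_monomial F' N2uv'); rewrite ?memvZ //=.
  rewrite xx !mulZ yy zz scalerA -expr2.
  by case: sE => ->; rewrite ?scale0r ?scale1r; mem3.
by rewrite -!scalerAr xy xz yz scaler0; mem3.
Qed.

Lemma rank2_c d : d != 0 -> y * z = 0 -> z * z = d *: v ->
  exists2 B, basis_of N B & monomial B.
Proof.
move=> d0 yz zz; have [N2u N2v] := rank2_uv.
have d'0 : d^-1 != 0 by rewrite invr_eq0.
have := frameZ (oner_neq0 K) (oner_neq0 K) d'0 F; rewrite !scale1r => F'.
have := span2Z (oner_neq0 K) d'0 N2uv; rewrite scale1r => N2uv'.
apply: (frame_monomial F' N2uv'); rewrite ?memvZ //=.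
  rewrite xx !mulZ yy zz scalerA (_ : d^-1 * d^-1 * d = d^-1); last by field.
  by mem3.
by rewrite -!scalerAr xy xz yz scaler0; mem3.
Qed.

End Rank2.

Lemma rank2_shift x y z u v (ga be : K) : frame x y z -> x * x = 0 ->
    x * y = u -> x * z = v -> (N * N <= <<[:: u; v]>>)%VS ->
  [/\ frame x y (z + ga *: y + be *: x), x * (z + ga *: y + be *: x) = v + ga *: u
    & (N * N <= span [:: u; v + ga *: u]%R)%VS].
Proof.
move=> F xx xy xz N2uv; split.
- by have := frame_shift 0 ga be F; rewrite scale0r addr0.
- by rewrite !mulrDr -!scalerAr xx xy xz scaler0 addr0.
apply: (span2_sub N2uv); first by rewrite memv_span ?mem_head.
rewrite {1}(_ : v = (- ga) *: u + 1 *: (v + ga *: u)); last by algring.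
exact: span2_lin.
Qed.

(** Replacing [z] by [z + ga y + be x] only affects [v], [y z] and [z z]. The two free parameters
    clear two of the four coefficients [e], [f], [c], [d], and scaling deals with the rest. For
    [f = 0], [be = - e] clears [y z], and if [d - 2 e] is nonzero, [ga] clears the [u] part of
    [z z]. *)
Lemma rank2_monomial x y z : frame x y z -> x * x = 0 -> y * y = 0 ->
  (N * N <= span [:: x * y; x * z]%R)%VS ->
  exists2 B, basis_of N B & monomial B.
Proof.
move=> F xx yy; set u := x * y; set v := x * z => N2uv; have [Nx Ny Nz _] := F.
have [e [f yzE]] : exists e f, y * z = e *: u + f *: v.
  by apply: memv_span2; rewrite (memv_subv N2uv) ?memv_mul.
have [c [d zzE]] : exists c d, z * z = c *: u + d *: v.
  by apply: memv_span2; rewrite (memv_subv N2uv) ?memv_mul.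
have eqyz ga be : y * (z + ga *: y + be *: x) = (e - f * ga + be) *: u + f *: (v + ga *: u).
  transitivity (y * z + ga *: (y * y) + be *: u); first by rewrite /u; algring.
  by rewrite yy yzE; algring.
have eqzz ga be : (z + ga *: y + be *: x) * (z + ga *: y + be *: x) =
    (c + 2 * ga * e + 2 * ga * be - ga * (d + 2 * ga * f + 2 * be)) *: u
    + (d + 2 * ga * f + 2 * be) *: (v + ga *: u).
  transitivity (z * z + (2 * ga) *: (y * z) + (2 * be) *: v + (2 * ga * be) *: u
    + ga ^+ 2 *: (y * y) + be ^+ 2 *: (x * x)); first by rewrite /u /v; algring.
  by rewrite xx yy zzE yzE; algring.
have [f0|f0] := eqVneq f 0.
  have [d0|d0] := eqVneq (d - 2 * e) 0.
    have [F' xz' N2uv'] := rank2_shift 0 (- e) F xx erefl erefl N2uv.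
    apply: (rank2_b F' xx yy erefl xz' N2uv').
      by rewrite eqyz f0 mul0r subr0 subrr !scale0r addr0.
    rewrite eqzz (_ : d + _ + _ = d - 2 * e); last by rewrite f0; ring.
    by rewrite d0 scale0r addr0.
  have [F' xz' N2uv'] := rank2_shift (c / (d - 2 * e)) (- e) F xx erefl erefl N2uv.
  apply: (rank2_c F' xx yy erefl xz' N2uv' d0).
    by rewrite eqyz f0 mul0r subr0 subrr !scale0r addr0.
  rewrite eqzz f0; set g := c / _; rewrite (_ : _ - g * _ = 0) ?scale0r ?add0r.
    by congr (_ *: _); ring.
  have : g * (d - 2 * e) = c by rewrite /g divfK.
  by move=> <-; ring.
(* The choice [be = f ga - e] clears the [u] part of [y z]; the [v] part of [z z] is then
   [d - 2 e + 4 f ga], which this value annihilates. *)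
pose ga := (2 * e - d) / (2 * 2 * f).
have gaE : 2 * 2 * f * ga = 2 * e - d by rewrite /ga mulrCA mulfV ?mulr1 // !mulf_neq0.
have [F' xz' N2uv'] := rank2_shift ga (f * ga - e) F xx erefl erefl N2uv.
apply: (rank2_a F' xx yy erefl xz' N2uv' f0).
  by rewrite eqyz (_ : e - _ + _ = 0) ?scale0r ?add0r //; ring.
rewrite eqzz (_ : d + _ + _ = 0) ?scale0r ?addr0 //.
by rewrite (_ : d = 2 * e - 2 * 2 * f * ga); [ring|rewrite gaE; ring].
Qed.

Section Rank1.
Variables x y z u v : A.
Hypotheses (F : frame x y z) (xx : x * x = 0) (xy : x * y = 0).
Hypotheses (xz : x * z = u) (N2uv : (N * N <= <<[:: u; v]>>)%VS).

Lemma rank1_a r : y * y = v -> y * z = 0 -> z * z = r *: v ->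
  exists2 B, basis_of N B & monomial B.
Proof.
move=> yy yz zz; have [s s0 sE] := normalize_square r; have [Nx Ny Nz _] := F.
have := frameZ (oner_neq0 K) (oner_neq0 K) s0 F; rewrite !scale1r => F'.
have := span2Z s0 (oner_neq0 K) N2uv; rewrite scale1r => N2uv'.
apply: (frame_monomial F' N2uv').
- by rewrite -xz memvZ ?memv_mul.
- by rewrite -yy memv_mul.
- rewrite /= xx mulZ yy zz scalerA -expr2.
  by case: sE => ->; rewrite ?scale0r ?scale1r; mem3.
by rewrite /= -!scalerAr xy xz yz scaler0; mem3.
Qed.

Lemma rank1_b p : y * y = p *: u -> z * z \in [:: 0; v] -> y * z \in [:: 0; v] ->
  v \in (N * N)%VS -> exists2 B, basis_of N B & monomial B.
Proof.
move=> yy zz yz N2v; have [Nx Ny Nz _] := F.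
(* When [p] is nonzero, [x] and hence [u] are scaled by [p], so that [y * y] becomes the new [u]. *)
have [t t0 tE] : exists2 t : K, t != 0 & p = 0 \/ p = t.
  by have [->|p0] := eqVneq p 0; [exists 1; [exact: oner_neq0|left]|exists p; [|right]].
have := frameZ t0 (oner_neq0 K) (oner_neq0 K) F; rewrite !scale1r => F'.
have := span2Z t0 (oner_neq0 K) N2uv; rewrite scale1r => N2uv'.
have memP w : w \in [:: 0; v] -> w \in [:: 0; t *: u; v].
  by rewrite !inE => /orP[]->; rewrite ?orbT.
apply: (frame_monomial F' N2uv') => //.
- by rewrite -xz memvZ ?memv_mul.
- rewrite /= (memP _ zz) mulZ xx yy.
  by case: tE => ->; rewrite ?scale0r ?scaler0; mem3.
by rewrite /= (memP _ yz) -!scalerAl xy xz scaler0; mem3.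
Qed.

End Rank1.

Lemma frame_products x y z U : frame x y z -> x * x \in U -> x * y \in U ->
  x * z \in U -> y * y \in U -> y * z \in U -> z * z \in U -> (N * N <= U)%VS.
Proof.
move=> [Nx Ny Nz NX] *; have XN : {subset [:: x; y; z] <= N}.
  by move=> w; rewrite !inE => /or3P[]/eqP->.
have := N2_generated XN NX; rewrite N3 addv0 span3E => /subv_trans; apply.
rewrite !prodvDl !prodvDr !prodv_line !subv_add -!memvE.
by rewrite (mulrC y x) (mulrC z x) (mulrC z y); do ?[apply/andP; split].
Qed.

Lemma solve2 (a : K) : exists b, 2 * b = a.
Proof. by exists (a / 2); rewrite mulrCA mulfV // mulr1. Qed.

(** Adding multiples of [x] to [y] and [z] adjusts the [u] parts of [y z] and [z z] freely. The [v]
    parts [p], [q], [r] form a binary quadratic form in [y] and [z]: if [p] is nonzero the square is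
    completed, if only [p] vanishes then [r] is cleared, and in each case [v] is replaced by a
    product that has a [v] part. If all three vanish, [N^2] is a line. *)
Lemma rank1_monomial x y z v : frame x y z -> x * x = 0 -> x * y = 0 ->
  (N * N <= span [:: x * z; v]%R)%VS -> exists2 B, basis_of N B & monomial B.
Proof.
move=> F xx xy; set u := x * z => N2uv; have [Nx Ny Nz _] := F.
have [p' [p yyE]] : exists p' p, y * y = p' *: u + p *: v.
  by apply: memv_span2; rewrite (memv_subv N2uv) ?memv_mul.
have [q' [q yzE]] : exists q' q, y * z = q' *: u + q *: v.
  by apply: memv_span2; rewrite (memv_subv N2uv) ?memv_mul.
have [r' [r zzE]] : exists r' r, z * z = r' *: u + r *: v.
  by apply: memv_span2; rewrite (memv_subv N2uv) ?memv_mul.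
have xy' al : x * (y + al *: x) = 0 by rewrite mulrDr -scalerAr xx xy scaler0 addr0.
have xz' ga be : x * (z + ga *: y + be *: x) = u.
  by rewrite !mulrDr -!scalerAr xx xy !scaler0 !addr0.
have yy' al : (y + al *: x) * (y + al *: x) = y * y.
  transitivity (y * y + (2 * al) *: (x * y) + al ^+ 2 *: (x * x)); first by algring.
  by rewrite xx xy !scaler0 !addr0.
have yz' al ga be : (y + al *: x) * (z + ga *: y + be *: x) =
    (q' + ga * p' + al) *: u + (q + ga * p) *: v.
  transitivity (y * z + ga *: (y * y) + al *: u + (be + al * ga) *: (x * y) + (al * be) *: (x * x)).
    by rewrite /u; algring.
  by rewrite xx xy yyE yzE; algring.
have zz' ga be : (z + ga *: y + be *: x) * (z + ga *: y + be *: x) =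
    (r' + 2 * ga * q' + ga ^+ 2 * p' + 2 * be) *: u + (r + 2 * ga * q + ga ^+ 2 * p) *: v.
  transitivity (z * z + (2 * ga) *: (y * z) + (2 * be) *: u + (2 * ga * be) *: (x * y)
    + ga ^+ 2 *: (y * y) + be ^+ 2 *: (x * x)); first by rewrite /u; algring.
  by rewrite xx xy yyE yzE zzE; algring.
have N2uv1 w (a b : K) : w = a *: u + b *: v -> b != 0 -> (N * N <= <<[:: u; w]>>)%VS.
  move=> wE b0; apply: (span2_sub N2uv); first by rewrite memv_span ?mem_head.
  have -> : v = (- (b^-1 * a)) *: u + b^-1 *: w; last exact: span2_lin.
  by rewrite wE scalerDr !scalerA mulVf // scale1r scaleNr addKr.
have [p0|p0] := eqVneq p 0; last first.
  have [ga gaE] : exists ga, q + ga * p = 0.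
    by exists (- (q / p)); rewrite mulNr divfK ?subrr.
  have [rho rhoE] : exists rho, rho * p = r + 2 * ga * q + ga ^+ 2 * p.
    by exists ((r + 2 * ga * q + ga ^+ 2 * p) / p); rewrite divfK.
  have [be beE] := solve2 (rho * p' - (r' + 2 * ga * q' + ga ^+ 2 * p')).
  pose al := - (q' + ga * p').
  apply: (rank1_a (r := rho) (frame_shift al ga be F) xx (xy' al) (xz' ga be) (N2uv1 _ _ _ yyE p0)).
  - exact: yy'.
  - by rewrite yz' gaE subrr !scale0r addr0.
  by rewrite zz' yyE scalerDr !scalerA rhoE beE subrKC.
have [q0|q0] := eqVneq q 0; last first.
  have [ga gaE] : exists ga, r + 2 * ga * q = 0.
    have [h hE] := solve2 (- r / q); exists h.
    by rewrite hE divfK ?subrr.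
  have [be beE] := solve2 (- (r' + 2 * ga * q' + ga ^+ 2 * p')).
  have yz1 : (y + 0 *: x) * (z + ga *: y + be *: x) = (q' + ga * p') *: u + q *: v.
    by rewrite yz' p0 mulr0 !addr0.
  apply: (rank1_b (frame_shift 0 ga be F) xx (xy' 0) (xz' ga be) (N2uv1 _ (q' + ga * p') _ erefl
    q0)).
  - by rewrite yy' yyE p0 scale0r addr0.
  - by rewrite zz' p0 mulr0 addr0 gaE beE subrr !scale0r addr0 mem_head.
  - by rewrite yz1; mem3.
  by rewrite -yz1 memv_mul // !memvD ?memvZ.
have [r0|r0] := eqVneq r 0; last first.
  have := frame_shift (- q') 0 0 F; rewrite !scale0r !addr0 => F'.
  apply: (rank1_b F' xx (xy' _) erefl (N2uv1 _ _ _ zzE r0)).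
  - by rewrite yy' yyE p0 scale0r addr0.
  - by mem3.
  - have := yz' (- q') 0 0; rewrite !scale0r !addr0 => ->.
    by rewrite p0 q0 !mul0r !addr0 subrr !scale0r ?addr0 mem_head.
  - exact: memv_mul.
have : (N * N <= <[u]>)%VS.
  apply: (frame_products F); rewrite ?xx ?xy ?mem0v ?memv_line //.
  - by rewrite yyE p0 scale0r addr0 memvZ ?memv_line.
  - by rewrite yzE q0 scale0r addr0 memvZ ?memv_line.
  - by rewrite zzE r0 scale0r addr0 memvZ ?memv_line.
by move/dimvS; rewrite dN2 dim_vline; case: (u != 0).
Qed.

(** Here [x] annihilates [N], and only [y] and [z] matter; their three products satisfy a relation
    in the plane [N^2], which [null_product] normalises. *)
Lemma rank0_monomial x y z : frame x y z -> x * x = 0 -> x * y = 0 -> x * z = 0 ->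
  exists2 B, basis_of N B & monomial B.
Proof.
move=> F xx xy xz; have [Nx Ny Nz _] := F.
have [y' [z' [eqX yz]]] : exists y' z', <<[:: y'; z']>>%VS = <<[:: y; z]>>%VS /\
    (y' * z' \in 0%VS \/ y' * y' \in 0%VS).
  by apply: (null_product (U := (N * N)%VS)); rewrite ?memv_mul ?sub0v ?dimv0 ?dN2.
have xX w : w \in <<[:: y; z]>>%VS -> (w \in N) * (x * w = 0).
  case/memv_span2=> a [b ->]; rewrite memvD ?memvZ // mulrDr -!scalerAr xy xz.
  by rewrite !scaler0 addr0.
have X'X w : w \in [:: y'; z'] -> w \in <<[:: y; z]>>%VS.
  by move=> wX; rewrite -eqX memv_span.
have [[Ny' xy'] [Nz' xz']] : ((y' \in N) * (x * y' = 0)) * ((z' \in N) * (x * z' = 0)).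
  by split; apply: xX; apply: X'X; mem3.
have F' : frame x y' z'.
  apply: (frame_change F) => //; first by rewrite memv_span ?mem_head.
    rewrite span_cons eqX; apply: memv_subv (addvSr _ _) _; rewrite memv_span //; mem3.
  rewrite span_cons eqX; apply: memv_subv (addvSr _ _) _; rewrite memv_span //; mem3.
rewrite !memv0 in yz; case: yz => /eqP yz.
  apply: (@frame_monomial _ _ _ (y' * y') (z' * z') F'); rewrite ?memv_mul //.
  - by apply: (frame_products F'); rewrite ?xx ?xy' ?xz' ?yz ?mem0v // memv_span //; mem3.
  - by rewrite /= xx; mem3.
  - by rewrite /= xy' xz' yz; mem3.
apply: (@frame_monomial _ _ _ (y' * z') (z' * z') F'); rewrite ?memv_mul //.
- by apply: (frame_products F'); rewrite ?xx ?xy' ?xz' ?yz ?mem0v // memv_span //; mem3.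
- by rewrite /= xx yz; mem3.
- by rewrite /= xy' xz'; mem3.
Qed.

End Pencil.

(** * Base points of a pencil of conics *)

Section Conics.
Variables (K : closedFieldType) (A : comFalgType K).
Hypotheses (two_neq0 : 2 != 0 :> K).
Implicit Types (U V W Z : {vspace A}) (x y z u v : A) (B C X Y : seq A).
Variables (N : {vspace A}).
Hypotheses (NN : (N * N <= N)%VS) (N3 : (N * (N * N) = 0)%VS).
Hypotheses (dN : \dim N = 5) (dN2 : \dim (N * N) = 2).

Lemma tuple_basis U n : \dim U = n -> exists e : n.-tuple A, basis_of U e.
Proof. by move=> <-; exists (vbasis U); apply: vbasisP. Qed.

Lemma dim_diffv U W : (W <= U)%VS -> \dim (U :\: W) = (\dim U - \dim W)%N.
Proof.
move=> sWU; have := dimv_cap_compl U W; rewrite (capv_idPr sWU) => <-.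
by rewrite addKn.
Qed.

Lemma frame_exists1 x : x \in N -> x \notin (N * N)%VS -> exists y z,
  frame N x y z /\ forall a b, (a, b) != (0, 0) -> a *: y + b *: z \notin (<[x]> + N * N)%VS.
Proof.
move=> Nx N2x; set W := (<[x]> + N * N)%VS.
have sWN : (W <= N)%VS by rewrite subv_add -memvE Nx.
have dW : \dim (N :\: W) = 2 by rewrite dim_diffv // dim_addv_line // dN dN2.
have [y [z byz]] := basis2 dW; have sD := diffvSl N W.
have memD w : w \in [:: y; z] -> w \in (N :\: W)%VS by move/(basis_mem byz).
exists y, z; split.
  split=> //; try by apply: memv_subv sD _; rewrite memD // !inE eqxx ?orbT.
  rewrite span_cons (span_basis byz) addvC addvA [(_ + <[x]>)%VS]addvC -/W addvC addv_diff.
  exact: addvSl.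
move=> a b ab0; apply: contra_neqN (basis2_comb byz ab0) => wW.
apply/eqP; rewrite -memv0 -(capv_diff N W) memv_cap wW andbT.
by rewrite memvD // memvZ // memD // !inE eqxx ?orbT.
Qed.

Lemma frame_exists2 x y : x \in N -> y \in N -> x \notin (N * N)%VS ->
  y \notin (<[x]> + N * N)%VS -> exists z, frame N x y z.
Proof.
move=> Nx Ny N2x Wy; set W := (<[y]> + (<[x]> + N * N))%VS.
have sWN : (W <= N)%VS by rewrite !subv_add -!memvE Nx Ny.
have dW : \dim (N :\: W) = 1%N by rewrite dim_diffv // !dim_addv_line // dN dN2.
have [z z0 zE] := basis1 dW; exists z; split=> //.
  by apply: memv_subv (diffvSl N W) _; rewrite zE memv_line.
rewrite span3E -zE; apply: (@subv_trans _ _ (N :\: W + W)%VS).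
  by rewrite addv_diff addvSl.
rewrite subv_add; apply/andP; split.
  by apply: subv_trans (addvSl _ _); apply: subv_trans (addvSr _ _); apply: addvSr.
rewrite !subv_add addvSr andbT; apply/andP; split; apply: subv_trans (addvSl _ _).
  by apply: subv_trans (addvSr _ _); apply: addvSl.
exact: addvSl.
Qed.

(** If [x y = 0] for some [y] independent of [x] modulo [N^2], multiplication by [x] has rank at
    most 1. Otherwise it maps the plane of [y0], [z0] isomorphically onto [N^2]; a direction [y1]
    with [y1^2 = m x y1] exists, and [y1 - (m / 2) x] is then a second generator of square zero, as
    the rank 2 case requires. *)
Lemma base_point_monomial x : x \in N -> x \notin (N * N)%VS -> x * x = 0 ->
  exists2 B, basis_of N B & monomial B.
Proof.
move=> Nx N2x xx; have [y0 [z0 [F0 ind0]]] := frame_exists1 Nx N2x.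
have [_ Ny0 Nz0 _] := F0.
set u0 := x * y0; set v0 := x * z0.
have low y : y \in N -> y \notin (<[x]> + N * N)%VS -> x * y = 0 ->
    exists2 B, basis_of N B & monomial B.
  move=> Ny Wy xy; have [z F] := frame_exists2 Nx Ny N2x Wy; have [_ _ Nz _] := F.
  have [xz|xz] := eqVneq (x * z) 0; first exact: (rank0_monomial NN N3 dN dN2 F).
  have N2xz : x * z \in (N * N)%VS by rewrite memv_mul.
  have [v _ vE] : exists2 v, v != 0 & (N * N :\: <[x * z]>)%VS = <[v]>%VS.
    by apply: basis1; rewrite dim_diffv ?dN2 ?dim_vline ?xz // -memvE.
  apply: (rank1_monomial two_neq0 NN N3 dN dN2 (v := v) F xx xy).
  by rewrite span2E -vE addvC addv_diff addvSl.
have [u00|u00] := eqVneq u0 0.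
  apply: (low y0) => //; have := ind0 1 0; rewrite scale1r scale0r addr0; apply.
  by rewrite xpair_eqE oner_eq0.
have [/vlineP[c vcu]|uv] := boolP (v0 \in <[u0]>%VS).
  apply: (low ((- c) *: y0 + 1 *: z0)).
  - by rewrite memvD ?memvZ.
  - by apply: ind0; rewrite xpair_eqE oner_eq0 andbF.
  - by rewrite mulrDr -!scalerAr -/u0 -/v0 vcu scaleNr scale1r addNr.
have N2uv : (N * N)%VS = <<[:: u0; v0]>>%VS.
  apply/esym/eqP; rewrite eqEdim dN2; apply/andP; split.
    by apply/span_subvP=> w; rewrite !inE => /orP[]/eqP->; rewrite memv_mul.
  by rewrite span2E addvC dim_addv_line // dim_vline u00.
have coords w : w \in (N * N)%VS -> exists a b, w = a *: u0 + b *: v0.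
  by rewrite N2uv; apply: memv_span2.
have [a1 [b1 yyE]] := coords _ (memv_mul Ny0 Ny0).
have [a2 [b2 yzE]] := coords _ (memv_mul Ny0 Nz0).
have [a3 [b3 zzE]] := coords _ (memv_mul Nz0 Nz0).
have [y1 [Ny1 Wy1 [m y1E]]] : exists y, [/\ y \in N, y \notin (<[x]> + N * N)%VS
    & exists m, y * y = m *: (x * y)].
  have [b10|b10] := eqVneq b1 0.
    exists y0; split=> //; last by exists a1; rewrite yyE b10 scale0r addr0.
    have := ind0 1 0; rewrite scale1r scale0r addr0; apply.
    by rewrite xpair_eqE oner_eq0.
  (* the cubic expresses that [y * y] is proportional to [x * y] *)
  have [t tP] := closed_cubic_root (2 * b2 - a1) (b3 - 2 * a2) (- a3) b10.
  exists (t *: y0 + 1 *: z0); split; first by rewrite memvD ?memvZ.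
    by apply: ind0; rewrite xpair_eqE oner_eq0 andbF.
  exists (t ^+ 2 * b1 + 2 * t * b2 + b3).
  transitivity (t ^+ 2 *: (y0 * y0) + (2 * t) *: (y0 * z0) + z0 * z0); first by algring.
  transitivity ((t ^+ 2 * a1 + 2 * t * a2 + a3) *: u0 + (t ^+ 2 * b1 + 2 * t * b2 + b3) *: v0).
    by rewrite yyE yzE zzE; algring.
  rewrite mulrDr -!scalerAr -/u0 -/v0 scale1r scalerDr scalerA; congr (_ *: _ + _).
  by apply/eqP; rewrite -subr_eq0 -oppr_eq0 -tP; apply/eqP; ring.
pose y := y1 - (m / 2) *: x.
have Ny : y \in N by rewrite memvB // memvZ.
have yy : y * y = 0.
  transitivity (y1 * y1 - (2 * (m / 2)) *: (x * y1) + (m / 2) ^+ 2 *: (x * x)).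
    by rewrite /y; move: (m / 2) => h; algring.
  by rewrite xx scaler0 addr0 y1E mulrCA mulfV // mulr1 subrr.
have Wy : y \notin (<[x]> + N * N)%VS.
  apply: contraNN Wy1 => Wy; rewrite -[y1](subrK ((m / 2) *: x)) memvD // memvZ //.
  by apply: memv_subv (addvSl _ _) _; apply: memv_line.
have [z F] := frame_exists2 Nx Ny N2x Wy; have [_ _ Nz NX] := F.
apply: (rank2_monomial two_neq0 NN N3 dN F xx yy).
have : (N * N <= <[x]> * N)%VS.
  by rewrite N2uv; apply/span_subvP=> w; rewrite !inE => /orP[]/eqP->; rewrite memv_mul ?memv_line.
move/subv_trans; apply; apply: subv_trans (prodvSr _ NX) _.
rewrite prodvDr subv_add; apply/andP; split; last first.
  by apply: subv_trans (sub0v _); rewrite -N3 prodvSl // -memvE.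
rewrite span3E !prodvDr !prodv_line xx span2E !subv_add -!memvE mem0v.
by rewrite (memv_subv (addvSl _ _)) ?memv_line // (memv_subv (addvSr _ _)) ?memv_line.
Qed.

End Conics.

Section NetsOfConics.
Variables (K : closedFieldType) (A : comFalgType K).
Hypotheses (two_neq0 : 2 != 0 :> K).
Implicit Types (U V W Z : {vspace A}) (x y z u v : A) (B C X Y : seq A).
Variables (N : {vspace A}).
Hypotheses (NN : (N * N <= N)%VS) (N3 : (N * (N * N) = 0)%VS).
Hypotheses (dN : \dim N = 5) (dN2 : \dim (N * N) = 2).

(* Multiplication on [N / N^2] with values in the plane [N^2] is a pencil of
   conics; a root of its discriminant gives a singular member. *)
Lemma singular_member : exists w u, [/\ w \in N, w \notin (N * N)%VS & (<[w]> * N <= <[u]>)%VS].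
Proof.
have dD : \dim (N :\: (N * N)) = 3 by rewrite dim_diffv // dN dN2.
have [e be] := tuple_basis dD; have [f bf] := tuple_basis dN2.
pose Q k : 'M[K]_3 := \matrix_(i, j) coord f k (e`_i * e`_j).
have eN i : (i < 3)%N -> e`_i \in N.
  move=> lt_i; apply: memv_subv (diffvSl N (N * N)) _; apply: (basis_mem be).
  by rewrite mem_nth // size_tuple.
pose W (w : 'rV[K]_3) := \sum_i w 0 i *: e`_i.
have WQ w k (j : 'I_3) : coord f k (W w * e`_j) = (w *m Q k) 0 j.
  rewrite mxE /W mulr_suml linear_sum; apply: eq_bigr => i _.
  by rewrite mxE -scalerAl linearZ.
have We w (j : 'I_3) : W w * e`_j = (w *m Q 0) 0 j *: f`_0 + (w *m Q 1) 0 j *: f`_1.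
  rewrite [LHS](coord_basis bf); last first.
    by rewrite memv_mul ?eN // memv_suml // => i _; rewrite memvZ ?eN.
  rewrite big_ord_recl big_ord1 !WQ; congr (_ *: _ + _ *: _).
  by congr ((_ *m Q _) _ _); apply: val_inj.
have [w [w0 [u wP]]] : exists w, w != 0 /\ exists u, forall j : 'I_3, W w * e`_j \in <[u]>%VS.
  have [/det0P[w w0 wQ]|D0] := boolP (\det (Q 1) == 0).
    exists w; split=> //; exists f`_0 => j.
    by rewrite We wQ [(0 : 'rV_3) 0 j]mxE scale0r addr0 memvZ ?memv_line.
  have Q1 : Q 1 \in unitmx by rewrite unitmxE unitfE.
  (* For invertible [Q 1], an eigenvalue [la] of this matrix makes [Q 0 - la Q 1] singular; its null
     vector multiplies [N] into the line of [la f_0 + f_1]. *)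
  have [la] := closed_rootP (char_poly (Q 0 *m invmx (Q 1))) ltac:(by rewrite size_char_poly).
  rewrite -eigenvalue_root_char => /eigenvalueP[w wE w0]; exists w; split=> //.
  exists (la *: f`_0 + f`_1) => j.
  have -> : W w * e`_j = (w *m Q 1) 0 j *: (la *: f`_0 + f`_1); last by rewrite memvZ ?memv_line.
  rewrite We -[Q 0](mulmxKV Q1) mulmxA wE -scalemxAl mxE scalerDr scalerA.
  by rewrite (mulrC la).
exists (W w), u; split.
- by rewrite memv_suml // => i _; rewrite memvZ ?eN.
- apply: contraNN w0 => N2w; have : W w = 0.
    apply/eqP; rewrite -memv0 -(capv_diff N (N * N)) memv_cap N2w andbT.
    by rewrite memv_suml // => i _; rewrite memvZ // (basis_mem be) // mem_nth // size_tuple.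
  move/freeP: (basis_free be) => fe /fe w00; apply/eqP/rowP=> i; rewrite mxE; exact: w00.
have Nw : W w \in N by rewrite memv_suml // => i _; rewrite memvZ ?eN.
have NX : (N <= <<e>> + N * N)%VS by rewrite (span_basis be) addv_diff addvSl.
apply: subv_trans (prodvSr _ NX) _; rewrite prodvDr subv_add; apply/andP; split.
  apply/prodvP=> a b /vlineP[c ->] /coord_span->; rewrite -scalerAl memvZ // mulr_sumr.
  by rewrite memv_suml // => j _; rewrite -scalerAr memvZ.
by apply: subv_trans (sub0v _); rewrite -N3 prodvSl // -memvE.
Qed.

(** Let [w] be the singular element, with [w^2] nonzero; then [w N] is the line of [w^2], and [y],
    [z] can be made orthogonal to [w]. A quadratic equation yields [p] in their plane with
    [p^2 = c w^2], and [p + g w] has square zero for [g^2 = - c]. *)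
Lemma base_point : exists x, [/\ x \in N, x \notin (N * N)%VS & x * x = 0].
Proof.
have [w [u [Nw N2w wN]]] := singular_member.
have [ww|ww] := eqVneq (w * w) 0; first by exists w.
have wNE : (<[w]> * N <= <[w * w]>)%VS.
  apply: (subv_trans wN); have /vlineP[c wwE] : w * w \in <[u]>%VS.
    by apply: memv_subv wN _; rewrite memv_mul ?memv_line.
  have c0 : c != 0 by apply: contraNneq ww => c0; rewrite wwE c0 scale0r.
  by rewrite -memvE -(memvZ_neq0 _ _ c0) -wwE memv_line.
have [y0 [z0 [[_ Ny0 Nz0 _] ind0]]] := frame_exists1 NN dN dN2 Nw N2w.
have orth y : y \in N -> exists c, w * (y + c *: w) = 0.
  move=> Ny; have /vlineP[c wyE] : w * y \in <[w * w]>%VS.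
    by apply: memv_subv wNE _; rewrite memv_mul ?memv_line.
  by exists (- c); rewrite mulrDr wyE -scalerAr scaleNr subrr.
have [cy wy] := orth _ Ny0; have [cz wz] := orth _ Nz0.
set y := y0 + cy *: w in wy; set z := z0 + cz *: w in wz.
have Ny : y \in N by rewrite memvD ?memvZ.
have Nz : z \in N by rewrite memvD ?memvZ.
have ind a b : (a, b) != (0, 0) -> a *: y + b *: z \notin (<[w]> + N * N)%VS.
  move/ind0; apply: contraNN => Wyz.
  have -> : a *: y0 + b *: z0 = a *: y + b *: z - (a * cy + b * cz) *: w.
    by rewrite /y /z; algring.
  rewrite memvB // memvZ //; apply: memv_subv (addvSl _ _) _; exact: memv_line.
have ww2 : w * w \in (N * N)%VS by rewrite memv_mul.
have dV : \dim (N * N :\: <[w * w]>) = 1%N.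
  by rewrite dim_diffv ?dN2 ?dim_vline ?ww // -memvE.
have [v v0 vE] := basis1 dV.
have N2wv s : s \in (N * N)%VS -> exists a b, s = a *: (w * w) + b *: v.
  move=> N2s; apply: memv_span2; rewrite span2E -vE addvC addv_diff.
  exact: memv_subv (addvSl _ _) _.
have [a1 [b1 yyE]] := N2wv _ (memv_mul Ny Ny).
have [a2 [b2 yzE]] := N2wv _ (memv_mul Ny Nz).
have [a3 [b3 zzE]] := N2wv _ (memv_mul Nz Nz).
have [p [Np Wp wp [c pp]]] : exists p, [/\ p \in N, p \notin (<[w]> + N * N)%VS, w * p = 0
    & exists c, p * p = c *: (w * w)].
  have [b10|b10] := eqVneq b1 0.
    exists y; split=> //; last by exists a1; rewrite yyE b10 scale0r addr0.
    have := ind 1 0; rewrite scale1r scale0r addr0; apply.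
    by rewrite xpair_eqE oner_eq0.
  have [t tP] := closed_quadratic_root (2 * b2) b3 b10.
  exists (t *: y + 1 *: z); split; first by rewrite memvD ?memvZ.
  - by apply: ind; rewrite xpair_eqE oner_eq0 andbF.
  - by rewrite mulrDr -!scalerAr wy wz !scaler0 addr0.
  exists (t ^+ 2 * a1 + 2 * t * a2 + a3).
  transitivity (t ^+ 2 *: (y * y) + (2 * t) *: (y * z) + z * z).
    by move: (y) (z) => ? ?; algring.
  transitivity ((t ^+ 2 * a1 + 2 * t * a2 + a3) *: (w * w) + (b1 * t ^+ 2 + 2 * b2 * t + b3) *: v).
    by rewrite yyE yzE zzE; algring.
  by rewrite tP scale0r addr0.
have [g gP] := closed_sqrt (- c).
exists (p + g *: w); split; first by rewrite memvD ?memvZ.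
  apply: contraNN Wp => N2p; rewrite -[p](addrK (g *: w)) memvB //.
    exact: memv_subv (addvSr _ _) _.
  by rewrite memvZ //; apply: memv_subv (addvSl _ _) _; exact: memv_line.
transitivity (p * p + (2 * g) *: (w * p) + g ^+ 2 *: (w * w)); first by algring.
by rewrite pp wp scaler0 addr0 gP scaleNr subrr.
Qed.

Lemma monomial_3_2 : exists2 B, basis_of N B & monomial B.
Proof.
by have [x [Nx N2x xx]] := base_point; apply: base_point_monomial Nx N2x xx.
Qed.

End NetsOfConics.

(** If [N^2 / N^3] is not at most a line, it has dimension at least 2, and so has [N / N^2]. With
    [\dim N] at most 5 this leaves four triples of dimensions of [N], [N^2], [N^3]. *)
Lemma nilpotent_monomial (K : closedFieldType) (A : comFalgType K)
    (N : {vspace A}) k : 2 != 0 :> K -> 3 != 0 :> K ->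
  (N * N <= N)%VS -> (N ^+ k = 0)%VS -> (\dim N <= 5)%N ->
  exists2 B, basis_of N B & monomial B.
Proof.
move=> two0 three0 NN Nk dN5.
have [N2_0|N2_0] := eqVneq (N * N)%VS 0%VS.
  exists (vbasis N); first exact: vbasisP.
  move=> x y /vbasis_mem Nx /vbasis_mem Ny; rewrite inE.
  by rewrite -memv0 -N2_0 memv_mul.
have [small|large] := leqP (\dim (N * N)) (\dim (N * (N * N))).+1.
  exact: (curvilinear_monomial two0 NN Nk).
have sub3 : (N * (N * N) <= N * N)%VS by rewrite prodvSr.
have lt2 : (\dim (N * N) < \dim N)%N.
  rewrite ltn_neqAle dimvS // andbT; apply: contraNneq N2_0 => d2.
  have /eqP NE : (N * N)%VS == N by rewrite eqEdim NN d2 leqnn.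
  by rewrite (nakayama0 Nk (I := N * N)) ?NE.
(* A single generator [x] modulo [N^2] would make [N^2] the line of [x * x] modulo [N^3]. *)
have lt2' : ((\dim (N * N)).+1 < \dim N)%N.
  rewrite ltn_neqAle lt2 andbT; apply: contraTN large => /eqP d1.
  have dD : \dim (N :\: (N * N)) = 1%N by rewrite dim_diffv // -d1 subSnn.
  have [x _ xE] := basis1 dD.
  have XN : {subset [:: x] <= N}.
    move=> w; rewrite inE => /eqP->; apply: memv_subv (diffvSl N (N * N)) _.
    by rewrite xE memv_line.
  have NX : (N <= <<[:: x]>> + N * N)%VS.
    by rewrite span_seq1 -xE addv_diff addvSl.
  have := dimvS (N2_generated XN NX); rewrite span_seq1 prodv_line -leqNgt.
  move/leq_trans; apply; apply: leq_trans (dimv_add_leqif _ _) _.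
  by rewrite dim_vline -[X in (_ <= X)%N]add1n leq_add2r leq_b1.
have N3_0 : \dim (N * (N * N)) = 0 -> (N * (N * N) = 0)%VS.
  by move/eqP; rewrite dimv_eq0 => /eqP.
have cases : [\/ \dim N = 4 /\ \dim (N * N) = 2 /\ \dim (N * (N * N)) = 0,
   \dim N = 5 /\ \dim (N * N) = 2 /\ \dim (N * (N * N)) = 0,
   \dim N = 5 /\ \dim (N * N) = 3 /\ \dim (N * (N * N)) = 0
 | \dim N = 5 /\ \dim (N * N) = 3 /\ \dim (N * (N * N)) = 1%N].
  move: (\dim N) (\dim (N * N)) (\dim (N * (N * N))) dN5 lt2' large => a b c *.
  have [?|?] := leqP a 4; [by constructor 1; lia|].
  have [?|?] := leqP b 2; [by constructor 2; lia|].
  by have [?|?] := leqP c 0; [constructor 3; lia|constructor 4; lia].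
case: cases => -[d1 [d2 d3]].
- have d12 : \dim N = (\dim (N * N)).+2 by rewrite d1 d2.
  exact: (monomial_2_2 NN d12 d2 (N3_0 d3)).
- exact: (monomial_3_2 two0 NN (N3_0 d3) d1 d2).
- have d12 : \dim N = (\dim (N * N)).+2 by rewrite d1 d2.
  exact: (monomial_2_3 NN d12 d2 (N3_0 d3)).
- have d12 : \dim N = (\dim (N * N)).+2 by rewrite d1 d2.
  exact: (monomial_2_2_1 two0 three0 NN Nk d12 d2 d3).
Qed.

(** * Decomposition into local algebras *)

Section LocalDecomposition.
Variables (K : closedFieldType) (A : comFalgType K).
Implicit Types (U V W N : {vspace A}) (a c e f x y z w : A) (B C E : seq A).

Lemma memv_limg_amull a x : reflect (exists y, x = a * y) (x \in limg (amull a)).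
Proof.
apply: (iffP memv_imgP) => [[y _ ->]|[y ->]].
  by exists y; rewrite lfunE.
by exists y; rewrite ?memvf ?lfunE.
Qed.

Lemma memv_idem e x : e * e = e -> (x \in limg (amull e)) = (e * x == x).
Proof.
move=> ee; apply/memv_limg_amull/eqP => [[y ->]|<-]; last by exists x.
by rewrite mulrA ee.
Qed.

Lemma eigenvector_in U a : U != 0%VS -> {in U, forall x, a * x \in U} ->
  exists la w, [/\ w \in U, w != 0 & a * w = la *: w].
Proof.
move=> U0 aU; have [b bU] := tuple_basis (erefl (\dim U)).
have bmem (i : 'I_(\dim U)) : b`_i \in U by rewrite (basis_mem bU) // mem_nth // size_tuple.
pose M : 'M[K]_(\dim U) := \matrix_(i, j) coord b j (a * b`_i).
have [la] := closed_rootP (char_poly M) ltac:(by rewrite size_char_poly eqSS dimv_eq0).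
rewrite -eigenvalue_root_char => /eigenvalueP[v vM v0].
exists la, (\sum_i v 0 i *: b`_i); split.
- by rewrite memv_suml // => i _; rewrite memvZ.
- apply: contraNneq v0 => w0; apply/eqP/rowP=> i; rewrite mxE.
  by move/freeP: (basis_free bU) => /(_ _ w0).
rewrite mulr_sumr scaler_sumr.
transitivity (\sum_i \sum_j (v 0 i * M i j) *: b`_j).
  apply: eq_bigr => i _; rewrite -scalerAr {1}(coord_basis bU (aU _ (bmem i))) scaler_sumr.
  by apply: eq_bigr => j _; rewrite mxE scalerA.
rewrite exchange_big; apply: eq_bigr => j _ /=.
by rewrite -scaler_suml scalerA; congr (_ *: _); have /rowP/(_ j) := vM; rewrite !mxE.
Qed.

(** The ideals [c ^+ n A] decrease and must become constant. The equation makes [c ^+ n.+1 * d]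
    idempotent; the positive exponent ensures that this idempotent is a multiple of [c]. *)
Lemma fitting_stable c : exists n d, c ^+ n.+1 = c ^+ n.+1 * (c ^+ n.+1 * d).
Proof.
pose I n := limg (amull (c ^+ n)).
have sI n : (I n.+1 <= I n)%VS.
  apply/subvP=> x /memv_limg_amull[y ->]; apply/memv_limg_amull.
  by exists (c * y); rewrite mulrA -exprSr.
have [n In] : exists n, (I n <= I n.+1)%VS.
  apply: NNPP => noI; have dI n : (\dim (I n) + n <= \dim {:A})%N.
    elim: n => [|n IHn]; first by rewrite addn0 dimvS ?subvf.
    apply: leq_trans IHn; rewrite addnS ltn_add2r ltn_neqAle dimvS // andbT.
    apply/eqP=> dE; case: noI; exists n.
    by have /eqP-> : I n == I n.+1 by rewrite eq_sym eqEdim sI dE leqnn.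
  by have := dI (\dim {:A}).+1; rewrite addnS ltnNge leq_addl.
have InS k : (I n <= I (n + k)%N)%VS.
  elim: k => [|k IHk]; first by rewrite addn0.
  apply: subv_trans IHk _; apply/subvP=> x /memv_limg_amull[y ->].
  have /(subvP In)/memv_limg_amull[z zE] : c ^+ n * y \in I n.
    by apply/memv_limg_amull; exists y.
  apply/memv_limg_amull; exists z.
  rewrite addnC exprD -mulrA zE mulrA -exprD; congr (c ^+ _ * z); lia.
have /(subvP (InS n.+1)) : c ^+ n \in I n by apply/memv_limg_amull; exists 1; rewrite mulr1.
case/memv_limg_amull=> d dE; exists n, d.
rewrite {1}exprS dE !mulrA -exprS -exprD; congr (c ^+ _ * d); lia.
Qed.

(** Idempotents and nilpotents are kept apart because the rank bounds the former and the corank the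
    latter. *)
Definition split_basis U E C := [/\ basis_of U (E ++ C), monomial (E ++ C),
  {in E &, forall e f, e * f = if e == f then e else 0}
  & {in C, forall x, nilpotent x}].

Lemma split_basis_add e f E1 C1 E2 C2 : e * e = e -> f * f = f -> e * f = 0 ->
  split_basis (limg (amull e)) E1 C1 -> split_basis (limg (amull f)) E2 C2 ->
  split_basis (limg (amull e) + limg (amull f)) (E1 ++ E2) (C1 ++ C2).
Proof.
move=> ee ff ef [b1 m1 o1 n1] [b2 m2 o2 n2].
have mul0 x y : x \in E1 ++ C1 -> y \in E2 ++ C2 -> x * y = 0.
  move=> /(basis_mem b1); rewrite memv_idem // => /eqP<-.
  move=> /(basis_mem b2); rewrite memv_idem // => /eqP<-.
  by rewrite mulrACA ef mul0r.
have permE : perm_eq ((E1 ++ E2) ++ (C1 ++ C2)) ((E1 ++ C1) ++ (E2 ++ C2)).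
  by rewrite -!catA perm_cat2l perm_catCA.
split.
- rewrite (perm_basis _ permE) cat_basis //; apply/directv_addP/eqP; rewrite -subv0.
  apply/subvP=> x /memv_capP[]; rewrite !memv_idem // => /eqP<- /eqP<-.
  by rewrite memv0 mulrA [f * e]mulrC ef mul0r.
- move=> x y; rewrite !(perm_mem permE) in_cons (perm_mem permE) -in_cons.
  rewrite (mem_cat x) (mem_cat y) => /orP[x1|x2] /orP[y1|y2].
  + by have := m1 _ _ x1 y1; rewrite !in_cons => /orP[->//|m12]; rewrite mem_cat m12 orbT.
  + by rewrite mul0 // mem_head.
  + by rewrite mulrC mul0 // mem_head.
  + by have := m2 _ _ x2 y2; rewrite !in_cons => /orP[->//|m12]; rewrite mem_cat m12 !orbT.
- have ne x y : x \in E1 -> y \in E2 -> x != y.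
    move=> x1 y2; apply/eqP=> xy; have : x * y = 0 by rewrite mul0 // mem_cat ?x1 ?y2.
    rewrite -xy (o1 _ _ x1 x1) eqxx => x0; have := basis_not0 b1 (x := x).
    by rewrite mem_cat x1 x0 eqxx => /(_ isT).
  move=> x y; rewrite !mem_cat => /orP[x1|x2] /orP[y1|y2].
  + exact: o1.
  + by rewrite (negPf (ne _ _ x1 y2)) mul0 // mem_cat ?x1 ?y2.
  + by rewrite eq_sym (negPf (ne _ _ y1 x2)) mulrC mul0 // mem_cat ?y1 ?x2.
  + exact: o2.
- by move=> x; rewrite mem_cat => /orP[/n1|/n2].
Qed.

Hypotheses (two_neq0 : 2 != 0 :> K) (three_neq0 : 3 != 0 :> K).
Hypothesis small_nil : forall U, {in U, forall x, nilpotent x} -> (\dim U <= 5)%N.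

(** Induction on the dimension of [e A], splitting as long as a proper idempotent exists. If there
    is none, take an eigenvalue [la] of [a] in [e A]: the Fitting idempotent of [a - la e] kills an
    eigenvector, so it is not [e], hence it is 0 and [a - la e] is nilpotent. Thus [e A] is local
    and [nilpotent_monomial] handles its maximal ideal. *)
Lemma split_basis_idem e : e * e = e -> exists E C, split_basis (limg (amull e)) E C.
Proof.
have [n] := ubnP (\dim (limg (amull e))); elim: n e => // n IHn e; rewrite ltnS => le_n ee.
have mE x : (x \in limg (amull e)) = (e * x == x) by apply: memv_idem.
have [e0|e0] := eqVneq e 0.
  exists [::], [::]; split=> //=; rewrite (_ : limg _ = 0%VS) ?nil_basis //.
  by apply/eqP; rewrite -subv0; apply/subvP=> x; rewrite mE e0 mul0r eq_sym memv0.
have [[f [ff ef f0 fe]]|irr] :=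
  classic (exists f, [/\ f * f = f, e * f = f, f != 0 & f != e]).
  pose g := e - f.
  have gg : g * g = g.
    transitivity (e * e - e * f - (e * f - f * f)); first by rewrite /g; ring.
    by rewrite ee ff ef subrr subr0.
  have fg : f * g = 0 by rewrite mulrBr ff mulrC ef subrr.
  have eg : e * g = g by rewrite mulrBr ee ef.
  have sub h : e * h = h -> (limg (amull h) <= limg (amull e))%VS.
    move=> eh; apply/subvP=> x /memv_limg_amull[y ->].
    by rewrite mE mulrA eh.
  have lt h h' : h * h = h -> e * h = h -> e * h' = h' -> h * h' = 0 -> h' != 0 ->
      (\dim (limg (amull h)) < n)%N.
    move=> hh eh eh' hh' h'0; apply: leq_trans le_n; rewrite ltn_neqAle dimvS ?sub // andbT.
    apply: contraNneq h'0 => dE.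
    have /eqP hE : limg (amull h) == limg (amull e) by rewrite eqEdim sub // dE leqnn.
    have : h' \in limg (amull h) by rewrite hE mE eh'.
    by rewrite memv_idem // hh' eq_sym.
  have g0 : g != 0 by rewrite subr_eq0 eq_sym.
  have [E1 [C1 S1]] := IHn f (lt _ _ ff ef eg fg g0) ff.
  have [E2 [C2 S2]] := IHn g (lt _ _ gg eg ef (etrans (mulrC g f) fg) f0) gg.
  exists (E1 ++ E2), (C1 ++ C2).
  rewrite (_ : limg (amull e) = limg (amull f) + limg (amull g))%VS.
    exact: split_basis_add.
  apply/eqP; rewrite eqEsubv; apply/andP; split; last by rewrite subv_add !sub.
  apply/subvP=> x; rewrite mE => /eqP<-.
  by rewrite -[e in e * x](subrKC f) mulrDl memv_add //; apply/memv_limg_amull; exists x.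
have loc a : a \in limg (amull e) -> exists la, nilpotent (a - la *: e).
  move=> ea; have [||la [w [we w0 aw]]] := @eigenvector_in (limg (amull e)) a.
  - by apply: contraNneq e0 => U0; rewrite -memv0 -U0 mE ee.
  - by move=> x; rewrite !mE => /eqP xE; rewrite mulrCA xE.
  exists la; set c := a - la *: e; have [m [d dE]] := fitting_stable c.
  have ec : e * c = c by apply/eqP; rewrite -mE memvB ?memvZ // mE ee.
  have cw : c * w = 0.
    by rewrite mulrBl aw -scalerAl; move: we; rewrite mE => /eqP->; rewrite subrr.
  pose f := c ^+ m.+1 * d.
  have ff : f * f = f.
    transitivity (c ^+ m.+1 * (c ^+ m.+1 * d) * d); last by rewrite -dE.
    by rewrite /f; ring.
  have ef : e * f = f by rewrite /f exprS !mulrA ec.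
  have [f0|f0] := eqVneq f 0; first by exists m.+1; rewrite dE -/f f0 mulr0.
  have [fe|fe] := eqVneq f e; last by case: irr; exists f.
  case/eqP: w0; move: we; rewrite mE => /eqP<-; rewrite -fe /f exprSr.
  by rewrite -!mulrA [d * w]mulrC [c * _]mulrA cw mul0r mulr0.
have [b bU] := tuple_basis (erefl (\dim (limg (amull e)))).
have [la laP] : exists la : 'I_(\dim (limg (amull e))) -> K, forall i : 'I__, nilpotent (b`_i - la
  i *: e).
  apply: (fin_all_exists (P := fun (i : 'I__) l => nilpotent (b`_i - l *: e))) => i.
  by apply/loc/(basis_mem bU)/mem_nth; rewrite size_tuple.
pose X := [seq b`_(nat_of_ord i) - la i *: e | i <- enum 'I_(\dim (limg (amull e)))].
pose N := <<X>>%VS.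
have Nnil : {in N, forall x, nilpotent x}.
  by apply: nilpotent_span => _ /mapP[i _ ->].
have eNil (al : K) : nilpotent (al *: e) -> al = 0.
  case=> m; have eX k : e ^+ k.+1 = e.
    by elim: k => [|k IHk]; rewrite ?expr1 // exprS IHk ee.
  case: m => [/eqP|m]; first by rewrite expr0 oner_eq0.
  move/eqP; rewrite exprZn eX scaler_eq0 (negPf e0) orbF expf_eq0 => /eqP //.
have eAE : limg (amull e) = (<[e]> + N)%VS.
  apply/eqP; rewrite eqEsubv; apply/andP; split.
    rewrite -(span_basis bU); apply/span_subvP=> _ /tnthP[i ->]; rewrite (tnth_nth 0).
    rewrite -[b`_i](subrKC (la i *: e)) memv_add //; first by rewrite memvZ ?memv_line.
    by apply: memv_span; apply: map_f; rewrite mem_enum.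
  rewrite subv_add -memvE mE ee eqxx; apply/span_subvP=> _ /mapP[i _ ->].
  by rewrite memvB ?memvZ ?mE ?ee // -mE (basis_mem bU) // mem_nth // size_tuple.
have NN : (N * N <= N)%VS.
  apply/prodvP=> x y Nx Ny; have : x * y \in limg (amull e).
    have : x \in limg (amull e) by rewrite eAE (memv_subv (addvSr _ _)).
    by rewrite !mE => /eqP xE; rewrite mulrA xE.
  rewrite eAE => /memv_addline[al Nz]; rewrite -[x * y](subrKC (al *: e)).
  (* The product and its component in [N] are both nilpotent, hence so is the multiple [al] of the
     nonzero idempotent [e]. *)
  suffices al0 : al = 0 by move: Nz; rewrite al0 scale0r subr0 add0r.
  apply: eNil; rewrite -[al *: e](subKr (x * y)); apply: nilpotentB; last exact: Nnil.
  by apply: nilpotentMl; apply: Nnil.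
have [k Nk] : exists k, (N ^+ k = 0)%VS.
  by apply: expv_span_nil => _ /mapP[i _ ->].
have [C bC mC] := nilpotent_monomial two_neq0 three_neq0 NN Nk (small_nil Nnil).
have Ne : e \notin N.
  apply/negP=> /Nnil; rewrite -(scale1r e) => /eNil/eqP; by rewrite oner_eq0.
have eC x : x \in C -> e * x = x.
  move/(basis_mem bC) => Nx; apply/eqP; rewrite -mE eAE.
  exact: (memv_subv (addvSr _ _)).
exists [:: e], C; split.
- rewrite eAE -(span_basis bC) -span_cons basisEfree subvv /= free_cons.
  rewrite (span_basis bC) Ne (basis_free bC) /= span_cons (span_basis bC).
  by rewrite dim_addv_line // -(span_basis bC) (eqP (basis_free bC)).
- move=> x y; rewrite /= !inE => /predU1P[->|Cx] /predU1P[->|Cy].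
  + by rewrite ee eqxx orbT.
  + by rewrite eC // Cy !orbT.
  + by rewrite mulrC eC // Cx !orbT.
  + by have := mC _ _ Cx Cy; rewrite inE => /orP[->//|->]; rewrite !orbT.
- by move=> x y; rewrite !inE => /eqP-> /eqP->; rewrite eqxx.
- by move=> x /(basis_mem bC)/Nnil.
Qed.

Lemma split_basis_full : exists E C, split_basis {:A} E C.
Proof.
have [E [C S]] := split_basis_idem (mulr1 1).
exists E, C; suff <- : limg (amull (1 : A)) = {:A}%VS by [].
by apply/eqP; rewrite eqEsubv subvf; apply/subvP=> x _; rewrite memv_idem ?mulr1 ?mul1r.
Qed.

End LocalDecomposition.

(** * Curves in the unit group *)

Section FunctionClass.
Variables (K : fieldType) (T : Type) (C : (T -> K) -> Prop).
Hypotheses (C_ext : forall f g, f =1 g -> C f -> C g).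
Hypotheses (C_cst : forall c, C (fun=> c)).
Hypotheses (C_add : forall f g, C f -> C g -> C (fun t => f t + g t)).
Hypotheses (C_mul : forall f g, C f -> C g -> C (fun t => f t * g t)).

Lemma class_sum (I : Type) (r : seq I) (P : pred I) (f : I -> T -> K) :
  (forall i, C (f i)) -> C (fun t => \sum_(i <- r | P i) f i t).
Proof.
move=> Cf; elim: r => [|i r IHr].
  by apply: C_ext (C_cst 0) => t; rewrite big_nil.
have [Pi|nPi] := boolP (P i).
  by apply: C_ext (C_add (Cf i) IHr) => t; rewrite big_cons Pi.
by apply: C_ext IHr => t; rewrite big_cons (negPf nPi).
Qed.

Lemma class_prod (I : Type) (r : seq I) (P : pred I) (f : I -> T -> K) :
  (forall i, C (f i)) -> C (fun t => \prod_(i <- r | P i) f i t).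
Proof.
move=> Cf; elim: r => [|i r IHr].
  by apply: C_ext (C_cst 1) => t; rewrite big_nil.
have [Pi|nPi] := boolP (P i).
  by apply: C_ext (C_mul (Cf i) IHr) => t; rewrite big_cons Pi.
by apply: C_ext IHr => t; rewrite big_cons (negPf nPi).
Qed.

Lemma class_exp f n : C f -> C (fun t => f t ^+ n).
Proof.
move=> Cf; elim: n => [|n IHn]; first exact: C_ext (C_cst 1).
by apply: C_ext (C_mul Cf IHn) => t; rewrite exprS.
Qed.

(** Stated for an abstract class because it serves polynomial functions, Laurent functions and
    regular functions alike. *)
Lemma class_meval n (p : {mpoly K[n]}) (v : T -> 'I_n -> K) :
  (forall i, C (fun t => v t i)) -> C (fun t => p.@[v t]).
Proof.
move=> Cv; apply: (@C_ext (fun t => \sum_(m <- msupp p) p@_m * \prod_i v t i ^+ m i)).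
  by move=> t; rewrite mevalE.
apply: class_sum => m; apply: C_mul => //; apply: class_prod => i.
exact: class_exp.
Qed.

End FunctionClass.

(** * Exponential and multiplicative curves in an algebra *)

Section PolynomialCurves.
Variables (K : closedFieldType) (A : comFalgType K).
Hypothesis charK : forall n, (n%:R == 0 :> K) = (n == 0%N).

Definition laurent (f : K -> K) :=
  exists D (q : {poly K}), forall z, z != 0 -> z ^+ D * f z = q.[z].

Definition polyfun (f : K -> K) := exists q : {poly K}, forall z, f z = q.[z].

Lemma polyfun_meval n (p : {mpoly K[n]}) (v : K -> 'I_n -> K) :
  (forall i, polyfun (fun t => v t i)) -> polyfun (fun t => p.@[v t]).
Proof.
apply: class_meval => [f g fg [q qE]|c|f g [p1 E1] [p2 E2]|f g [p1 E1] [p2 E2]].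
- by exists q => z; rewrite -fg.
- by exists c%:P => z; rewrite hornerC.
- by exists (p1 + p2) => z; rewrite hornerD E1 E2.
- by exists (p1 * p2) => z; rewrite hornerM E1 E2.
Qed.

Lemma laurent_meval n (p : {mpoly K[n]}) (v : K -> 'I_n -> K) :
  (forall i, laurent (fun t => v t i)) -> laurent (fun t => p.@[v t]).
Proof.
apply: class_meval => [f g fg [D [q qE]]|c|f g [D1 [p1 E1]] [D2 [p2 E2]]|f g [D1 [p1 E1]] [D2 [p2
  E2]]].
- by exists D, q => z /qE; rewrite -fg.
- by exists 0%N, c%:P => z _; rewrite hornerC expr0 mul1r.
- exists (D1 + D2)%N, ('X^D2 * p1 + 'X^D1 * p2) => z z0.
  by rewrite !hornerE -E1 // -E2 // exprD; ring.
- exists (D1 + D2)%N, (p1 * p2) => z z0.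
  by rewrite hornerM -E1 // -E2 // exprD mulrACA.
Qed.

Lemma polyfun_curve n (b : 'I_n -> A) (g : 'I_n -> K -> K) : (forall i, polyfun (g i)) ->
  exists P : {poly A}, forall c, \sum_i g i c *: b i = P.[c%:A].
Proof.
case/fin_all_exists=> q qE.
exists (\sum_i b i *: map_poly (in_alg A) (q i)) => c.
rewrite horner_sum; apply: eq_bigr => i _.
by rewrite hornerZ -in_algE horner_map /= qE mulr_algr.
Qed.

Lemma laurent_curve n (b : 'I_n -> A) (g : 'I_n -> K -> K) : (forall i, laurent (g i)) ->
  exists D (P : {poly A}), forall c, c != 0 -> c ^+ D *: (\sum_i g i c *: b i) = P.[c%:A].
Proof.
move=> gl; have [D [q qE]] : exists (D : 'I_n -> nat) (q : 'I_n -> {poly K}),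
    forall i z, z != 0 -> z ^+ D i * g i z = (q i).[z].
  have [D DE] := fin_all_exists (P := fun i D => exists q : {poly K},
    forall z, z != 0 -> z ^+ D * g i z = q.[z]) gl.
  by have [q qE] := fin_all_exists DE; exists D, q.
pose D0 := (\sum_i D i)%N.
exists D0, (\sum_i b i *: map_poly (in_alg A) ('X^(D0 - D i) * q i)) => c c0.
rewrite horner_sum scaler_sumr; apply: eq_bigr => i _.
rewrite hornerZ -in_algE horner_map hornerM hornerXn -qE // mulrA -exprD subnK.
  by rewrite scalerA /= mulr_algr.
by rewrite /D0 (bigD1 i) //= leq_addr.
Qed.

(** With zero divisors in [A] the degree bounds the number of roots only when their pairwise
    differences are units, as is the case for distinct scalars. *)
Lemma scalar_eq0 (P : {poly A}) (f : nat -> K) : injective f ->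
  (forall n, P.[(f n)%:A] = 0) -> P = 0.
Proof.
move=> injf Pf; apply/eqP; apply: contraT => P0.
have := @max_ring_poly_roots A P [seq (f i)%:A | i <- iota 0 (size P)] P0.
rewrite size_map size_iota ltnn; apply.
  by apply/allP=> _ /mapP[i _ ->]; apply/rootP.
elim: (iota 0 (size P)) (iota_uniq 0 (size P)) => //= i s IHs /andP[i_s /IHs->].
rewrite andbT; apply/allP=> _ /mapP[j sj ->]; rewrite /diff_roots mulrC eqxx -scalerBl /=.
rewrite scaler_unit ?unitr1 // unitfE subr_eq0.
by apply: contraNneq i_s => /injf <-.
Qed.

Lemma natr_injK : injective (fun n => n%:R : K).
Proof.
move=> m n; wlog le_mn : m n / (m <= n)%N.
  by move=> IH; case: (leqP m n) => [/IH //|/ltnW /IH h /esym /h].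
move/eqP; rewrite eq_sym -subr_eq0 -natrB // charK subn_eq0 => le_nm.
by apply/eqP; rewrite eqn_leq le_mn.
Qed.

Lemma poly_ext_nat (P Q : {poly A}) :
  (forall n : nat, P.[(n%:R : K)%:A] = Q.[(n%:R : K)%:A]) -> P = Q.
Proof.
move=> PQ; apply/eqP; rewrite -subr_eq0; apply/eqP; apply: (scalar_eq0 natr_injK) => n.
by rewrite hornerD hornerN PQ subrr.
Qed.

Lemma poly_ext (P Q : {poly A}) : (forall c : K, P.[c%:A] = Q.[c%:A]) -> P = Q.
Proof. by move=> PQ; apply: poly_ext_nat => n. Qed.

Lemma poly_ext_neq0 (P Q : {poly A}) :
  (forall c : K, c != 0 -> P.[c%:A] = Q.[c%:A]) -> P = Q.
Proof.
move=> PQ; apply/eqP; rewrite -subr_eq0; apply/eqP.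
apply: (@scalar_eq0 _ (fun n => n.+1%:R)) => [m n /natr_injK[]//|n].
by rewrite hornerD hornerN PQ ?subrr // charK.
Qed.

Lemma ode_coef (u : A) (P : {poly A}) k : P^`() = u%:P * P -> (k.+1%:R : K) *: P`_k.+1 = u * P`_k.
Proof. by move=> PE; rewrite scaler_nat -coef_deriv PE coefCM. Qed.

(** The equation characterises [exp (u X)] up to its constant term: it is a recursion on
    coefficients, solvable because [k.+1] is invertible. It replaces power series in the lemmas
    below. *)
Lemma ode_unique (u : A) (P Q : {poly A}) : P^`() = u%:P * P -> Q^`() = u%:P * Q ->
  P`_0 = Q`_0 -> P = Q.
Proof.
move=> PE QE PQ0; apply/polyP; elim=> [//|k IHk].
have k0 : k.+1%:R != 0 :> K by rewrite charK.
by apply: (scalerI k0); rewrite (ode_coef _ PE) (ode_coef _ QE) IHk.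
Qed.

Lemma ode_shift (u : A) (P : {poly A}) (c : A) : P^`() = u%:P * P ->
  (P \Po ('X + c%:P))^`() = u%:P * (P \Po ('X + c%:P)).
Proof.
move=> PE; rewrite deriv_comp PE comp_polyM comp_polyC derivD derivX derivC addr0.
by rewrite mulr1.
Qed.

(** The coefficients of [P] are [u ^+ k / k!], and a polynomial has only finitely many nonzero
    ones. *)
Lemma ode_nilpotent (u : A) (P : {poly A}) : P^`() = u%:P * P -> P`_0 = 1 ->
  nilpotent u /\ nilpotent (P.[1] - 1).
Proof.
move=> PE P0.
have uX k : u ^+ k = (k`!%:R : K) *: P`_k.
  elim: k => [|k IHk]; first by rewrite P0 scale1r.
  by rewrite exprS IHk -scalerAr -(ode_coef _ PE) scalerA factS natrM mulrC.
have nu : nilpotent u by exists (size P); rewrite uX nth_default ?scaler0.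
split=> //; rewrite horner_coef.
have -> : size P = (size P).-1.+1.
  by rewrite prednK // lt0n size_poly_eq0; apply: contra_eq_neq P0 => ->;
    rewrite coef0 eq_sym oner_eq0.
rewrite big_ord_recl expr0 mulr1 P0 addrC addrA addNr add0r; apply: nilpotent_sum => i.
rewrite expr1n mulr1; have := uX (bump 0 i); rewrite /bump /= add1n => /(congr1 (fun w =>
  (i.+1`!%:R)^-1 *: w)).
rewrite scalerA mulVf ?charK -?lt0n ?fact_gt0 // scale1r => <-.
by apply: nilpotentZ; rewrite exprSr; apply: nilpotentMl.
Qed.

Definition exp_poly (u : A) m : {poly A} := \poly_(k < m) ((k`!%:R : K)^-1 *: u ^+ k).

Lemma exp_poly_ode u m : u ^+ m = 0 -> (exp_poly u m)^`() = u%:P * exp_poly u m.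
Proof.
move=> um; apply/polyP=> k; rewrite coef_deriv coefCM !coef_poly.
have f0 j : j`!%:R != 0 :> K by rewrite charK -lt0n fact_gt0.
have [lt_km|le_mk] := ltnP k m; last by rewrite ltnNge (leqW le_mk) mul0rn mulr0.
rewrite -scaler_nat -scalerAr -exprS.
have [lt_k1m|] := ltnP k.+1 m.
  rewrite scalerA factS natrM invfM mulrA mulfV ?mul1r //.
  by rewrite charK.
by move/(nilpotentW um)->; rewrite !scaler0.
Qed.

Lemma exp_poly0 u m : u ^+ m = 0 -> (exp_poly u m)`_0 = 1.
Proof.
case: m => [/eqP|m _]; first by rewrite expr0 oner_eq0.
by rewrite coef_poly /= invr1 scale1r expr0.
Qed.

(** Both [P (X + d)] and [P (d) P (X)] solve the equation, with the same constant term. *)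
Lemma ode_addition (u : A) (P : {poly A}) (c d : A) : P^`() = u%:P * P -> P`_0 = 1 ->
  P.[c + d] = P.[c] * P.[d].
Proof.
move=> PE P0.
have : P \Po ('X + d%:P) = P.[d] *: P.
  apply: (@ode_unique u); first exact: ode_shift.
    by rewrite derivZ PE scalerAr.
  by rewrite coefZ P0 mulr1 -horner_coef0 horner_comp !hornerE.
by move/(congr1 (fun p => p.[c])); rewrite horner_comp !hornerE mulrC.
Qed.

Lemma ode_horner_nat (u : A) (P : {poly A}) n : P^`() = u%:P * P -> P`_0 = 1 ->
  P.[(n%:R : K)%:A] = P.[1] ^+ n.
Proof.
move=> PE P0; elim: n => [|n IHn]; first by rewrite scale0r horner_coef0 P0.
by rewrite mulrSr scalerDl scale1r (ode_addition _ _ PE) // IHn exprSr.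
Qed.

Lemma ode_unit (u : A) (P : {poly A}) : P^`() = u%:P * P -> P`_0 = 1 -> P.[1] \is a GRing.unit.
Proof.
move=> PE P0; apply/unitrPr; exists P.[-1].
by rewrite -(ode_addition _ _ PE) // subrr horner_coef0 P0.
Qed.

(** Injectivity of the exponential without a logarithm: the value at 1 determines the values at all
    natural numbers, hence the polynomial, hence [u]. *)
Lemma ode_inj (u v : A) (P Q : {poly A}) : P^`() = u%:P * P -> P`_0 = 1 ->
  Q^`() = v%:P * Q -> Q`_0 = 1 -> P.[1] = Q.[1] -> u = v.
Proof.
move=> PE P0 QE Q0 PQ1; have PQ : P = Q.
  by apply: poly_ext_nat => n; rewrite (ode_horner_nat _ PE) // (ode_horner_nat _ QE) // PQ1.
have := congr1 (fun p : {poly A} => p`_0) PE; have := congr1 (fun p : {poly A} => p`_0) QE.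
by rewrite !coefCM P0 Q0 !mulr1 PQ => -> ->.
Qed.

(** Some [p i] may be zero, so that the products of two families can be used as they are in
    [diagonalizableM]. *)
Definition diagonalizable (x : A) := exists (I : finType) (c : I -> K) (p : I -> A),
  [/\ forall i j, p i * p j = if i == j then p i else 0, \sum_i p i = 1
    & x = \sum_i c i *: p i].

Lemma diagonalizable1 : diagonalizable 1.
Proof.
exists unit, (fun=> 1), (fun=> 1); split=> [[] []|  |]; rewrite ?eqxx ?mulr1 //.
  by rewrite big_const cardT enumT unlock /= addr0.
by rewrite big_const cardT enumT unlock /= scale1r addr0.
Qed.

Lemma diagonalizableM x y : diagonalizable x -> diagonalizable y -> diagonalizable (x * y).
Proof.
case=> I [c [p [pp p1 ->]]] [J [d [q [qq q1 ->]]]].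
exists (I * J)%type, (fun ij => c ij.1 * d ij.2), (fun ij => p ij.1 * q ij.2); split.
- move=> [i j] [i' j'] /=; rewrite mulrACA pp qq xpair_eqE.
  by case: eqP; case: eqP => /=; rewrite ?mul0r ?mulr0.
- rewrite -(pair_big xpredT xpredT (fun i j => p i * q j)) /= -[RHS]mul1r -{1}p1 -q1.
  by rewrite big_distrlr.
rewrite -(pair_big xpredT xpredT (fun i j => (c i * d j) *: (p i * q j))) /= big_distrlr /=.
by apply: eq_bigr => i _; apply: eq_bigr => j _; rewrite -scalerAl -scalerAr scalerA.
Qed.

Lemma diagonalizable_unipotent x : diagonalizable x -> nilpotent (x - 1) -> x = 1.
Proof.
case=> I [c [p [pp p1 ->]]] [m x0].
have xE : \sum_i c i *: p i - 1 = \sum_i (c i - 1) *: p i.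
  by rewrite -[X in _ - X]p1 -sumrB; apply: eq_bigr => i _; rewrite scalerBl scale1r.
have pE (d : I -> K) j : (\sum_i d i *: p i) * p j = d j *: p j.
  rewrite mulr_suml (bigD1 j) //= big1 ?addr0 => [|i ij]; first by rewrite -scalerAl pp eqxx.
  by rewrite -scalerAl pp (negPf ij) scaler0.
have pow j n : (\sum_i c i *: p i - 1) ^+ n * p j = (c j - 1) ^+ n *: p j.
  elim: n => [|n IHn]; first by rewrite !expr0 mul1r scale1r.
  by rewrite exprSr -mulrA [in X in _ * X]xE pE -scalerAr IHn scalerA -exprS.
apply/eqP; rewrite -subr_eq0 xE big1 // => j _; have := pow j m.
rewrite x0 mul0r => /esym/eqP; rewrite scaler_eq0 expf_eq0.
by case/orP=> [/andP[_ /eqP->]|/eqP->]; rewrite ?scale0r ?scaler0.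
Qed.

Lemma coef_comp_polyZX (P : {poly A}) (c : A) k : (P \Po (c *: 'X))`_k = c ^+ k * P`_k.
Proof.
rewrite coef_comp_poly; have [lt_k|le_k] := ltnP k (size P); last first.
  rewrite nth_default // mulr0 big1 // => i _; rewrite exprZn coefZ coefXn.
  by rewrite (gtn_eqF (leq_trans (ltn_ord i) le_k)) !mulr0.
rewrite (bigD1 (Ordinal lt_k)) //= big1 ?addr0 => [|i ik].
  by rewrite exprZn coefZ coefXn eqxx mulr1 mulrC.
by rewrite exprZn coefZ coefXn eq_sym (negPf ik : (i == k :> nat) = false) !mulr0.
Qed.

(* Comparing coefficients in [g (c * d) = g c * g d] shows that the coefficients
   of [P] are orthogonal idempotents. *)
Lemma multiplicative_curve_diagonalizable (g : K -> A) :
  (exists D (P : {poly A}), forall c, c != 0 -> c ^+ D *: g c = P.[c%:A]) ->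
  (forall c d, c != 0 -> d != 0 -> g (c * d) = g c * g d) -> g 1 = 1 ->
  forall c, c != 0 -> diagonalizable (g c).
Proof.
move=> [D [P PE]] gM g1 c c0.
have PM a b : a != 0 -> b != 0 -> P.[(a * b)%:A] = P.[a%:A] * P.[b%:A].
  by move=> a0 b0; rewrite -!PE ?mulf_neq0 // gM // exprMn -scalerAl -scalerAr scalerA.
have Pk k b : b != 0 -> b ^+ k *: P`_k = P`_k * P.[b%:A].
  move=> b0; have : P \Po (b%:A *: 'X) = P.[b%:A] *: P.
    apply: poly_ext_neq0 => a a0; rewrite horner_comp !hornerE -scalerAl mul1r.
    by rewrite scalerA [b * a]mulrC PM // mulrC.
  move/(congr1 (fun p : {poly A} => p`_k)); rewrite coefZ mulrC => <-.
  by rewrite coef_comp_polyZX exprZn expr1n mulr_algl.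
have Pkk k j : P`_k * P`_j = if k == j then P`_k else 0.
  have : P`_k *: 'X^k = P`_k *: P.
    apply: poly_ext_neq0 => a a0; rewrite !hornerZ hornerXn -Pk //.
    by rewrite exprZn expr1n mulr_algr.
  move/(congr1 (fun p : {poly A} => p`_j)); rewrite !coefZ coefXn eq_sym => <-.
  by case: eqP; rewrite ?mulr1 ?mulr0.
(* The coefficients of [P] are the projections onto the weight spaces of a one-parameter torus, the
   weight being [i - D]. *)
exists 'I_(size P), (fun i : 'I__ => (c ^+ D)^-1 * c ^+ i), (fun i : 'I__ => P`_i); split.
- by move=> i j; rewrite Pkk.
- have := PE 1 (oner_neq0 K); rewrite g1 expr1n !scale1r => ->.
  by rewrite horner_coef; apply: eq_bigr => i _; rewrite expr1n mulr1.
have cD : c ^+ D != 0 by rewrite expf_neq0.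
apply: (scalerI cD); rewrite PE // horner_coef scaler_sumr; apply: eq_bigr => i _.
by rewrite scalerA mulVKf // exprZn expr1n mulr_algr.
Qed.

End PolynomialCurves.

(** * Algebras whose unit group is a torus times a vector group *)

Section UnitGroupParametrization.
Variables (K : closedFieldType) (A : comFalgType K) (r s : nat).
Hypothesis charK : forall n, (n%:R == 0 :> K) = (n == 0%N).
Local Notation pt := 'rV[K]_(r + r + s).
Variable rho : pt -> A.
Variables (dimA : nat) (bas : 'I_dimA -> A) (F : 'I_dimA -> {mpoly K[r + r + s]}).
Hypothesis rhoE : forall x, tv_pt x -> rho x = \sum_i (F i).@[x 0] *: bas i.
Hypothesis rho1 : rho (tv_one K r s) = 1.
Hypothesis rhoM : forall x y, tv_pt x -> tv_pt y -> rho (tv_mul x y) = rho x * rho y.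
Hypothesis rho_inj : forall x, tv_pt x -> rho x = 1 -> x = tv_one K r s.
Hypothesis rho_surj : forall w, w \is a GRing.unit -> exists2 x, tv_pt x & w = rho x.

Definition vector_pt (a : 'rV[K]_s) : pt := tv_mk (const_mx 1) (const_mx 1) a.

Lemma vector_ptP a : tv_pt (vector_pt a).
Proof. by move=> i; rewrite !tv_mkE !mxE mulr1. Qed.

Lemma rho_vectorD a b : rho (vector_pt (a + b)) = rho (vector_pt a) * rho (vector_pt b).
Proof.
rewrite -rhoM; try exact: vector_ptP; congr rho; rewrite /tv_mul !tv_mkE.
by congr tv_mk; apply/rowP=> i; rewrite !mxE mulr1.
Qed.

Lemma vector_pt0 : vector_pt 0 = tv_one K r s.
Proof. by []. Qed.

Lemma vector_curve (a : 'rV[K]_s) : exists P : {poly A},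
  forall c, rho (vector_pt (c *: a)) = P.[c%:A].
Proof.
have [|P PE] := polyfun_curve bas (g := fun i c => (F i).@[vector_pt (c *: a) 0]).
  move=> j; apply: polyfun_meval => i; rewrite /vector_pt /tv_mk.
  case: (split_ordP i) => k ->.
    exists 1 => z; rewrite row_mxEl hornerC.
    by case: (split_ordP k) => l ->; rewrite ?row_mxEl ?row_mxEr mxE.
  by exists ((a 0 k) *: 'X) => z; rewrite row_mxEr mxE !hornerE mulrC.
by exists P => c; rewrite rhoE ?PE //; apply: vector_ptP.
Qed.

(** By [poly_ext] the polynomial is unique, so the choice made here is canonical and identities
    between curves can be checked on scalars. *)
Definition curve a : {poly A} := epsilon (inhabits 0) (fun P : {poly A} =>
  forall c, rho (vector_pt (c *: a)) = P.[c%:A]).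

Lemma curveE a c : rho (vector_pt (c *: a)) = (curve a).[c%:A].
Proof. by move: c; apply: (epsilon_spec (inhabits 0) _ (vector_curve a)). Qed.

Definition tangent a : A := (curve a)^`().[0].

Lemma curve_at0 a : (curve a).[0] = 1.
Proof. by have := curveE a 0; rewrite !scale0r rho1. Qed.

(** The curve of [k a + b] is the curve of [a] at [k X] times the curve of [b]; the product rule at
    0 gives the claim. *)
Lemma tangent_linear : linear tangent.
Proof.
move=> k a b; rewrite /tangent; have -> : curve (k *: a + b) = (curve a \Po (k%:A *: 'X)) * curve b.
  apply: (poly_ext charK) => c; rewrite -curveE scalerDr rho_vectorD hornerM -curveE; congr (_ * _).
  by rewrite horner_comp !hornerE -scalerAl mul1r !scalerA -curveE mulrC.
rewrite derivM deriv_comp derivZ derivX !hornerE !horner_comp !hornerE /=.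
by rewrite !curve_at0 !mulr1 mul1r mulr_algr.
Qed.

HB.instance Definition _ := GRing.isSemilinear.Build K 'rV[K]_s A _ tangent
  (GRing.semilinear_linear tangent_linear).

(** Differentiating [rho ((d + c) a) = rho (d a) rho (c a)] with respect to [d] at 0. *)
Lemma curve_ode a : (curve a)^`() = (tangent a)%:P * curve a.
Proof.
apply: (poly_ext charK) => c.
have : curve a \Po ('X + (c%:A)%:P) = (curve a).[c%:A] *: curve a.
  apply: (poly_ext charK) => d; rewrite horner_comp !hornerE -scalerDl -!curveE scalerDl.
  by rewrite rho_vectorD mulrC.
move/(congr1 (fun p : {poly A} => p^`().[0])).
rewrite deriv_comp derivD derivX derivC addr0 mulr1 horner_comp !hornerE => ->.
by rewrite derivZ hornerZ mulrC.
Qed.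

Lemma curve_coef0 a : (curve a)`_0 = 1.
Proof. by rewrite -horner_coef0 curve_at0. Qed.

Lemma rho_vector a : rho (vector_pt a) = (curve a).[1].
Proof. by have := curveE a 1; rewrite !scale1r. Qed.

Definition coordinate_pt (i : 'I_r) (z : K) : pt :=
  tv_mk (\row_j (if j == i then z else 1)) (\row_j (if j == i then z^-1 else 1)) 0.

Lemma coordinate_ptP i z : z != 0 -> tv_pt (coordinate_pt i z).
Proof. by move=> z0 j; rewrite !tv_mkE !mxE; case: eqP; rewrite ?mulfV ?mulr1. Qed.

Lemma rho_coordinate_diagonalizable i z : z != 0 -> diagonalizable (rho (coordinate_pt i z)).
Proof.
move: z; apply: multiplicative_curve_diagonalizable => [//||c d c0 d0|].
- have [|D [P PE]] := laurent_curve bas (g := fun j c => (F j).@[coordinate_pt i c 0]).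
    move=> j; apply: laurent_meval => k; rewrite /coordinate_pt /tv_mk.
    case: (split_ordP k) => l ->; last by exists 0%N, 0 => z _; rewrite row_mxEr mxE hornerC mulr0.
    case: (split_ordP l) => m ->.
      have [->|ni] := eqVneq m i.
        by exists 0%N, 'X => z _; rewrite !row_mxEl mxE eqxx hornerX expr0 mul1r.
      by exists 0%N, 1 => z _; rewrite !row_mxEl mxE (negPf ni) hornerC mulr1.
    have [->|ni] := eqVneq m i.
      by exists 1%N, 1 => z z0; rewrite row_mxEl row_mxEr mxE eqxx hornerC expr1 mulfV.
    by exists 0%N, 1 => z _; rewrite row_mxEl row_mxEr mxE (negPf ni) hornerC mulr1.
  by exists D, P => z z0; rewrite rhoE ?PE //; apply: coordinate_ptP.
- rewrite -rhoM; try exact: coordinate_ptP; congr rho; rewrite /tv_mul !tv_mkE addr0.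
  by congr tv_mk; apply/rowP=> j; rewrite !mxE; case: eqP; rewrite ?invfM ?mulr1.
rewrite -rho1; congr rho; rewrite /coordinate_pt /tv_one invr1.
by congr tv_mk; apply/rowP=> j; rewrite !mxE if_same.
Qed.

Lemma torus_diagonalizable (t u : 'rV[K]_r) : (forall i, t 0 i * u 0 i = 1) ->
  diagonalizable (rho (tv_mk t u 0)).
Proof.
move=> tu; have t0 i : t 0 i != 0.
  by apply/eqP=> ti0; have := tu i; rewrite ti0 mul0r => /esym/eqP; rewrite oner_eq0.
have uE i : u 0 i = (t 0 i)^-1 by apply: (mulfI (t0 i)); rewrite tu mulfV.
pose part (l : seq 'I_r) : pt := tv_mk (\row_j (if j \in l then t 0 j else 1))
  (\row_j (if j \in l then (t 0 j)^-1 else 1)) 0.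
(* [part l] replaces the coordinates outside [l] by 1, so the point is built up as a product of
   points with one nontrivial coordinate. *)
suffices part_diag l : uniq l -> tv_pt (part l) /\ diagonalizable (rho (part l)).
  have [_] := part_diag _ (enum_uniq 'I_r); congr (diagonalizable (rho (tv_mk _ _ _))).
    by apply/rowP=> j; rewrite mxE mem_enum.
  by apply/rowP=> j; rewrite mxE mem_enum uE.
elim: l => [_|i l IHl /= /andP[il /IHl[lP lD]]].
  rewrite /part (_ : tv_mk _ _ _ = tv_one K r s) ?rho1; last first.
    by congr tv_mk; apply/rowP=> j; rewrite !mxE.
  by split; [apply: tv_pt1|apply: diagonalizable1].
have -> : part (i :: l) = tv_mul (coordinate_pt i (t 0 i)) (part l).
  rewrite /tv_mul !tv_mkE addr0; congr tv_mk; apply/rowP=> j; rewrite !mxE inE.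
    by have [->|] := eqVneq j i; rewrite ?(negPf il) ?mulr1 ?mul1r.
  by have [->|] := eqVneq j i; rewrite ?(negPf il) ?mulr1 ?mul1r.
have iP := coordinate_ptP i (t0 i).
split; first exact: tv_ptM.
by rewrite rhoM //; apply: diagonalizableM lD; apply: rho_coordinate_diagonalizable.
Qed.

(* Removing the vector part of the preimage of [exp u] leaves an element of the
   torus that is both diagonalizable and unipotent, hence 1. *)
Lemma nilpotent_tangent u : nilpotent u -> exists a, u = tangent a.
Proof.
case=> m um; pose E := exp_poly u m.
have EE := exp_poly_ode charK um; have E0 := exp_poly0 um.
have [x xP Ex] := rho_surj (ode_unit charK EE E0).
pose a := tv_a x; pose y := tv_mk (tv_t x) (tv_u x) (0 : 'rV[K]_s).
have yP : tv_pt y by move=> i; rewrite !tv_mkE xP.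
have xE : x = tv_mul y (vector_pt a).
  rewrite -[LHS]tv_mkK /tv_mul !tv_mkE add0r.
  by congr tv_mk; apply/rowP=> i; rewrite !mxE mulr1.
have yE : rho y = E.[1] * rho (vector_pt (- a)).
  rewrite Ex xE rhoM //; last exact: vector_ptP.
  by rewrite -mulrA -rho_vectorD subrr vector_pt0 rho1 mulr1.
have y1 : rho y = 1.
  apply: diagonalizable_unipotent; first by apply: torus_diagonalizable => i; apply: xP.
  have [_ n1] := ode_nilpotent charK EE E0.
  have [_ n2] := ode_nilpotent charK (curve_ode (- a)) (curve_coef0 (- a)).
  rewrite yE rho_vector; move: n1 n2; move: (exp_poly u m).[1] (curve (- a)).[1] => e f n1 n2.
  have -> : e * f - 1 = (f - 1) * (e - 1) + (e - 1) + (f - 1) by ring.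
  by apply: (nilpotentD _ n2); apply: (nilpotentD _ n1); apply: nilpotentMl.
exists a; apply: (ode_inj charK EE E0 (curve_ode a) (curve_coef0 a)).
by rewrite Ex xE rhoM ?y1 ?mul1r ?rho_vector //; apply: vector_ptP.
Qed.

Lemma dim_nilpotent (U : {vspace A}) : {in U, forall x, nilpotent x} -> (\dim U <= s)%N.
Proof.
move=> Unil; have : (U <= limg (linfun tangent))%VS.
  apply/subvP=> u /Unil/nilpotent_tangent[a ->]; apply/memv_imgP.
  by exists a; rewrite ?memvf ?lfunE.
have dS : \dim {:'rV[K]_s} = s by rewrite dimvf dim_matrix; apply: mul1n.
move/dimvS/leq_trans; apply; rewrite -[leqRHS]dS.
by rewrite -(limg_ker_dim (linfun tangent) fullv) leq_addl.
Qed.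

(* For a partial sum [S] of [E] the element [1 - 2 S] is a square root of 1, and
   the square roots of 1 in the group have signs as torus coordinates. *)
Lemma size_idempotents (E : seq A) : uniq E -> 0 \notin E ->
  {in E &, forall e f, e * f = if e == f then e else 0} -> (size E <= r)%N.
Proof.
move=> uE E0 EE; pose k := size E.
have Emem (i : 'I_k) : E`_i \in E by rewrite mem_nth.
have two0 : 2 != 0 :> K by rewrite charK.
pose S (J : {ffun 'I_k -> bool}) := \sum_i (if J i then E`_i else 0).
have Se J (i : 'I_k) : S J * E`_i = if J i then E`_i else 0.
  rewrite mulr_suml (bigD1 i) //= big1 ?addr0 => [|j ji]; last first.
    case: ifP; rewrite ?mul0r // EE // => _; rewrite nth_uniq //.
    by rewrite (negPf ji : (j == i :> nat) = false).
  by case: ifP; rewrite ?mul0r // EE // eqxx.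
have SS J : S J * S J = S J.
  rewrite {2}/S mulr_sumr; apply: eq_bigr => i _.
  by case: ifP => Ji; rewrite ?mulr0 // Se Ji.
pose root J := 1 - 2 * S J.
have rootK J : root J * root J = 1.
  transitivity (1 - 4 * S J + 4 * (S J * S J)); first by rewrite /root; ring.
  by rewrite SS subrK.
have root_inj : injective root.
  move=> J1 J2 /(congr1 (fun x => (2^-1 : K) *: (1 - x))); rewrite /root !subKr.
  rewrite -!scaler_nat ![_ *: 1 * _]mulr_algl !scalerA mulVf // !scale1r => SJ.
  apply/ffunP=> i; have := Se J1 i; rewrite SJ Se.
  have Ei0 : E`_i != 0 by apply: contraNneq E0 => <-.
  by case: (J1 i); case: (J2 i) => // /eqP; rewrite ?(negPf Ei0) // eq_sym (negPf Ei0).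
have /fin_all_exists[g gP] J : exists x, tv_pt x /\ root J = rho x.
  have /rho_surj[x xP xE] : root J \is a GRing.unit by apply/unitrPr; exists (root J).
  by exists x.
have gg J : tv_mul (g J) (g J) = tv_one K r s.
  by have [gJ rJ] := gP J; apply: rho_inj; [exact: tv_ptM|rewrite rhoM // -rJ rootK].
have ga J : tv_a (g J) = 0.
  have := congr1 (@tv_a K r s) (gg J); rewrite /tv_mul /tv_one !tv_mkE => a2.
  by apply: (scalerI two0); rewrite scaler0 scaler_nat mulr2n.
have gt J i : tv_t (g J) 0 i ^+ 2 = 1.
  have := congr1 (fun x => tv_t x 0 i) (gg J); rewrite /tv_mul /tv_one !tv_mkE !mxE.
  by rewrite expr2.
have gu J i : tv_u (g J) 0 i = tv_t (g J) 0 i.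
  have [gJ _] := gP J; have t0 : tv_t (g J) 0 i != 0.
    by apply/eqP=> t0; have /eqP := gt J i; rewrite t0 expr0n eq_sym oner_eq0.
  by apply: (mulfI t0); rewrite gJ -expr2 gt.
pose sg J : {ffun 'I_r -> bool} := [ffun i => tv_t (g J) 0 i == 1].
have sg_inj : injective sg.
  move=> J1 J2 sJ; apply: root_inj; have [_ ->] := gP J1; have [_ ->] := gP J2.
  have tE i : tv_t (g J1) 0 i = tv_t (g J2) 0 i.
    have /ffunP/(_ i) := sJ; rewrite !ffunE.
    have := gt J1 i; have := gt J2 i; move=> /eqP + /eqP.
    rewrite !sqrf_eq1; have [->|m1] := eqVneq (-1 : K) 1.
      by rewrite !orbb => /eqP-> /eqP->.
    by move=> /orP[]/eqP-> /orP[]/eqP-> //; rewrite eqxx (negPf m1).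
  rewrite -[g J1]tv_mkK -[g J2]tv_mkK !ga; congr (rho (tv_mk _ _ _)).
    by apply/rowP=> i.
  by apply/rowP=> i; rewrite !gu.
(* The [2 ^ k] square roots of 1 inject into the [2 ^ r] sign vectors. *)
have := leq_card sg sg_inj; rewrite !card_ffun card_bool !card_ord.
by rewrite leq_exp2l.
Qed.

End UnitGroupParametrization.

(** * The algebra of a prehomogeneous module *)

Section OpenOrbit.
Variable K : closedFieldType.

(** Some polynomial vanishes on the complement of [X] but not at [y], and [q] is its restriction to
    the line. Several open conditions along one line then combine into a product of polynomials in
    one variable. *)
Lemma zopen_line (V : vectType K) (X : V -> Prop) (y d : V) : zopen_in X -> X y ->
  exists q : {poly K}, q.[0] != 0 /\ forall c, q.[c] != 0 -> X (y + c *: d).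
Proof.
move=> [S SP] Xy; set b := vbasis {:V} in SP.
have bb : basis_of {:V} b := vbasisP _.
have [p [Sp py]] : exists p, S p /\ p.@[passmx.rVof b y 0] <> 0.
  apply: NNPP => noP; have : ~ X (passmx.vecof b (passmx.rVof b y)).
    by apply/SP => p Sp; apply: NNPP => py; apply: noP; exists p.
  by rewrite passmx.rVofK.
have [q qE] : polyfun (fun c => p.@[passmx.rVof b (y + c *: d) 0]).
  apply: polyfun_meval => i.
  exists ((passmx.rVof b y 0 i)%:P + passmx.rVof b d 0 i *: 'X) => c.
  by rewrite !mxE linearD linearZ !hornerE /= mulrC.
exists q; split; first by rewrite -qE scale0r addr0; apply/eqP.
move=> c; rewrite -qE => pc; apply: NNPP => nX.
have /SP/(_ p Sp)/eqP : ~ X (passmx.vecof b (passmx.rVof b (y + c *: d))).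
  by rewrite passmx.rVofK.
exact/negP.
Qed.

Lemma nonroot_neq0 (q : {poly K}) : q != 0 -> exists2 c, c != 0 & q.[c] != 0.
Proof.
move=> q0; have /closed_nonrootP[c] : q * 'X != 0 by rewrite mulf_neq0 ?polyX_eq0.
by rewrite /root !hornerE mulf_eq0 negb_or => /andP[]; exists c.
Qed.

Lemma horner0_neq0 (q : {poly K}) : q.[0] != 0 -> q != 0.
Proof. by apply: contraNneq => ->; rewrite horner0. Qed.

Variables (G : linAlgGroup K) (M : prehomModule G).
Hypothesis commG : lag_commutative G.
Local Notation V := (phm_space M).
Local Notation act := (phm_act M).

Lemma act_comm x y : lag_pt x -> lag_pt y -> (act x \o act y = act y \o act x)%VF.
Proof. by move=> Gx Gy; rewrite -!phm_actM // commG. Qed.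

Lemma actVK x w : lag_pt x -> act (lag_inv x) (act x w) = w.
Proof.
move=> Gx; rewrite -comp_lfunE -phm_actM ?lag_mulV ?phm_act1 ?id_lfunE //.
exact: lag_ptV.
Qed.

(* [L w] is the operator in the linear span of [G] that sends [v] to [w].  An
   invertible [a = L w] lies in [G] because some [v + k (a^-1 v - v)] and its
   image under [a] both lie in the open orbit. *)
Lemma orbit_operator : exists (v : V) (L : 'Hom(V, 'End(V))),
  [/\ forall w, L w v = w,
      forall w w', (L w \o L w' = L w' \o L w)%VF,
      forall x, lag_pt x -> act x = L (act x v)
    & forall w, lker (L w) == 0%VS -> phm_image (L w)].
Proof.
have [v openO] := phm_open_orbit M; pose O w := exists2 x, lag_pt x & w = act x v.
have Ov : O v by exists (lag_one G); [exact: lag_pt1|rewrite phm_act1 id_lfunE].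
set n := \dim {:V}; pose b := vbasis {:V}.
have /fin_all_exists[x /fin_all_exists[c xcP]] (i : 'I_n) :
    exists x c, [/\ lag_pt x, c != 0 & v + c *: b`_i = act x v].
  have [q [q0 qP]] := zopen_line b`_i openO Ov.
  have [c c0 /qP[x Gx xE]] := nonroot_neq0 (horner0_neq0 q0).
  by exists x, c.
(* Since [act (x i)] moves [v] by [c i] times the basis vector, the operator with index [i] sends
   [v] exactly to that vector. *)
pose L0 w : 'End(V) := \sum_(i < n) coord b i w *: ((c i)^-1 *: (act (x i) - \1%VF)).
have L0_linear : linear L0.
  move=> a w w'; rewrite /L0 scaler_sumr -big_split; apply: eq_bigr => i _ /=.
  by rewrite linearP scalerDl !scalerA.
pose L := linfun (HB.pack_for {linear V -> 'End(V)} L0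
  (GRing.isSemilinear.Build _ _ _ _ L0 (GRing.semilinear_linear L0_linear))).
have LE w : L w = L0 w by rewrite lfunE.
have Lv w : L w v = w.
  rewrite LE [RHS](coord_vbasis (memvf w)) sum_lfunE; apply: eq_bigr => i _.
  have [_ c0 xE] := xcP i; rewrite !scale_lfunE; congr (_ *: _).
  by rewrite add_lfunE opp_lfunE id_lfunE -xE [_ - v]addrC addKr scalerA mulVf // scale1r.
have Lcomm a w : (forall y, lag_pt y -> (a \o act y = act y \o a)%VF) ->
    (a \o L w = L w \o a)%VF.
  move=> aG; rewrite LE /L0; apply/lfunP=> z; rewrite !comp_lfunE !sum_lfunE linear_sum.
  apply: eq_bigr => i _; have [Gx _ _] := xcP i.
  rewrite !scale_lfunE !linearZ /= !add_lfunE !opp_lfunE !id_lfunE linearB /=.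
  have /lfunP/(_ z) := aG _ Gx; rewrite !comp_lfunE => ->.
  by rewrite scalerA mulrC -scalerA.
have LactC w y : lag_pt y -> (L w \o act y = act y \o L w)%VF.
  by move=> Gy; apply/esym/Lcomm => y' Gy'; apply: act_comm.
have LLC w w' : (L w \o L w' = L w' \o L w)%VF.
  by apply: Lcomm => y; apply: LactC.
have actE y : lag_pt y -> act y = L (act y v).
  move=> Gy; apply/lfunP=> w; have comm z : act y (L z v) = L z (act y v).
    by rewrite -!comp_lfunE LactC.
  have LL z z' u : L z (L z' u) = L z' (L z u) by rewrite -!comp_lfunE LLC.
  transitivity (L w (act y v)); first by rewrite -comm Lv.
  by rewrite -{1}[act y v]Lv LL Lv.
exists v, L; split=> // w Lw0; set a := L w in Lw0 *.
have aK := lker0_lfunK Lw0; have aVK := lker0_lfunVK Lw0.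
pose d := (a^-1)%VF v - v.
have [q1 [q10 q1P]] := zopen_line d openO Ov.
have [q2 [q20 q2P]] := zopen_line (a v - v) openO Ov.
(* [a] sends [v + k d] to [v + (1 - k) (a v - v)], whence the substitution of [1 - 'X]; the
   substituted polynomial is nonzero because its value at 1 is [q2.[0]]. *)
have [k _] : exists2 k, k != 0 & (q1 * (q2 \Po (1 - 'X))).[k] != 0.
  apply: nonroot_neq0; rewrite mulf_neq0 ?(horner0_neq0 q10) //.
  apply: contraNneq q20 => /(congr1 (fun p => p.[1])).
  by rewrite horner_comp !hornerE subrr => ->.
rewrite hornerM horner_comp !hornerE mulf_eq0 negb_or => /andP[/q1P[g Gg gE] /q2P[g' Gg' g'E]].
have ag : a (act g v) = act g' v.
  rewrite -gE -g'E linearD linearZ linearB /= aVK scalerBl scale1r -[v - a v]opprB.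
  by rewrite scalerN addrA subrKC.
(* [a] commutes with the group and sends [g v] to [g' v], so [g^-1 g'] agrees with [a] at [v]; both
   operators are values of [L], hence equal. *)
have GG : lag_pt (lag_mul (lag_inv g) g') by apply: lag_ptM => //; apply: lag_ptV.
exists (lag_mul (lag_inv g) g') => //; rewrite actE // /a; congr (L _).
rewrite phm_actM //; last exact: lag_ptV.
by rewrite comp_lfunE -ag -[a _]comp_lfunE LactC // comp_lfunE actVK // /a Lv.
Qed.

End OpenOrbit.

(** For the product [um_op w w'], commuting operators together with the law [um_op1] give
    commutativity and associativity at once, which is the form that an open orbit provides. *)
Record unital_mult (K : fieldType) := UnitalMult {
  um_space : vectType K;
  um_one : um_space;
  um_op : 'Hom(um_space, 'End(um_space));
  um_op1 : forall w, um_op w um_one = w;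
  um_comm : forall w w', (um_op w \o um_op w' = um_op w' \o um_op w)%VF;
  um_one_neq0 : um_one != 0
}.

Definition um_alg (K : fieldType) (D : unital_mult K) : Type := um_space D.

Section UnitalMultAlgebra.
Variables (K : fieldType) (D : unital_mult K).
Local Notation V := (um_space D).
Let mul (x y : um_alg D) : um_alg D := um_op D x y.

HB.instance Definition _ := Vector.on (um_alg D).

Lemma um_swap w w' z : um_op D w (um_op D w' z) = um_op D w' (um_op D w z).
Proof. by rewrite -!comp_lfunE um_comm. Qed.

Lemma um_mulC : commutative mul.
Proof. by move=> x y; rewrite /mul -[y in LHS]um_op1 um_swap um_op1. Qed.

Lemma um_mulA : associative mul.
Proof. by move=> x y z; rewrite [RHS]um_mulC {1}/mul [mul y z]um_mulC /mul um_swap. Qed.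

Lemma um_mul1 : left_id (um_one D : um_alg D) mul.
Proof. by move=> x; rewrite um_mulC /mul um_op1. Qed.

Lemma um_mulDl : left_distributive mul +%R.
Proof. by move=> x y z; rewrite /mul linearD add_lfunE. Qed.

HB.instance Definition _ := GRing.Zmodule_isComNzRing.Build (um_alg D)
  um_mulA um_mulC um_mul1 um_mulDl (um_one_neq0 D).

Lemma um_scaleAl (a : K) (x y : um_alg D) : a *: (x * y) = (a *: x) * y.
Proof. by rewrite /GRing.mul /= /mul linearZ scale_lfunE. Qed.

HB.instance Definition _ := GRing.Lmodule_isLalgebra.Build K (um_alg D) um_scaleAl.
HB.instance Definition _ := GRing.Lalgebra_isComAlgebra.Build K (um_alg D).
HB.instance Definition _ := Algebra_isFalgebra.Build K (um_alg D).
HB.instance Definition _ := ComFalgebra.on (um_alg D).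

(* The vector space structures of [um_alg D] and [um_space D] have the same
   operations but are not convertible as records. *)
Lemma um_basis n (B : n.-tuple V) :
  @basis_of K (um_alg D) fullv B -> basis_of {:V} B.
Proof.
move=> bB; rewrite /basis_of; apply/andP; split; last first.
  by apply/freeP => k kB; have /freeP/(_ k kB) := basis_free bB.
rewrite eqEsubv subvf; apply/subvP=> w _.
rewrite (coord_basis bB (memvf (w : um_alg D))).
by rewrite memv_suml // => i _; rewrite memvZ // memv_span // mem_nth // size_tuple.
Qed.

End UnitalMultAlgebra.

(** * Multiplication tables and equivalence of modules *)

Section ModuleTable.
Variables (K : closedFieldType).

Definition table n := {ffun 'I_n * 'I_n -> option 'I_n}.

(** The table determines the operators [L w], and the image of [G] is the set of invertible ones;
    hence the table determines the subgroup up to equivalence. [None] stands for the product 0. *)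
Definition has_table (G : linAlgGroup K) (M : prehomModule G) n (t : table n) : Prop :=
  exists (v : phm_space M) (L : 'Hom(phm_space M, 'End(phm_space M))) (B : n.-tuple (phm_space M)),
  [/\ forall w, L w v = w,
      forall a, phm_image a <-> exists2 w, lker (L w) == 0%VS & a = L w,
      basis_of {:phm_space M} B
    & forall i j : 'I_n, L B`_i B`_j = oapp (fun k : 'I_n => B`_k) 0 (t (i, j))].

Lemma table_image (G H : linAlgGroup K) (M : prehomModule G) (N : prehomModule H)
    (L : 'Hom(phm_space M, 'End(phm_space M))) (L' : 'Hom(phm_space N, 'End(phm_space N)))
    (f : 'Hom(phm_space M, phm_space N)) (h : 'Hom(phm_space N, phm_space M)) :
  (h \o f)%VF = \1%VF -> (f \o h)%VF = \1%VF ->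
  (forall w z, f (L w z) = L' (f w) (f z)) ->
  (forall a, phm_image a -> exists2 w, lker (L w) == 0%VS & a = L w) ->
  (forall w, lker (L' w) == 0%VS -> phm_image (L' w)) ->
  forall a, phm_image a -> phm_image (f \o a \o h)%VF.
Proof.
move=> hf fh fL im im' a /im[w Lw0 ->].
have fhE z : f (h z) = z by rewrite -comp_lfunE fh id_lfunE.
have hfE z : h (f z) = z by rewrite -comp_lfunE hf id_lfunE.
have -> : (f \o L w \o h)%VF = L' (f w).
  by apply/lfunP=> z; rewrite !comp_lfunE fL fhE.
apply: im'; apply/lker0P=> x y; rewrite -[x]fhE -[y]fhE -!fL => /(can_inj hfE).
by move/(lker0P Lw0)=> ->.
Qed.

Lemma basis_hom (U W : vectType K) n (X : n.-tuple U) (Y : n.-tuple W) :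
  basis_of {:U} X -> exists f : 'Hom(U, W), forall i : 'I_n, f X`_i = Y`_i.
Proof.
move=> bX; have [f fX] := linear_of_free X Y; exists (linfun f) => i.
by rewrite lfunE -(nth_map _ 0) ?size_tuple // fX ?size_tuple // (basis_free bX).
Qed.

Lemma basis_hom_eq (U W : vectType K) n (X : n.-tuple U) (f g : 'Hom(U, W)) :
  basis_of {:U} X -> (forall i : 'I_n, f X`_i = g X`_i) -> f = g.
Proof.
move=> bX fg; apply/lfunP=> w; rewrite (coord_basis bX (memvf w)) !linear_sum.
by apply: eq_bigr => i _; rewrite !linearZ /= fg.
Qed.

Lemma same_table_equiv (G H : linAlgGroup K) (M : prehomModule G) (N : prehomModule H)
    n (t : table n) : has_table M t -> has_table N t -> phm_equiv M N.
Proof.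
move=> [v [L [B [Lv im bB LB]]]] [v' [L' [B' [Lv' im' bB' LB']]]].
have [f fB] := basis_hom B' bB; have [h hB] := basis_hom B bB'.
have hf : (h \o f)%VF = \1%VF.
  by apply: (basis_hom_eq bB) => i; rewrite comp_lfunE fB hB id_lfunE.
have fh : (f \o h)%VF = \1%VF.
  by apply: (basis_hom_eq bB') => i; rewrite comp_lfunE hB fB id_lfunE.
have fL w z : f (L w z) = L' (f w) (f z).
  have sumZ (U W : vectType K) (g : 'Hom(U, W)) (c : 'I_n -> K) (X : 'I_n -> U) :
      g (\sum_i c i *: X i) = \sum_i c i *: g (X i).
    by rewrite linear_sum; apply: eq_bigr => i _; rewrite linearZ.
  have sum2 (U W : vectType K) (g : 'I_n -> 'Hom(U, W)) (c : 'I_n -> K) u :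
      (\sum_i c i *: g i) u = \sum_i c i *: g i u.
    by rewrite sum_lfunE; apply: eq_bigr => i _; rewrite scale_lfunE.
  have fE u : f u = \sum_i coord B i u *: B'`_i.
    by rewrite {1}(coord_basis bB (memvf u)) sumZ; apply: eq_bigr => i _; rewrite fB.
  rewrite [f w]fE [f z]fE (sumZ _ _ L') sum2.
  rewrite {1}(coord_basis bB (memvf w)) (sumZ _ _ L) sum2 (sumZ _ _ f).
  apply: eq_bigr => i _; congr (_ *: _).
  rewrite {1}(coord_basis bB (memvf z)) (sumZ _ _ (L _)) (sumZ _ _ f) (sumZ _ _ (L' _)).
  apply: eq_bigr => j _; congr (_ *: _).
  by rewrite LB LB'; case: (t (i, j)) => [k|] /=; rewrite ?fB // linear0.
have fhE z : f (h z) = z by rewrite -comp_lfunE fh id_lfunE.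
have hfE z : h (f z) = z by rewrite -comp_lfunE hf id_lfunE.
have hL w z : h (L' w z) = L (h w) (h z).
  by rewrite -{1}[w]fhE -{1}[z]fhE -fL hfE.
exists f, h; split=> // a; split.
  apply: (table_image hf fh fL) => [b /im //|w Lw]; by apply/im'; exists w.
move/(table_image fh hf hL (fun b => proj1 (im' b)) (fun w Lw => proj2 (im _) (ex_intro2 _ _ w Lw
  erefl))).
suffices -> : (h \o (f \o a \o h) \o f)%VF = a by [].
by apply/lfunP=> z; rewrite !comp_lfunE !hfE.
Qed.

End ModuleTable.

(** * Regular functions and their composition *)

Section RegularFunctions.
Variables (K : fieldType) (n : nat) (X : 'rV[K]_n -> Prop).

Definition regfun (g : 'rV[K]_n -> K) :=
  exists F : {mpoly K[n]}, forall x, X x -> g x = F.@[x 0].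

Lemma regfun_ext f g : f =1 g -> regfun f -> regfun g.
Proof. by move=> fg [F FE]; exists F => x /FE <-. Qed.

Lemma regfun_cst c : regfun (fun=> c).
Proof. by exists c%:MP => x _; rewrite mevalC. Qed.

Lemma regfunD f g : regfun f -> regfun g -> regfun (fun x => f x + g x).
Proof. by move=> [F FE] [H HE]; exists (F + H) => x Xx; rewrite mevalD FE ?HE. Qed.

Lemma regfunM f g : regfun f -> regfun g -> regfun (fun x => f x * g x).
Proof. by move=> [F FE] [H HE]; exists (F * H) => x Xx; rewrite mevalM FE ?HE. Qed.

Lemma regfun_sum (I : Type) (l : seq I) (P : pred I) (f : I -> 'rV[K]_n -> K) :
  (forall i, regfun (f i)) -> regfun (fun x => \sum_(i <- l | P i) f i x).
Proof. exact: class_sum regfun_ext regfun_cst regfunD _ _ _ _. Qed.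

Lemma regfun_meval m (p : {mpoly K[m]}) (v : 'rV[K]_n -> 'I_m -> K) :
  (forall i, regfun (fun x => v x i)) -> regfun (fun x => p.@[v x]).
Proof. exact: class_meval regfun_ext regfun_cst regfunD regfunM _ _ _. Qed.

Lemma regular_on_coord m (f : 'rV[K]_n -> 'rV[K]_m) j : regular_on X f -> regfun (fun x => f x 0 j).
Proof. by case=> F FE; exists (F j) => x Xx; apply: FE. Qed.

Lemma regular_onI m (f : 'rV[K]_n -> 'rV[K]_m) : (forall j, regfun (fun x => f x 0 j)) ->
  regular_on X f.
Proof. by case/fin_all_exists=> F FE; exists F => x Xx j; apply: FE. Qed.

End RegularFunctions.

Lemma regfun_comp (K : fieldType) m n (X : 'rV[K]_n -> Prop) (Y : 'rV[K]_m -> Prop)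
    (h : 'rV[K]_n -> 'rV[K]_m) (g : 'rV[K]_m -> K) :
  regular_on X h -> (forall x, X x -> Y (h x)) -> regfun Y g -> regfun X (fun x => g (h x)).
Proof.
move=> hX hXY [F FE].
have [H HE] : regfun X (fun x => F.@[h x 0]).
  by apply: regfun_meval => i; apply: regular_on_coord.
by exists H => x Xx; rewrite FE ?HE //; apply: hXY.
Qed.

(** * Finiteness for corank at most 5 *)

Section Finiteness.
Variables (K : closedFieldType) (G : linAlgGroup K) (r s : nat).
Hypothesis charK : forall n, (n%:R == 0 :> K) = (n == 0%N).
Hypotheses (commG : lag_commutative G) (rsG : has_rank_corank G r s).

Lemma act_coord_regular (M : prehomModule G) (v : phm_space M) j :
  regfun (@lag_pt K G) (fun x => coord (vbasis {:phm_space M}) j (phm_act M x v)).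
Proof.
set b := vbasis _; have bb : basis_of _ b := vbasisP _.
apply: (@regfun_ext _ _ _ (fun x => \sum_i coord b i v * passmx.mxof b b (phm_act M x) i j)).
  move=> x; rewrite passmx.coord_rVof (passmx.rVof_app b bb) mxE.
  by apply: eq_bigr => i _; rewrite passmx.coord_rVof.
apply: regfun_sum => i; apply: regfunM; first exact: regfun_cst.
apply: regfun_ext (regular_on_coord (mxvec_index i j) (phm_regular M)) => x.
by rewrite mxvecE.
Qed.

Lemma module_has_table (M : prehomModule G) : (s <= 5)%N ->
  exists n (t : table n), (n <= r + s)%N /\ has_table M t.
Proof.
move=> s5; have [v [L [Lv LC actL imL]]] := orbit_operator M commG.
have im a : phm_image a <-> exists2 w, lker (L w) == 0%VS & a = L w.
  split=> [[x Gx ->]|[w Lw ->]]; last exact: imL.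
  exists (phm_act M x v); rewrite -?actL //; apply/lker0P=> y z eq_xyz.
  by rewrite -(actVK y Gx) eq_xyz actVK.
(* The zero module carries no algebra with [1 != 0]; it gets the empty table. *)
have [v0|v0] := eqVneq v 0.
  exists 0%N, [ffun=> None]; split=> //; exists v, L, [tuple]; split=> // [|[]//].
  rewrite (_ : {:_}%VS = 0%VS) ?nil_basis //; apply/eqP; rewrite -subv0; apply/subvP=> w _.
  by rewrite -[w]Lv v0 linear0 memv0.
pose D := UnitalMult Lv LC v0; pose A : comFalgType K := um_alg D.
have [f [h [[_ hreg] fP hP fM]]] := rsG.
have hpt x : tv_pt x -> lag_pt (h x) by move=> /hP[].
have hM x y : tv_pt x -> tv_pt y -> h (tv_mul x y) = lag_mul (h x) (h y).
  move=> xP yP; have [hx fx] := hP x xP; have [hy fy] := hP y yP.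
  by have [_ <-] := fP _ (lag_ptM hx hy); rewrite fM // fx fy.
have e1 : tv_pt (tv_one K r s) := @tv_pt1 K r s.
have h1 : h (tv_one K r s) = lag_one G.
  have he := hpt _ e1; set e := h _ in he *.
  have ee : lag_mul e e = e by rewrite -hM // (tv_mul1 e1).
  by rewrite -(lag_mul1 he) -(lag_mulV he) -lag_mulA ?ee ?lag_mulV //; apply: lag_ptV.
pose rho (x : 'rV[K]_(r + r + s)) : A := phm_act M (h x) v.
have [F FE] := fin_all_exists (fun j => regfun_comp hreg hpt (act_coord_regular v j)).
have rhoE x : tv_pt x -> rho x = \sum_i (F i).@[x 0] *: (vbasis {:phm_space M})`_(i : 'I__) :> A.
  move=> xP; rewrite [LHS](coord_vbasis (memvf (phm_act M (h x) v))).
  by apply: eq_bigr => i _; rewrite -FE.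
have rho1 : rho (tv_one K r s) = 1 by rewrite /rho h1 phm_act1 id_lfunE.
have rhoM x y : tv_pt x -> tv_pt y -> rho (tv_mul x y) = rho x * rho y.
  move=> xP yP; rewrite /rho hM // phm_actM; try exact: hpt.
  transitivity (phm_act M (h x) (phm_act M (h y) v)); first exact: comp_lfunE.
  by rewrite {1}(actL _ (hpt _ xP)).
(* The orbit map at [v], the unit of [A], is injective: an element fixing [v] acts as [L v], which
   is the identity, and the action is effective. *)
have rho_inj x : tv_pt x -> rho x = 1 -> x = tv_one K r s.
  move=> xP x1; have [hx fx] := hP x xP; rewrite -fx.
  have -> : h x = lag_one G.
    apply: (phm_effective (p := M)) => //; rewrite actL // (_ : phm_act M (h x) v = v) //.
    apply/lfunP=> w; rewrite id_lfunE -{2}[w]Lv -{1}[w]Lv -[L v (L w v)]comp_lfunE LC.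
    by rewrite comp_lfunE Lv.
  by rewrite -h1; have [] := hP _ e1.
have rho_surj (w : A) : w \is a GRing.unit -> exists2 x, tv_pt x & w = rho x.
  move=> /lker0_amull wU; have : lker (L w) == 0%VS.
    apply/lker0P=> y z; have /lker0P inj := wU; have := inj (y : A) (z : A).
    by rewrite !lfunE /=.
  move/imL=> [g Gg LwE]; have [fg hfg] := fP _ Gg; exists (f g) => //.
  by rewrite /rho hfg -LwE Lv.
have small_nil (U : {vspace A}) : {in U, forall x, nilpotent x} -> (\dim U <= s)%N.
  exact: (dim_nilpotent charK rhoE rho1 rhoM rho_surj).
have [E [C [bEC mEC EE CN]]] : exists E C, @split_basis _ A {:A} E C.
  apply: split_basis_full; rewrite ?charK // => U /small_nil dU.
  exact: leq_trans dU s5.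
have fEC := basis_free bEC.
have Er : (size E <= r)%N.
  apply: (size_idempotents charK rhoM rho_inj rho_surj _ _ EE).
    exact/free_uniq/(catl_free fEC).
  by apply/negP=> E0; have := free_not0 fEC (v := 0); rewrite mem_cat E0 eqxx => /(_ isT).
have Cs : (size C <= s)%N.
  by rewrite -(eqP (catr_free fEC)); apply/small_nil/nilpotent_span.
pose B := in_tuple (E ++ C); pose n := size (E ++ C).
pose t : table n := [ffun ij => [pick k : 'I_n | (B`_(ij.1 : 'I_n) : A) * B`_(ij.2 : 'I_n) ==
  B`_k]].
exists n, t; split; first by rewrite /n size_cat leq_add.
exists v, L, B; split=> //; first exact: (@um_basis K D n B).
move=> i j; rewrite /t ffunE /=.
case: pickP => [k /eqP //|noK] /=.
have : (B`_i : A) * B`_j \in 0 :: E ++ C by apply: mEC; apply: mem_nth; apply: ltn_ord.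
rewrite inE => /predU1P[//|ijEC]; pose k := index ((B`_i : A) * B`_j) (E ++ C).
have lt_k : (k < n)%N by rewrite index_mem.
by have := noK (Ordinal lt_k); rewrite /= nth_index // eqxx.
Qed.

Lemma finitely_many_small : (s <= 5)%N -> finitely_many_prehomModules G.
Proof.
move=> s5; have [[M0]|noM] := classic (inhabited (prehomModule G)); last first.
  have L : 'I_0 -> prehomModule G by case.
  by exists 0%N, L => M; case: noM.
pose T : finType := {n : 'I_(r + s).+1 & table n}.
(* One representative for each table of size at most [r + s]; a table that no module realises gets
   an arbitrary module, available because of [M0]. *)
exists #|T|, (fun i => let l := enum_val i in
  epsilon (inhabits M0) (fun M => has_table M (tagged l))) => M.
have [n [t [le_n Mt]]] := module_has_table M s5.
pose l : T := Tagged (fun n : 'I_(r + s).+1 => table n) (i := Ordinal (le_n : n < (r + s).+1)%N) t.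
exists (enum_rank l); apply: (same_table_equiv (t := t)) => //.
rewrite enum_rankK /=; apply: (epsilon_spec (inhabits M0) (fun M => has_table M t)).
by exists M.
Qed.

End Finiteness.

(** * Pencils of quadrics *)

Section PencilAlgebra.
Variables (K : fieldType) (r n : nat) (d : 'I_n -> K).
Local Notation V := 'rV[K]_(r.+1 + (n + 2)).
Implicit Types (x y : 'rV[K]_n) (w : V).

(* The pair [sum x_i y_i], [sum d_i x_i y_i]; recall [0 ^+ 0 = 1]. *)
Definition pencil x y : 'rV[K]_2 := \row_j \sum_i d i ^+ j * (x 0 i * y 0 i).

Definition pa_c w : 'rV[K]_r.+1 := lsubmx w.
Definition pa_x w : 'rV[K]_n := lsubmx (rsubmx w).
Definition pa_z w : 'rV[K]_2 := rsubmx (rsubmx w).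
Definition pa_mk (c : 'rV[K]_r.+1) x (z : 'rV[K]_2) : V := row_mx c (row_mx x z).

Lemma pa_mkE c x z : (pa_c (pa_mk c x z) = c) * (pa_x (pa_mk c x z) = x) *
  (pa_z (pa_mk c x z) = z).
Proof. by rewrite /pa_c /pa_x /pa_z !(row_mxKl, row_mxKr). Qed.

Lemma pa_mkK w : pa_mk (pa_c w) (pa_x w) (pa_z w) = w.
Proof. by rewrite /pa_mk !hsubmxK. Qed.

Lemma pa_cD a w w' : pa_c (a *: w + w') = a *: pa_c w + pa_c w'.
Proof. by rewrite /pa_c linearP. Qed.
Lemma pa_xD a w w' : pa_x (a *: w + w') = a *: pa_x w + pa_x w'.
Proof. by rewrite /pa_x !linearP. Qed.
Lemma pa_zD a w w' : pa_z (a *: w + w') = a *: pa_z w + pa_z w'.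
Proof. by rewrite /pa_z !linearP. Qed.

Lemma pa_mkD a c x z c' x' z' :
  a *: pa_mk c x z + pa_mk c' x' z' = pa_mk (a *: c + c') (a *: x + x') (a *: z + z').
Proof. by rewrite /pa_mk !scale_row_mx !add_row_mx. Qed.

Lemma pencilC x y : pencil x y = pencil y x.
Proof. by apply/rowP=> j; rewrite !mxE; apply: eq_bigr => i _; rewrite [x 0 i * _]mulrC. Qed.

Lemma pencilDr a x y y' : pencil x (a *: y + y') = a *: pencil x y + pencil x y'.
Proof.
apply/rowP=> j; rewrite !mxE mulr_sumr -big_split; apply: eq_bigr => i _ /=.
by rewrite !mxE; ring.
Qed.

Lemma pencilZr a x y : pencil x (a *: y) = a *: pencil x y.
Proof.
apply/rowP=> j; rewrite !mxE mulr_sumr; apply: eq_bigr => i _ /=.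
by rewrite !mxE; ring.
Qed.

Lemma pencilZl a x y : pencil (a *: x) y = a *: pencil x y.
Proof. by rewrite pencilC pencilZr pencilC. Qed.

Lemma pencilr0 x : pencil x 0 = 0.
Proof. by rewrite -(scale0r 0) pencilZr scale0r. Qed.

Lemma pencil0r x : pencil 0 x = 0.
Proof. by rewrite pencilC pencilr0. Qed.

(* Product of [K^r] and the local algebra [K + K^n + K^2], whose residue is the
   coordinate [pa_c w 0 0]. *)
Definition pa_mul w w' : V := pa_mk (\row_i (pa_c w 0 i * pa_c w' 0 i))
  (pa_c w 0 0 *: pa_x w' + pa_c w' 0 0 *: pa_x w)
  (pa_c w 0 0 *: pa_z w' + pa_c w' 0 0 *: pa_z w + pencil (pa_x w) (pa_x w')).

Definition pa_one : V := pa_mk (const_mx 1) 0 0.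

Lemma pa_mul_linear w : linear (pa_mul w).
Proof.
move=> a w1 w2; rewrite /pa_mul pa_cD pa_xD pa_zD pencilDr pa_mkD; congr pa_mk.
- by apply/rowP=> i; rewrite !mxE; ring.
- by apply/rowP=> i; rewrite !mxE; ring.
by apply/rowP=> i; rewrite !mxE; ring.
Qed.

HB.instance Definition _ w := GRing.isSemilinear.Build K V V _ (pa_mul w)
  (GRing.semilinear_linear (pa_mul_linear w)).

Definition pa_op w : 'End(V) := linfun (pa_mul w).

Lemma pa_opE w w' : pa_op w w' = pa_mul w w'. Proof. by rewrite lfunE. Qed.

Lemma pa_mulC w w' : pa_mul w w' = pa_mul w' w.
Proof.
rewrite /pa_mul pencilC; congr pa_mk; last by rewrite [_ *: _ + _ *: _]addrC.
  by apply/rowP=> i; rewrite !mxE mulrC.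
by rewrite addrC.
Qed.

Lemma pa_mul1 w : pa_mul w pa_one = w.
Proof.
rewrite -[RHS]pa_mkK /pa_mul /pa_one !pa_mkE pencilr0 !scaler0 mxE !scale1r !add0r addr0.
by congr pa_mk; apply/rowP=> i; rewrite !mxE mulr1.
Qed.

Lemma pa_mulA w1 w2 w3 : pa_mul w1 (pa_mul w2 w3) = pa_mul (pa_mul w1 w2) w3.
Proof.
rewrite /pa_mul !pa_mkE; congr pa_mk.
- by apply/rowP=> i; rewrite !mxE mulrA.
- by apply/rowP=> i; rewrite !mxE; ring.
rewrite pencilDr [pencil (_ + _) _]pencilC pencilDr !pencilZr.
rewrite [pencil (pa_x w3) _]pencilC [pencil (pa_x w3) _]pencilC.
by apply/rowP=> j; rewrite !mxE; ring.
Qed.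

Lemma pa_opM w w' : pa_op (pa_mul w w') = (pa_op w \o pa_op w')%VF.
Proof. by apply/lfunP=> z; rewrite comp_lfunE !pa_opE pa_mulA. Qed.

Lemma pa_op1 : pa_op pa_one = \1%VF.
Proof. by apply/lfunP=> z; rewrite pa_opE id_lfunE pa_mulC pa_mul1. Qed.

Lemma pa_op_inj w w' : pa_op w = pa_op w' -> w = w'.
Proof. by move/lfunP/(_ pa_one); rewrite !pa_opE !pa_mul1. Qed.

Lemma pa_op_linear : linear pa_op.
Proof.
move=> a w w'; apply/lfunP=> z; rewrite add_lfunE scale_lfunE !pa_opE.
by rewrite ![pa_mul _ z]pa_mulC linearP.
Qed.

HB.instance Definition _ := GRing.isSemilinear.Build K V 'End(V) _ pa_op
  (GRing.semilinear_linear pa_op_linear).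

End PencilAlgebra.

(** * The prehomogeneous module of a pencil of quadrics *)

Section PencilModule.
Variables (K : closedFieldType) (G : linAlgGroup K) (r n : nat).
Hypothesis two_neq0 : 2 != 0 :> K.
Local Notation V := 'rV[K]_(r.+1 + (n + 2)).
Variables (f : 'rV[K]_(lag_dim G) -> 'rV[K]_(r.+1 + r.+1 + (n + 2)))
          (h : 'rV[K]_(r.+1 + r.+1 + (n + 2)) -> 'rV[K]_(lag_dim G)).
Hypotheses (f_regular : regular_on (@lag_pt K G) f)
  (fP : forall x, lag_pt x -> tv_pt (f x) /\ h (f x) = x)
  (hP : forall y, tv_pt y -> lag_pt (h y) /\ f (h y) = y)
  (fM : forall x y, lag_pt x -> lag_pt y -> f (lag_mul x y) = tv_mul (f x) (f y)).
Variable d : 'I_n -> K.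

(* [t_0 exp(a)] in the local factor and [t_i] in the others; the exponential has
   no cubic term. *)
Definition pencil_pt (p : 'rV[K]_(r.+1 + r.+1 + (n + 2))) : V :=
  let b := lsubmx (tv_a p) in let z := rsubmx (tv_a p) in
  pa_mk (tv_t p) (tv_t p 0 0 *: b) (tv_t p 0 0 *: (z + 2^-1 *: pencil d b b)).

Definition pencil_act x := pa_op d (pencil_pt (f x)).

Lemma pencil_pt1 : pencil_pt (tv_one K r.+1 (n + 2)) = pa_one K r n.
Proof.
rewrite /pencil_pt /tv_one !tv_mkE !linear0 pencilr0 scaler0 addr0 !scaler0.
by [].
Qed.

Lemma pencil_ptM p q : pencil_pt (tv_mul p q) = pa_mul d (pencil_pt p) (pencil_pt q).
Proof.
rewrite /pencil_pt /tv_mul !tv_mkE /pa_mul !pa_mkE; congr pa_mk; rewrite !linearD.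
  by apply/rowP=> i; rewrite !mxE; ring.
set b := lsubmx (tv_a p); set b' := lsubmx (tv_a q).
have -> : pencil d (b + b') (b + b') = pencil d b b + pencil d b' b' + 2 *: pencil d b b'.
  have := pencilDr d 1 (b + b') b b'; rewrite !scale1r => ->.
  rewrite ![pencil d (b + b') _]pencilC.
  have := pencilDr d 1 b b b'; rewrite !scale1r => ->.
  have := pencilDr d 1 b' b b'; rewrite !scale1r => ->.
  by rewrite (pencilC d b' b) scaler_nat mulr2n; apply/rowP=> j; rewrite !mxE; ring.
rewrite pencilZr pencilZl; apply/rowP=> j; rewrite !mxE; field.
by rewrite two_neq0.
Qed.

Lemma f_one : f (lag_one G) = tv_one K r.+1 (n + 2).
Proof.
have e1 := lag_pt1 G; have [fe _] := fP e1; set e := f _ in fe *.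
have ee : tv_mul e e = e by rewrite -fM // lag_mul1.
by rewrite -(tv_mul1 fe) -(tv_mulV fe) -(tv_mulA (tv_ptV fe) fe fe) ee tv_mulV.
Qed.

Lemma pencil_act1 : pencil_act (lag_one G) = \1%VF.
Proof. by rewrite /pencil_act f_one pencil_pt1 pa_op1. Qed.

Lemma pencil_actM x y : lag_pt x -> lag_pt y ->
  pencil_act (lag_mul x y) = (pencil_act x \o pencil_act y)%VF.
Proof. by move=> Gx Gy; rewrite /pencil_act fM // pencil_ptM pa_opM. Qed.

Local Notation reg := (regfun (@lag_pt K G)).

Lemma reg_f j : reg (fun x => f x 0 j).
Proof. exact: regular_on_coord. Qed.

Lemma reg_t i : reg (fun x => tv_t (f x) 0 i).
Proof. by apply: regfun_ext (reg_f (lshift _ (lshift _ i))) => x; rewrite !mxE. Qed.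

Lemma reg_b i : reg (fun x => lsubmx (tv_a (f x)) 0 i).
Proof. by apply: regfun_ext (reg_f (rshift _ (lshift _ i))) => x; rewrite !mxE. Qed.

Lemma reg_z i : reg (fun x => rsubmx (tv_a (f x)) 0 i).
Proof. by apply: regfun_ext (reg_f (rshift _ (rshift _ i))) => x; rewrite !mxE. Qed.

Lemma reg_pencil (g g' : 'rV[K]_(lag_dim G) -> 'rV[K]_n) j :
  (forall i, reg (fun x => g x 0 i)) -> (forall i, reg (fun x => g' x 0 i)) ->
  reg (fun x => pencil d (g x) (g' x) 0 j).
Proof.
move=> gR g'R; apply: (@regfun_ext _ _ _ (fun x => \sum_i d i ^+ j * (g x 0 i * g' x 0 i))).
  by move=> x; rewrite mxE.
apply: regfun_sum => i; apply: regfunM; first exact: regfun_cst.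
exact: regfunM.
Qed.

Lemma reg_pencil_pt j : reg (fun x => pencil_pt (f x) 0 j).
Proof.
rewrite /pencil_pt /pa_mk; case: (split_ordP j) => k ->.
  by apply: regfun_ext (reg_t k) => x; rewrite row_mxEl.
case: (split_ordP k) => i ->.
  by apply: regfun_ext (regfunM (reg_t 0) (reg_b i)) => x; rewrite row_mxEr row_mxEl [RHS]mxE.
have zR : reg (fun x => tv_t (f x) 0 0 * (rsubmx (tv_a (f x)) 0 i
    + 2^-1 * pencil d (lsubmx (tv_a (f x))) (lsubmx (tv_a (f x))) 0 i)).
  apply: regfunM; first exact: reg_t.
  apply: regfunD; first exact: reg_z.
  by apply: regfunM; [exact: regfun_cst|apply: reg_pencil; apply: reg_b].
apply: regfun_ext zR => x; rewrite row_mxEr row_mxEr [RHS]mxE; congr (_ * _).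
by rewrite [RHS]mxE; congr (_ + _); rewrite [RHS]mxE.
Qed.

Lemma reg_linear m N (phi : {linear 'rV[K]_m -> 'rV[K]_N})
    (g : 'rV[K]_(lag_dim G) -> 'rV[K]_m) j :
  (forall i, reg (fun x => g x 0 i)) -> reg (fun x => phi (g x) 0 j).
Proof.
move=> gR; apply: (@regfun_ext _ _ _ (fun x => \sum_i g x 0 i * phi (delta_mx 0 i) 0 j)).
  move=> x; rewrite [in RHS](row_sum_delta (g x)) linear_sum summxE.
  by apply: eq_bigr => i _; rewrite linearZ mxE.
by apply: regfun_sum => i; apply: regfunM => //; apply: regfun_cst.
Qed.

Lemma pencil_act_regular : regular_on (@lag_pt K G) (fun x =>
  mxvec (passmx.mxof (vbasis {:V}) (vbasis {:V}) (pencil_act x))).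
Proof.
apply: regular_onI => j.
pose phi w := mxvec (passmx.mxof (vbasis {:V}) (vbasis {:V}) (pa_op d w)).
have phi_linear : linear phi by move=> a u v; rewrite /phi pa_op_linear passmx.mxof_linear linearP.
exact: (@reg_linear _ _ (HB.pack_for {linear V -> _} phi
  (GRing.isSemilinear.Build _ _ _ _ phi (GRing.semilinear_linear phi_linear)))
  _ j reg_pencil_pt).
Qed.

Lemma pencil_effective x : lag_pt x -> pencil_act x = \1%VF -> x = lag_one G.
Proof.
move=> Gx /lfunP/(_ (pa_one K r n)); rewrite id_lfunE pa_opE pa_mul1 => xE.
have [xP hx] := fP Gx; have [_ h1] := fP (lag_pt1 G).
suffices -> : x = h (tv_one K r.+1 (n + 2)) by rewrite -h1 f_one.
rewrite -[LHS]hx; congr h; rewrite -[LHS]tv_mkK; move: xP xE; set p := f x => xP xE.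
have tE : tv_t p = const_mx 1 by have := congr1 (@pa_c K r n) xE;
  rewrite /pencil_pt /pa_one !pa_mkE.
have uE : tv_u p = const_mx 1.
  by apply/rowP=> i; have := xP i; rewrite tE !mxE mul1r.
have bE : lsubmx (tv_a p) = 0.
  by have := congr1 (@pa_x K r n) xE; rewrite /pencil_pt /pa_one !pa_mkE tE mxE scale1r.
have zE : rsubmx (tv_a p) = 0.
  have := congr1 (@pa_z K r n) xE; rewrite /pencil_pt /pa_one !pa_mkE tE mxE scale1r bE.
  by rewrite pencilr0 scaler0 addr0.
by rewrite tE uE -[tv_a p]hsubmxK bE zE row_mx0.
Qed.

Lemma pencil_orbit w : (exists2 x, lag_pt x & w = pencil_act x (pa_one K r n)) <->
  forall i, pa_c w 0 i != 0.
Proof.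
split=> [[x Gx ->] i|c0].
  rewrite pa_opE pa_mul1 /pencil_pt pa_mkE; apply/eqP=> ti0.
  by have [/(_ i)] := fP Gx; rewrite ti0 mul0r => /esym/eqP; rewrite oner_eq0.
(* The preimage is a logarithm: the local component is divided by its residue, and [z] loses the
   quadratic term of the exponential. *)
pose b := (pa_c w 0 0)^-1 *: pa_x w.
pose z := (pa_c w 0 0)^-1 *: pa_z w - 2^-1 *: pencil d b b.
pose p := tv_mk (pa_c w) (\row_i (pa_c w 0 i)^-1) (row_mx b z).
have pP : tv_pt p by move=> i; rewrite !tv_mkE [X in _ * X]mxE mulfV.
have [hp fp] := hP pP; exists (h p) => //.
rewrite pa_opE pa_mul1 fp /pencil_pt !tv_mkE row_mxKl row_mxKr /z subrK.
by rewrite /b !scalerA !mulfV ?scale1r ?pa_mkK.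
Qed.

Lemma pencil_open_orbit : exists v : V,
  zopen_in (fun w => exists2 x, lag_pt x & w = pencil_act x v).
Proof.
exists (pa_one K r n); pose b := vbasis {:V}.
pose P : {mpoly K[\dim {:V}]} := \prod_(i < r.+1) \sum_(j < \dim {:V}) (pa_c b`_j 0 i) *: 'X_j.
exists (fun p => p = P) => x.
have PE : P.@[x 0] = \prod_i pa_c (passmx.vecof b x) 0 i.
  rewrite /P rmorph_prod; apply: eq_bigr => i _.
  rewrite rmorph_sum /passmx.vecof /pa_c linear_sum summxE; apply: eq_bigr => j _ /=.
  by rewrite mevalZ mevalXU linearZ [RHS]mxE mulrC.
split=> [nO p ->|/(_ P erefl) P0 /pencil_orbit c0].
  rewrite PE; apply/eqP; apply: contra_notT nO => /prodf_neq0 c0.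
  by apply/pencil_orbit => i; apply: c0.
by have /eqP := P0; rewrite PE; apply/negP/prodf_neq0 => i _; apply: c0.
Qed.

Definition pencil_module : prehomModule G :=
  PrehomModule pencil_act1 pencil_actM pencil_act_regular pencil_effective pencil_open_orbit.

Lemma pencil_image (a : 'End(V)) : @phm_image K G pencil_module a <->
  exists2 w, forall i, pa_c w 0 i != 0 & a = pa_op d w.
Proof.
split=> [[x Gx ->]|[w c0 ->]].
  exists (pencil_pt (f x)) => //; apply/pencil_orbit; exists x => //.
  by rewrite pa_opE pa_mul1.
have /pencil_orbit[x Gx wE] := c0; exists x => //.
by rewrite wE pa_opE pa_mul1.
Qed.

End PencilModule.

Lemma det_mx22 (R : comNzRingType) (C : 'M[R]_2) :
  \det C = C 0 0 * C 1 1 - C 0 1 * C 1 0.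
Proof.
rewrite (expand_det_row _ 0) big_ord_recl big_ord1 /cofactor !det_mx11 !mxE /=.
rewrite expr0 expr1 mul1r mulN1r mulrN.
by congr (C _ _ * C _ _ - C _ _ * C _ _); apply: val_inj.
Qed.

(** Evaluated on the standard basis, the hypothesis says that [P P^T] and [P diag(d') P^T] are the
    diagonal matrices with entries [al i = C 0 0 + d i C 1 0] and [be i = C 0 1 + d i C 1 1]. As [P]
    is invertible, each [al i] is nonzero and each quotient [be i / al i] is an eigenvalue of
    [diag(d')]. *)
Lemma moebius (K : fieldType) n (d d' : 'I_n -> K) (P : 'M[K]_n) (C : 'M[K]_2) :
  (forall x y, pencil d' (x *m P) (y *m P) = pencil d x y *m C) ->
  (forall z : 'rV_2, z *m C = 0 -> z = 0) ->
  C 0 0 * C 1 1 - C 0 1 * C 1 0 != 0 /\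
  forall i, C 0 0 + d i * C 1 0 != 0 /\
    exists k, C 0 1 + d i * C 1 1 = (C 0 0 + d i * C 1 0) * d' k.
Proof.
move=> PC C0.
have detC : C 0 0 * C 1 1 - C 0 1 * C 1 0 != 0.
  apply/negP=> D0; have /det0P[v v0 vC] : \det C == 0 by rewrite det_mx22.
  by rewrite (C0 v vC) eqxx in v0.
split=> // i.
pose al i := C 0 0 + d i * C 1 0; pose be i := C 0 1 + d i * C 1 1.
have row_pencil (x : 'rV[K]_2) : (x *m C = \row_j (x 0 0 * C 0 j + x 0 1 * C 1 j)).
  apply/rowP=> j; rewrite !mxE big_ord_recl big_ord1; congr (_ + x 0 _ * C _ j); exact: val_inj.
have basisE a b : pencil d (delta_mx 0 a) (delta_mx 0 b) = (a == b)%:R *: \row_j (d a ^+ j).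
  apply/rowP=> j; rewrite !mxE (bigD1 a) //= big1 ?addr0 => [|c ca]; rewrite !mxE eqxx /=.
    by rewrite eqxx mul1r mulrC.
  by rewrite (negPf ca) mul0r mulr0.
have PP j a b : \sum_k d' k ^+ (j : 'I_2) * (P a k * P b k) = (a == b)%:R * (C 0 j + d a * C 1 j).
  have := PC (delta_mx 0 a) (delta_mx 0 b); rewrite -!rowE basisE row_pencil => /rowP/(_ j).
  rewrite !mxE; under eq_bigr do rewrite !mxE; move=> ->.
  by rewrite expr0 expr1; ring.
have Pinj (x : 'rV[K]_n) : (forall a, \sum_k x 0 k * P a k = 0) -> x = 0.
  move=> xP; have Pu : P \in unitmx.
    rewrite -row_free_unit -kermx_eq0; apply/rowV0P => v /sub_kermxP vP.
    have v0 b : pencil d v (delta_mx 0 b) = 0.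
      by apply: C0; rewrite -PC vP pencil0r.
    apply/rowP=> b; have /rowP/(_ 0) := v0 b; rewrite !mxE (bigD1 b) //= big1 ?addr0.
      by rewrite mxE !eqxx mulr1 expr0 mul1r.
    by move=> c cb; rewrite mxE (negPf cb) andbF !mulr0.
  apply: (can_inj (mulmxK (_ : P^T \in unitmx))); first by rewrite unitmx_tr.
  rewrite mul0mx; apply/rowP=> a; rewrite !mxE -[RHS](xP a).
  by apply: eq_bigr => k _; rewrite mxE.
have ei : pencil d (delta_mx 0 i) (delta_mx 0 i) != 0.
  rewrite basisE eqxx scale1r; apply/eqP=> /rowP/(_ 0); rewrite !mxE expr0.
  by move/eqP; rewrite oner_eq0.
have [k Pik] : exists k, P i k != 0.
  apply/existsP; apply: contraNT ei; rewrite negb_exists => /forallP Pi0.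
  have ri : (delta_mx 0 i : 'rV[K]_n) *m P = 0.
    by rewrite -rowE; apply/rowP=> k; rewrite !mxE; apply/eqP; rewrite -[_ == _]negbK.
  by apply/eqP/C0; rewrite -PC ri pencilr0.
have al0 : al i != 0.
  apply/eqP=> ali; case/eqP: Pik; have Pi0 := Pinj (row i P) _.
  have /rowP/(_ k) : row i P = 0; last by rewrite !mxE.
  apply: Pi0 => a; have := PP 0 i a; have [<-|_] := eqVneq i a.
    by rewrite mul1r -/(al i) ali => PPa; rewrite -[RHS]PPa; apply: eq_bigr => c _;
      rewrite mxE expr0 mul1r.
  by rewrite mul0r => PPa; rewrite -[RHS]PPa; apply: eq_bigr => c _; rewrite mxE expr0 mul1r.
(* row [i] of [P] is an eigenvector of [diag d'] with eigenvalue [be i / al i] *)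
split=> //; exists k; apply: (mulIf Pik).
have w0 : \row_c (be i * P i c - al i * (d' c * P i c)) = 0.
  apply: Pinj => a.
  transitivity (be i * (\sum_c d' c ^+ (0%R : 'I_2) * (P i c * P a c))
     - al i * (\sum_c d' c ^+ (1%R : 'I_2) * (P i c * P a c))).
    rewrite !mulr_sumr -sumrB; apply: eq_bigr => c _; rewrite mxE expr0 expr1; ring.
  by rewrite !PP -/(al i) -/(be i); ring.
have /rowP/(_ k) := w0; rewrite !mxE => /eqP; rewrite subr_eq0 => /eqP ->.
by rewrite mulrA.
Qed.

(** * From an equivalence of pencil modules to a homography *)

Section PencilEquivalence.
Variables (K : fieldType) (r m : nat).
Local Notation n := m.+4.
Variables d d' : 'I_n -> K.
Local Notation V := 'rV[K]_(r.+1 + (n + 2)).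
Hypotheses (d0 : d 0 = 0) (d1 : d 1 = 1).
Variables F H : 'End(V).
Hypotheses (HF : (H \o F = \1)%VF) (FH : (F \o H = \1)%VF).
Hypothesis conj_units : forall w : V, (forall i, pa_c w 0 i != 0) ->
  exists2 w' : V, forall i, pa_c w' 0 i != 0 & (F \o pa_op d w \o H)%VF = pa_op d' w'.

Local Notation nil x z := (pa_mk (0 : 'rV[K]_r.+1) x z).
Local Notation one := (pa_one K r n).

Lemma pa_mul_nil (e : 'I_n -> K) x z x' z' :
  pa_mul e (nil x z) (nil x' z') = nil 0 (pencil e x x').
Proof.
rewrite /pa_mul !pa_mkE mxE !scale0r !add0r; congr pa_mk.
by apply/rowP=> i; rewrite !mxE mul0r.
Qed.

(** [F] need not preserve the unit, so it need not be multiplicative. The conjugate of [pa_op d w]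
    is, for [w] in the maximal ideal, multiplication by an element, which is recovered by evaluating
    it at the unit. *)
Definition transport w : V := F (pa_op d w (H one)).

Lemma transport_linear : linear transport.
Proof.
by move=> a w w'; rewrite /transport linearP add_lfunE scale_lfunE linearP.
Qed.

HB.instance Definition _ := GRing.isSemilinear.Build K V V _ transport
  (GRing.semilinear_linear transport_linear).

Lemma conj_opM w w' : (F \o pa_op d (pa_mul d w w') \o H =
  (F \o pa_op d w \o H) \o (F \o pa_op d w' \o H))%VF.
Proof.
apply/lfunP=> v; rewrite pa_opM !comp_lfunE; congr (F (pa_op d w _)).
by rewrite -[RHS]comp_lfunE HF id_lfunE.
Qed.

(** [conj_units] speaks of units only, so the nilpotent element is written as the difference of a
    unit and 1. *)
Lemma transport_op x z : (F \o pa_op d (nil x z) \o H)%VF = pa_op d' (transport (nil x z)).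
Proof.
have [|w' _ wE] := conj_units (w := 1 *: nil x z + one).
  by move=> i; rewrite pa_cD !pa_mkE scaler0 add0r mxE oner_eq0.
have nE : (F \o pa_op d (nil x z) \o H)%VF = pa_op d' (w' - one).
  rewrite [RHS]linearB /= pa_op1 -wE; apply/lfunP=> v; rewrite add_lfunE opp_lfunE !comp_lfunE.
  rewrite pa_op_linear pa_op1 scale1r add_lfunE linearD !id_lfunE /=.
  by rewrite -[F (H v)]comp_lfunE FH id_lfunE addrK.
rewrite nE; congr pa_op; rewrite /transport.
have -> : F (pa_op d (nil x z) (H one)) = (F \o pa_op d (nil x z) \o H)%VF one.
  by rewrite !comp_lfunE.
by rewrite nE pa_opE pa_mul1.
Qed.

Lemma transportM x z x' z' : transport (nil 0 (pencil d x x')) =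
  pa_mul d' (transport (nil x z)) (transport (nil x' z')).
Proof.
apply: (@pa_op_inj _ _ _ d'); rewrite pa_opM -!transport_op -conj_opM.
by rewrite pa_mul_nil.
Qed.

Lemma transport_inj x z : transport (nil x z) = 0 -> x = 0 /\ z = 0.
Proof.
move=> t0; have := transport_op x z; rewrite t0 linear0 => /lfunP E.
have w0 : nil x z = 0.
  rewrite -[LHS](pa_mul1 d) -pa_opE.
  have := congr1 H (E (F one)); rewrite !comp_lfunE zero_lfunE linear0.
  have HFE v : H (F v) = v by rewrite -comp_lfunE HF id_lfunE.
  by rewrite !HFE.
have := congr1 (@pa_x K r n) w0; have := congr1 (@pa_z K r n) w0.
by rewrite !pa_mkE /pa_x /pa_z !linear0.
Qed.

(** The source element has cube zero and hence so has its image, while [pa_c] takes products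
    coordinatewise. *)
Lemma transport_c x z : pa_c (transport (nil x z)) = 0.
Proof.
set w := transport (nil x z).
have cube : pa_mul d' w (pa_mul d' w w) = 0.
  rewrite -(transportM x z x z); set q := pencil d x x.
  have -> : pa_mul d' w (transport (nil 0 q)) = transport (nil 0 (pencil d x 0)).
    by rewrite (transportM x z 0 q).
  by rewrite pencilr0 /pa_mk !row_mx0 linear0.
apply/rowP=> i; have := congr1 (fun v => pa_c v 0 i) cube.
rewrite /pa_mul !pa_mkE !mxE => /eqP.
by rewrite !mulf_eq0 !orbb => /eqP.
Qed.

Lemma transport_nil x z : transport (nil x z) = nil (pa_x (transport (nil x z))) (pa_z (transport
  (nil x z))).
Proof. by rewrite -[LHS]pa_mkK transport_c. Qed.

Lemma transport_pencil x x' : transport (nil 0 (pencil d x x')) =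
  nil 0 (pencil d' (pa_x (transport (nil x 0))) (pa_x (transport (nil x' 0)))).
Proof.
rewrite -(pa_mul_nil d' _ (pa_z (transport (nil x 0))) _ (pa_z (transport (nil x' 0)))).
by rewrite -!transport_nil -transportM.
Qed.

Lemma transport_x z : pa_x (transport (nil 0 z)) = 0.
Proof.
pose e i : 'rV[K]_n := delta_mx 0 i.
have ee (i : 'I_n) j : pencil d (e i) (e i) 0 j = d i ^+ j.
  rewrite mxE (bigD1 i) //= big1 ?addr0 => [|k ki]; rewrite !mxE ?eqxx ?mulr1 //.
  by rewrite (negPf ki) mulr0 mulr0.
(* Since [d 0 = 0] and [d 1 = 1], the squares of [e 0] and [e 1] are [(1, 0)] and [(1, 1)], a basis
   of the plane; so every element of the plane is a combination of products, and products are sent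
   into the plane. *)
have zE : nil (0 : 'rV[K]_n) z = (z 0 0 - z 0 1) *: nil 0 (pencil d (e 0) (e 0)) +
    (z 0 1 *: nil 0 (pencil d (e 1) (e 1)) + nil 0 0).
  rewrite !pa_mkD !scaler0 !addr0; congr pa_mk; apply/rowP=> j.
  rewrite [RHS]mxE [in RHS]mxE [in X in _ = _ + X]mxE !ee d0 d1 expr1n mulr1.
  case: (unliftP 0 j) => [k ->|->].
    rewrite (_ : lift 0 k = 1); last by apply: val_inj; case: k => -[].
    by rewrite expr1 mulr0 add0r.
  by rewrite expr0 mulr1 subrK.
have e0 : nil 0 0 = 0 :> V by rewrite /pa_mk !row_mx0.
by rewrite zE e0 addr0 linearP linearZ /= pa_xD transport_pencil pa_mkE
  transport_pencil /pa_x !linearZ /= -/(pa_x _) pa_mkE !scaler0 addr0.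
Qed.

Lemma pencil_conj_moebius : exists2 C : 'M[K]_2,
  C 0 0 * C 1 1 - C 0 1 * C 1 0 != 0 & forall i, C 0 0 + d i * C 1 0 != 0 /\
    exists k, C 0 1 + d i * C 1 1 = (C 0 0 + d i * C 1 0) * d' k.
Proof.
pose p (x : 'rV[K]_n) := pa_x (transport (nil x 0)).
pose c (z : 'rV[K]_2) := pa_z (transport (nil 0 z)).
have p_linear : linear p.
  move=> a x y; rewrite /p -pa_xD -linearP pa_mkD.
  by rewrite !scaler0 !addr0.
have c_linear : linear c.
  move=> a x y; rewrite /c -pa_zD -linearP pa_mkD.
  by rewrite !scaler0 !addr0.
pose P := lin1_mx (HB.pack_for {linear 'rV[K]_n -> 'rV[K]_n} p
  (GRing.isSemilinear.Build _ _ _ _ p (GRing.semilinear_linear p_linear))).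
pose C := lin1_mx (HB.pack_for {linear 'rV[K]_2 -> 'rV[K]_2} c
  (GRing.isSemilinear.Build _ _ _ _ c (GRing.semilinear_linear c_linear))).
have PE x : x *m P = p x by rewrite mul_rV_lin1.
have CE z : z *m C = c z by rewrite mul_rV_lin1.
have [||D0 CP] := @moebius K n d d' P C.
- by move=> x y; rewrite !PE CE /c transport_pencil pa_mkE.
- move=> z; rewrite CE => cz0; have [|_ //] := @transport_inj 0 z.
  by rewrite transport_nil transport_x -/(c z) cz0 /pa_mk !row_mx0.
by exists C.
Qed.

End PencilEquivalence.

(** * Cross ratios and infinitely many classes *)

Lemma phm_equiv_common (K : fieldType) (G : linAlgGroup K) (M N L : prehomModule G) :
  phm_equiv M L -> phm_equiv N L -> phm_equiv M N.
Proof.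
move=> [f [h [hf fh im]]] [f' [h' [hf' fh' im']]].
have hfE v : h (f v) = v by rewrite -comp_lfunE hf id_lfunE.
have fhE v : f (h v) = v by rewrite -comp_lfunE fh id_lfunE.
have hfE' v : h' (f' v) = v by rewrite -comp_lfunE hf' id_lfunE.
have fhE' v : f' (h' v) = v by rewrite -comp_lfunE fh' id_lfunE.
exists (h' \o f)%VF, (h \o f')%VF; split; try by apply/lfunP=> v;
  rewrite !comp_lfunE id_lfunE ?fhE' ?fhE ?hfE ?hfE'.
move=> a; rewrite im im'; set b := (f' \o _ \o _)%VF.
suffices -> : b = (f \o a \o h)%VF by [].
by apply/lfunP=> v; rewrite !comp_lfunE !fhE'.
Qed.

(** For the points 0, 1, 2, [la] the ratio of [(m0 - m3) (m1 - m2)] to [(m0 - m2) (m1 - m3)] is that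
    of [la] to [2 (la - 1)]; the formula solves this for [la]. *)
Definition cross_ratio_solution (K : fieldType) (m0 m1 m2 m3 : K) :=
  2 * ((m0 - m3) * (m1 - m2)) / (2 * ((m0 - m3) * (m1 - m2)) - (m0 - m2) * (m1 - m3)).

(** A homography multiplies the difference of two points [t], [t'] by its determinant divided by
    [(a + t c) (a + t' c)]; in both products of differences the same four denominators occur, so
    their ratio is unchanged. *)
Lemma cross_ratio (K : fieldType) (a b c e la : K) (m0 m1 m2 m3 : K) :
  2 != 0 :> K -> la != 0 -> a * e - b * c != 0 ->
  (forall t m, (t, m) \in [:: (0, m0); (1, m1); (2, m2); (la, m3)] ->
     a + t * c != 0 /\ b + t * e = (a + t * c) * m) ->
  la = cross_ratio_solution m0 m1 m2 m3.
Proof.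
move=> two0 la0 D0 mP.
have diff t m t' m' : (t, m) \in [:: (0, m0); (1, m1); (2, m2); (la, m3)] ->
    (t', m') \in [:: (0, m0); (1, m1); (2, m2); (la, m3)] ->
    (a + t * c) * (a + t' * c) * (m - m') = (a * e - b * c) * (t - t').
  move=> /mP[t0 tE] /mP[t'0 t'E].
  transitivity ((a + t' * c) * ((a + t * c) * m) - (a + t * c) * ((a + t' * c) * m'));
    first by ring.
  by rewrite -tE -t'E; ring.
pose T := [:: (0, m0); (1, m1); (2, m2); (la, m3)].
have T0 : (0, m0) \in T by rewrite !inE eqxx.
have T1 : (1, m1) \in T by rewrite !inE eqxx !orbT.
have T2 : (2, m2) \in T by rewrite !inE eqxx !orbT.
have T3 : (la, m3) \in T by rewrite !inE eqxx !orbT.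
pose u t := a + t * c.
have [u0 _] := mP _ _ T0; have [u1 _] := mP _ _ T1.
have [u2 _] := mP _ _ T2; have [u3 _] := mP _ _ T3.
have E03 := diff _ _ _ _ T0 T3; have E12 := diff _ _ _ _ T1 T2.
have E02 := diff _ _ _ _ T0 T2; have E13 := diff _ _ _ _ T1 T3.
set p := a + 0 * c in u0 E03 E02; set q := a + 1 * c in u1 E12 E13.
set v := a + 2 * c in u2 E12 E02; set w := a + la * c in u3 E03 E13.
rewrite /cross_ratio_solution; set X := (m0 - m3) * (m1 - m2); set Y := (m0 - m2) * (m1 - m3).
have N0 : p * w * (q * v) != 0 by rewrite !mulf_neq0.
set D := a * e - b * c in D0 E03 E12 E02 E13.
have XE : p * w * (q * v) * X = D ^+ 2 * la.
  by rewrite /X mulrACA E03 E12; ring.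
have YE : p * w * (q * v) * Y = D ^+ 2 * - (2 * (1 - la)).
  transitivity (p * v * (m0 - m2) * (q * w * (m1 - m3))); first by rewrite /Y; ring.
  by rewrite E02 E13; ring.
have ZE : p * w * (q * v) * (2 * X - Y) = 2 * D ^+ 2.
  transitivity (2 * (p * w * (q * v) * X) - p * w * (q * v) * Y); first by ring.
  by rewrite YE XE; ring.
(* Up to the nonzero denominators, the expression equals [2 D^2], whatever [la] is. *)
have Z0 : 2 * X - Y != 0.
  apply: contraTneq (mulf_neq0 two0 (mulf_neq0 D0 D0)) => Z0; rewrite -expr2 -ZE Z0 mulr0.
  by rewrite eqxx.
apply: (mulIf Z0); rewrite divfK //; apply: (mulfI N0).
transitivity (la * (p * w * (q * v) * (2 * X - Y))); first by ring.
rewrite ZE; transitivity (2 * (p * w * (q * v) * X)); last by ring.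
by rewrite XE; ring.
Qed.

(* The tuple [0, 1, 2, la, la, ...]: the default of [nth] pads the list. *)
Definition four_points (K : fieldType) m (la : K) (i : 'I_m.+4) := nth la [:: 0; 1; 2] i.

(** The images of the four points are only known to lie among 0, 1, 2 and [mu], so all [4^4]
    assignments are listed; only the finiteness of the list matters. *)
Definition equivalent_parameters (K : fieldType) (mu : K) : seq K :=
  let S := [:: 0; 1; 2; mu] in
  let SS := [seq (x, y) | x <- S, y <- S] in
  [seq cross_ratio_solution x.1 x.2 y.1 y.2 | x <- SS, y <- SS].

Lemma four_points_mem (K : fieldType) m (mu : K) (i : 'I_m.+4) :
  four_points mu i \in [:: 0; 1; 2; mu].
Proof. by case: i => -[|[|[|[|i]]]] ?; rewrite /four_points /= !inE eqxx ?orbT. Qed.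

Lemma pencil_module_parameter (K : closedFieldType) (G : linAlgGroup K) r m
  (two_neq0 : 2 != 0 :> K) f h f_regular fP hP fM (la mu : K) : la != 0 ->
  phm_equiv
    (@pencil_module K G r m.+4 two_neq0 f h f_regular fP hP fM (four_points la))
    (@pencil_module K G r m.+4 two_neq0 f h f_regular fP hP fM (four_points mu)) ->
  la \in equivalent_parameters mu.
Proof.
move=> la0 [F [H [HF FH im]]].
have [||w w0|C C0 CP] := @pencil_conj_moebius K r m (four_points la) (four_points mu)
  _ _ F H HF FH; first by [].
- by [].
- have /im/pencil_image : phm_image (M := @pencil_module K G r m.+4 two_neq0 f h
    f_regular fP hP fM (four_points la)) (pa_op (four_points la) w).
    by apply/pencil_image; exists w.
  by [].
have kP (t : 'I_m.+4) : exists k, C 0 0 + four_points la t * C 1 0 != 0 /\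
    C 0 1 + four_points la t * C 1 1 = (C 0 0 + four_points la t * C 1 0) * four_points mu (k :
      'I_m.+4).
  by have [t0 [k kE]] := CP t; exists k.
have [k0 P0] := kP ord0; have [k1 P1] := kP (inord 1).
have [k2 P2] := kP (inord 2); have [k3 P3] := kP (inord 3).
have -> : la = cross_ratio_solution (four_points mu k0) (four_points mu k1)
    (four_points mu k2) (four_points mu k3).
  apply: (cross_ratio two_neq0 la0 C0) => t x; rewrite !inE.
  rewrite /four_points !inordK //= in P1 P2 P3.
  by case/or4P=> /eqP[-> ->].
by apply: (allpairs_f _ (x := (_, _)) (y := (_, _)));
  apply: allpairs_f; apply: four_points_mem.
Qed.

Lemma infinitely_many_pencil_modules (K : closedFieldType) (G : linAlgGroup K) r m :
  (forall n, (n%:R == 0 :> K) = (n == 0%N)) -> has_rank_corank G r.+1 (m.+4 + 2) ->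
  ~ finitely_many_prehomModules G.
Proof.
move=> natr0 [f [h [[f_regular _] fP hP fM]]] [k [L LP]].
have two_neq0 : 2 != 0 :> K by rewrite natr0.
pose M la := @pencil_module K G r m.+4 two_neq0 f h f_regular fP hP fM (four_points la).
(* For each class in the list that contains a pencil module, one parameter [mu i] is fixed;
   comparison with it bounds the other parameters in that class. *)
have [mu muP] : exists mu : 'I_k -> K, forall i la, la != 0 -> phm_equiv (M la) (L i) ->
    phm_equiv (M (mu i)) (L i).
  apply: (@choice _ _ (fun i x => forall la, la != 0 -> phm_equiv (M la) (L i) -> phm_equiv (M x)
    (L i))).
  move=> i; have [[x xP]|nx] := classic (exists x, phm_equiv (M x) (L i)); first by exists x.
  by exists 0 => la _ laP; case: nx; exists la.
pose E := flatten [seq equivalent_parameters (mu i) | i <- enum 'I_k].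
have inE la : la != 0 -> la \in E.
  move=> la0; have [i laP] := LP (M la); apply/flattenP.
  exists (equivalent_parameters (mu i)); first by apply/mapP; exists i; rewrite ?mem_enum.
  exact: pencil_module_parameter la0 (phm_equiv_common laP (muP i la la0 laP)).
(* One more distinct nonzero parameter than the finite list [E] has entries. *)
pose N := [seq i.+1%:R : K | i <- iota 0 (size E).+1].
have uN : uniq N.
  by rewrite map_inj_in_uniq ?iota_uniq // => i j _ _ /(natr_injK natr0)[].
have sN : {subset N <= E} by move=> x /mapP[i _ ->]; apply: inE; rewrite natr0.
by have := uniq_leq_size uN sN; rewrite size_map size_iota ltnn.
Qed.

Local Close Scope ring_scope.

Theorem corollary1 (K : closedFieldType) (charK : [pchar K]%R =i pred0)
    (G : linAlgGroup K) (connG : lag_connected G) (commG : lag_commutative G)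
    (r s : nat) (rsG : has_rank_corank G r s)
    (not_degenerate : ~ (r = 0 /\ 5 < s)) :
  finitely_many_prehomModules G <-> s <= 5.
Proof.
have natr0 := (pcharf0P K).1 charK.
split; last exact: finitely_many_small natr0 commG rsG.
move=> fin; rewrite leqNgt; apply/negP=> s5.
(* A nonzero algebra contains the invertible scalars, a multiplicative group inside its unit group.
   So for rank 0 and corank above 5 there is no module at all, and this case is excluded; positive
   rank provides the residue coordinate of the local factor. *)
case: r rsG not_degenerate => [_ []//|r rsG _].
have [m sE] : exists m, s = (m.+4 + 2)%N by exists (s - 6)%N; lia.
by rewrite sE in rsG; apply: infinitely_many_pencil_modules natr0 rsG fin.
Qed.
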